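(* Let $N\subset\mathbb R^n$ be a star-shaped $n$-dimensional submanifold with corners, let $W$ be a finite-dimensional non-positively graded real vector space, $U\subset W^0$ open, and $Q$ a differential on $\mathcal A_{W|_U}$. A form $A\in\Omega(N,W|_U)^0$ satisfies $$dA=C_Q(A)$$ if and only if the form $$B=A-h(C_Q(A))\in\Omega(N,W)^0$$ satisfies $dB=0$.
   Context: $W=\bigoplus_{k\ge0}W^{-k}$, $W^{<0}=\bigoplus_{k>0}W^{-k}$. $\mathcal A_{W|_U}=C^\infty(U)\otimes S((W^{<0})^* )$ is the graded-commutative algebra with $(W^{-k})^*$ in degree $k$; a differential $Q$ is a degree 1 derivation with $Q^2=0$. $\Omega(N,W)^m=\bigoplus_{k\ge0}\Omega^{m+k}(N)\otimes W^{-k}$, and $\Omega(N,W|_U)^0\subset\Omega(N,W)^0$ is the set of $A$ whose 0-form part is a map $N\to U\subset W^0$. Let $\xi^i$ be a homogeneous basis of $W^*$ (degree-0 ones being linear coordinates on $U$), $e_i$ the dual basis, $A^i=\langle A,\xi^i\rangle\in\Omega^{\deg\xi^i}(N)$, $C_Q^i=Q\xi^i\in\mathcal A_{W|_U}$. $C_Q^i(A)\in\Omega(N)$ is obtained by substituting $A^j$ for $\xi^j$ in $C_Q^i$ (i.e. the image of $C_Q^i$ under the graded algebra morphism $\mathcal A_{W|_U}\to\Omega(N)$ sending $\xi^j\mapsto A^j$), and $C_Q(A)=\sum_iC_Q^i(A)e_i\in\Omega(N,W)^1$; so $dA=C_Q(A)$ means $dA^i=C^i_Q(A)$ for all $i$.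 Star-shaped means $0\in N$ and $tx\in N$ for $x\in N$, $t\in[0,1]$. $h:\Omega^\bullet(N)\to\Omega^{\bullet-1}(N)$ is the de Rham homotopy operator $h\alpha=\int_0^1 i_{\partial_t}(R^*\alpha)\,dt$, $R:N\times[0,1]\to N$, $R(x,t)=tx$, applied componentwise to $W$-valued forms. *)

(* Defs.v *)
From mathcomp Require Import all_boot all_order all_algebra.
From mathcomp Require Import all_classical all_reals all_analysis.

Set Implicit Arguments.
Unset Strict Implicit.
Unset Printing Implicit Defensive.

Import Order.TTheory GRing.Theory Num.Theory.
Import numFieldNormedType.Exports.

Local Open Scope classical_set_scope.
Local Open Scope ring_scope.

Section Smooth.
Context {R : realType}.

(* Used for finite-dimensional E and open V only. *)
Fixpoint Ck {E F : normedModType R} (k : nat) (V : set E) (f : E -> F) : Prop :=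
  if k is k'.+1 then
    (forall x, V x -> differentiable f x) /\
    (forall v, Ck k' V (fun x => 'D_v f x))
  else forall x, V x -> {for x, continuous f}.

Definition smooth {E F : normedModType R} (V : set E) (f : E -> F) : Prop :=
  forall k, Ck k V f.

(* Codimension-0 submanifolds of R^n: near each point, a diffeomorphism between
   open subsets of R^n straightens N to [0,oo[^k x R^(n-k). *)
Definition submanifold_with_corners {n : nat} (N : set 'rV[R]_n) : Prop :=
  forall x, N x ->
    exists (V V' : set 'rV[R]_n) (phi psi : 'rV[R]_n -> 'rV[R]_n) (k : nat),
      [/\ open V, V x, open V', smooth V phi & smooth V' psi] /\
      [/\ forall y, V y -> V' (phi y) /\ psi (phi y) = y,
          forall z, V' z -> V (psi z) /\ phi (psi z) = z &
          forall y, V y ->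
            (N y <-> forall i : 'I_n, (i < k)%N -> 0 <= phi y 0 i)].

Definition star_shaped {n : nat} (N : set 'rV[R]_n) : Prop :=
  N 0 /\ forall x (t : R), N x -> 0 <= t <= 1 -> N (t *: x).

(* g is a smooth extension of f|_N to a neighbourhood V of x. *)
Definition local_extension {n : nat} (N : set 'rV[R]_n) (f : 'rV[R]_n -> R)
    (x : 'rV[R]_n) (V : set 'rV[R]_n) (g : 'rV[R]_n -> R) : Prop :=
  [/\ open V, V x, smooth V g & forall y, V y -> N y -> g y = f y].

Definition smooth_on {n : nat} (N : set 'rV[R]_n) (f : 'rV[R]_n -> R) : Prop :=
  forall x, N x -> exists V g, local_extension N f x V g.

(* The derivative at x in N is that of any local smooth extension; it does not
   depend on the extension when N is a codimension-0 submanifold with corners,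
   since N is then contained in the closure of its interior. *)
Definition derive_on {n : nat} (N : set 'rV[R]_n) (f : 'rV[R]_n -> R)
    (x v : 'rV[R]_n) : R :=
  xget 0 [set D | exists V g, local_extension N f x V g /\ D = 'D_v g x].

End Smooth.

(* Differential forms on a subset of a normed space E with trivialised tangent
   bundle.  [a x vs] is the value at x of the component of degree [size vs] of
   the (inhomogeneous) form a on the tangent vectors vs.  Values outside of the
   subset of E under consideration are irrelevant. *)
Definition dform (E V : Type) := E -> seq E -> V.

Section Forms.
Context {R : realType}.

Definition multilinear {E : lmodType R} (w : seq E -> R) : Prop :=
  forall s1 s2 (c : R) u v,
    w (s1 ++ (c *: u + v) :: s2) = c * w (s1 ++ u :: s2) + w (s1 ++ v :: s2).

Definition is_alternating {E : Type} (w : seq E -> R) : Prop :=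
  forall s1 s2 s3 v, w (s1 ++ v :: s2 ++ v :: s3) = 0.

Definition is_form {n : nat} (N : set 'rV[R]_n) (a : dform 'rV[R]_n R) : Prop :=
  [/\ forall x, N x -> multilinear (a x),
      forall x, N x -> is_alternating (a x) &
      forall vs, smooth_on N (fun x => a x vs)].

Definition form1 {E : Type} : dform E R := fun _ vs => (size vs == 0%N)%:R.

Definition shuffle_inv {k : nat} (m : k.-tuple bool) : nat :=
  (\sum_(i < k) \sum_(j < i) (~~ nth false m j && nth false m i))%N.

(* Sum over shuffles: the vectors selected by the mask m are fed to a, the
   others to b. *)
Definition fwedge {E : Type} (a b : dform E R) : dform E R := fun x vs =>
  \sum_(m : (size vs).-tuple bool)
    (-1) ^+ shuffle_inv m * (a x (mask m vs) * b x (mask (map negb m) vs)).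

Definition fwedgeX {E : Type} (a : dform E R) (k : nat) : dform E R :=
  iter k (fwedge a) form1.

Definition ext_d {n : nat} (N : set 'rV[R]_n) (a : dform 'rV[R]_n R) :
    dform 'rV[R]_n R := fun x vs =>
  \sum_(i < size vs)
    (-1) ^+ i *
    derive_on N (fun y => a y (take i vs ++ drop i.+1 vs)) x (nth 0 vs i).

Definition pullback {E E' : normedModType R} (f : E -> E') (a : dform E' R) :
    dform E R :=
  fun z vs => a (f z) (map ('d f z : E -> E') vs).

Definition interior_product {E : Type} (X : E -> E) (a : dform E R) : dform E R :=
  fun z vs => a z (X z :: vs).

Definition ray_map {n : nat} (z : 'rV[R]_n * R) : 'rV[R]_n := z.2 *: z.1.

Definition partial_t {n : nat} (z : 'rV[R]_n * R) : 'rV[R]_n * R := (0, 1).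

Definition homotopy_op {n : nat} (a : dform 'rV[R]_n R) : dform 'rV[R]_n R :=
  fun x vs =>
    \int[lebesgue_measure]_(t in `[0%R, 1%R])
      interior_product partial_t (pullback ray_map a)
        (x, t) [seq (v, 0) | v <- vs].

End Forms.

Section Graded.
Context {R : realType} {W : vectType R}.

(* [gr k] is the homogeneous component of W in degree -k. *)
Definition is_grading (gr : nat -> {vspace W}) : Prop :=
  exists K : nat,
    [/\ forall k, (K <= k)%N -> gr k = 0%VS,
        (\sum_(k < K) gr k)%VS = fullv &
        directv (\sum_(k < K) gr k)%VS].

(* The dual basis xi^i is [coord e i], of degree [deg i]. *)
Definition homogeneous_basis {p : nat} (gr : nat -> {vspace W})
    (e : p.-tuple W) (deg : 'I_p -> nat) : Prop :=
  basis_of fullv e /\ forall i : 'I_p, e`_i \in gr (deg i).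

Context {p : nat} (e : p.-tuple W) (deg : 'I_p -> nat).

(* The linear surjection of R^p onto W^0 forgetting the coordinates of nonzero
   degree.  The topology and the smooth functions of W^0 are those induced along
   it: a subset of W^0 is open, a function on it is smooth, iff its preimage,
   resp. its composite with the surjection, is so in R^p. *)
Definition param0 (x : 'rV[R]_p) : W := \sum_(i | deg i == 0%N) x 0 i *: e`_i.

Definition open_in_W0 (U : set W) : Prop := open (param0 @^-1` U).

(* C^oo(U): functions on U are extended by 0 outside of U, so that equality on U
   is equality. *)
Definition smooth_fun (U : set W) (f : W -> R) : Prop :=
  smooth (param0 @^-1` U) (f \o param0) /\ forall w, ~ U w -> f w = 0.

(* [m] stands for the ordered monomial prod_i (xi^i)^(m i) of S((W^{<0})^* ). *)
Definition monomial := {ffun 'I_p -> nat}.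

Definition admissible (m : monomial) : bool :=
  [forall i, ((deg i == 0) ==> (m i == 0)) && (odd (deg i) ==> (m i <= 1))]%N.

Definition mdeg (m : monomial) : nat := (\sum_i m i * deg i)%N.

Definition madd (m1 m2 : monomial) : monomial := [ffun i => m1 i + m2 i]%N.

(* Exponent of the sign for sorting the product of two ordered monomials. *)
Definition koszul (m1 m2 : monomial) : nat :=
  (\sum_(i < p) \sum_(j < p | j < i) (m1 i * deg i) * (m2 j * deg j))%N.

(* [a m] is the coefficient in C^oo(U) of the monomial m. *)
Definition prealg := monomial -> W -> R.

Definition in_AWU (U : set W) (a : prealg) : Prop :=
  [/\ finite_set [set m | a m <> cst 0],
      forall m, ~~ admissible m -> a m = cst 0 &
      forall m, smooth_fun U (a m)].

Definition alg_homogeneous (k : nat) (a : prealg) : Prop :=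
  forall m, a m <> cst 0 -> mdeg m = k.

Definition alg_lin (c : R) (a b : prealg) : prealg :=
  fun m w => c * a m w + b m w.

Definition alg_mul (a b : prealg) : prealg := fun m w =>
  if admissible m then
    \sum_(x \in [set x : monomial * monomial | madd x.1 x.2 = m])
      (-1) ^+ koszul x.1 x.2 * (a x.1 w * b x.2 w)
  else 0.

(* xi^i as an element of the algebra: a coordinate function on U if deg i = 0, a
   generator of the symmetric algebra otherwise. *)
Definition alg_gen (U : set W) (i : 'I_p) : prealg := fun m =>
  patch (cst 0) U
    (fun w => if deg i == 0%N then (m == [ffun=> 0%N])%:R * coord e i w
              else (m == [ffun j => nat_of_bool (j == i)])%:R).

Definition is_differential (U : set W) (Q : prealg -> prealg) : Prop :=
  [/\ forall a, in_AWU U a -> in_AWU U (Q a),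
      forall c a b, in_AWU U a -> in_AWU U b ->
        Q (alg_lin c a b) = alg_lin c (Q a) (Q b),
      forall k a, in_AWU U a -> alg_homogeneous k a ->
        alg_homogeneous k.+1 (Q a),
      forall k a b, in_AWU U a -> in_AWU U b -> alg_homogeneous k a ->
        Q (alg_mul a b) =
        alg_lin ((-1) ^+ k) (alg_mul a (Q b)) (alg_mul (Q a) b) &
      forall a, in_AWU U a -> Q (Q a) = (fun _ => cst 0)].

Context {n : nat} (N : set 'rV[R]_n).

Definition component (A : dform 'rV[R]_n W) (i : 'I_p) : dform 'rV[R]_n R :=
  fun x vs => coord e i (A x vs).

Definition of_components (a : 'I_p -> dform 'rV[R]_n R) : dform 'rV[R]_n W :=
  fun x vs => \sum_i a i x vs *: e`_i.

(* Omega(N,W)^d: the component of form degree k+d takes values in W^{-k}. *)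
Definition Omega (gr : nat -> {vspace W}) (d : nat) (A : dform 'rV[R]_n W) :
    Prop :=
  [/\ forall i, is_form N (component A i),
      forall x vs k, N x -> size vs = (k + d)%N -> A x vs \in gr k &
      forall x vs, N x -> (size vs < d)%N -> A x vs = 0].

Definition Omega0_over (gr : nat -> {vspace W}) (U : set W)
    (A : dform 'rV[R]_n W) : Prop :=
  Omega gr 0 A /\ forall x, N x -> U (A x [::]).

Definition wd (A : dform 'rV[R]_n W) : dform 'rV[R]_n W :=
  of_components (fun i => ext_d N (component A i)).

Definition wh (A : dform 'rV[R]_n W) : dform 'rV[R]_n W :=
  of_components (fun i => homotopy_op (component A i)).

Definition form_monomial (A : dform 'rV[R]_n W) (m : monomial) :
    dform 'rV[R]_n R :=
  \big[fwedge/form1]_(i < p) fwedgeX (component A i) (m i).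

(* The substitution xi^j |-> A^j; the sum has finite support for a in the
   algebra. *)
Definition substitute (a : prealg) (A : dform 'rV[R]_n W) : dform 'rV[R]_n R :=
  fun x vs =>
    \sum_(m \in [set: monomial]) a m (A x [::]) * form_monomial A m x vs.

Definition C_of (U : set W) (Q : prealg -> prealg) (A : dform 'rV[R]_n W) :
    dform 'rV[R]_n W :=
  of_components (fun i => substitute (Q (alg_gen U i)) A).

Definition form_eq (A B : dform 'rV[R]_n W) : Prop :=
  forall x, N x -> A x = B x.

Definition form_sub (A B : dform 'rV[R]_n W) : dform 'rV[R]_n W :=
  fun x vs => A x vs - B x vs.

Definition form0 : dform 'rV[R]_n W := fun _ _ => 0.

End Graded.

(* Main.v *)
(* Put E = dA - C_Q(A).  Every component of C_Q(A) has positive form degree, so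
   the homotopy formula gives dB = E + h d(C_Q(A)).  Substituting A for xi is an
   algebra morphism Phi, and d Phi - Phi Q is a derivation along Phi whose value
   on xi^j is E^j.  As Q^2 = 0, its value on Q xi^i is d(C_Q^i(A)), which is
   therefore bounded, on each ray {t x}, by a multiple of the coefficients of E.
   Hence E = 0 implies dB = 0; and if dB = 0, then E = - h d(C_Q(A)), and
   Gronwall's inequality along the ray forces E = 0.  The derivation property on
   C^oo(U) rests on Hadamard's lemma, made global by bump functions. *)

Require Import Defs.
From mathcomp Require Import all_boot all_order all_algebra.
From mathcomp Require Import all_classical all_reals all_analysis.
From mathcomp Require Import ring lra zify.
From HB Require Import structures.

Import Order.TTheory GRing.Theory Num.Theory.
Import numFieldNormedType.Exports.
Local Open Scope classical_set_scope.
Local Open Scope ring_scope.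

(** * Signed shuffle products of functions on words *)

(** Gronwall's inequality needs E = - h d(C_Q(A)) to close up on finitely many scalar functions of
    one variable. Fix x and vs, and let L be the list x :: vs. A wedge product evaluated on a word
    involves only subwords of it, and h at the point s x inserts one extra vector, s x, a multiple
    of a letter of L. So the values of the E^j at the points t x on words over L control each other,
    and they are finite in number because E^j has pure form degree deg j + 1. All constants may
    depend on x and vs. This is also why forms are treated pointwise as functions on words: the
    product and d obey recursions on the first letter, and no basis of the exterior algebra appears.
    Corners enter only through the density of the interior of N, which makes derivatives at boundary
    points well defined. Since Q is given purely algebraically, its action on C^oo(U) by a chain
    rule has to be derived; after that d and Q produce the same partial derivatives, and their
    difference on a function is a combination of the E^i. *)

Section WordProduct.
Context {R : realType} {E : Type}.
Implicit Types (a b c : seq E -> R) (v : E) (vs w : seq E).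

(* [fwedge] at a point. *)
Definition wshuf a b : seq E -> R := fun vs =>
  \sum_(m : (size vs).-tuple bool)
    (-1) ^+ shuffle_inv m * (a (mask m vs) * b (mask (map negb m) vs)).

(** The parity automorphism. It carries the sign of every antiderivation below, so that Leibniz
    rules hold for inhomogeneous forms as well. *)
Definition wsgn a : seq E -> R := fun w => (-1) ^+ size w * a w.

Definition contr v a : seq E -> R := fun w => a (v :: w).

Definition wunit : seq E -> R := fun w => (size w == 0%N)%:R.

Lemma wshuf_nil a b : wshuf a b [::] = a [::] * b [::].
Proof.
rewrite /wshuf /= (big_pred1 [tuple]) => [|m]; last by apply/esym/eqP; rewrite [m]tuple0.
by rewrite /= /shuffle_inv big_ord0 expr0 mul1r.
Qed.

(** A leading [false] is inverted with each later [true]; a leading [true] with nothing. This count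
    becomes the parity sign in the recursion for the product. *)
Lemma shuffle_inv_cons k (b : bool) (m : k.-tuple bool) :
  shuffle_inv [tuple of b :: m] = (shuffle_inv m + ~~ b * count id m)%N.
Proof.
rewrite /shuffle_inv big_ord_recl big_ord0 add0n.
under eq_bigr => i _ do rewrite big_ord_recl /=.
rewrite big_split /= addnC; congr (_ + _)%N.
rewrite -(big_mkord xpredT (fun i => (~~ b && nth false m i : nat))%N) /=.
have := size_tuple m; move: (tval m) => s <- {m}.
rewrite (_ : count id s = \sum_(0 <= i < size s) nth false s i)%N.
  rewrite big_distrr; apply: eq_bigr => i _; by case: b; case: nth.
by rewrite -sumn_count sumnE big_map (big_nth false).
Qed.

Lemma sum_tupleS k (F : k.+1.-tuple bool -> R) :
  \sum_m F m = \sum_(m : k.-tuple bool) (F [tuple of true :: m] + F [tuple of false :: m]).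
Proof.
rewrite big_split /=.
rewrite (bigID (fun m : k.+1.-tuple bool => thead m)) /=; congr (_ + _).
- rewrite (reindex (fun m : k.-tuple bool => [tuple of true :: m])) /=.
    by apply: eq_bigl => m; rewrite theadE.
  exists (fun m : k.+1.-tuple bool => [tuple of behead m]) => m.
    by move=> _; exact/val_inj.
  by case/tupleP: m => x m; rewrite -topredE /= theadE => hx; apply/val_inj; rewrite /= hx.
- rewrite (reindex (fun m : k.-tuple bool => [tuple of false :: m])) /=.
    by apply: eq_bigl => m.
  exists (fun m : k.+1.-tuple bool => [tuple of behead m]) => m.
    by move=> _; exact/val_inj.
  by case/tupleP: m => x m; rewrite -topredE /= theadE => /negbTE hx; apply/val_inj; rewrite /= hx.
Qed.

(* Contraction is an antiderivation.  This recursion determines the product, so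
   the identities below are proved by induction on words. *)
Lemma wshuf_cons a b v vs :
  wshuf a b (v :: vs) = wshuf (contr v a) b vs + wshuf (wsgn a) (contr v b) vs.
Proof.
rewrite /wshuf /= sum_tupleS big_split /=; congr (_ + _); apply: eq_bigr => m _.
  by rewrite shuffle_inv_cons mul0n addn0.
rewrite shuffle_inv_cons mul1n exprD /wsgn /contr size_mask ?size_tuple //.
by rewrite !mulrA.
Qed.

Lemma wshufDl a a' b vs :
  wshuf (fun w => a w + a' w) b vs = wshuf a b vs + wshuf a' b vs.
Proof. by rewrite /wshuf -big_split; apply: eq_bigr => m _ /=; ring. Qed.

Lemma wshufDr a b b' vs :
  wshuf a (fun w => b w + b' w) vs = wshuf a b vs + wshuf a b' vs.
Proof. by rewrite /wshuf -big_split; apply: eq_bigr => m _ /=; ring. Qed.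

Lemma wshufZl k a b vs : wshuf (fun w => k * a w) b vs = k * wshuf a b vs.
Proof. by rewrite /wshuf big_distrr; apply: eq_bigr => m _ /=; ring. Qed.

Lemma wshufZr k a b vs : wshuf a (fun w => k * b w) vs = k * wshuf a b vs.
Proof. by rewrite /wshuf big_distrr; apply: eq_bigr => m _ /=; ring. Qed.

Lemma wshuf0l b : wshuf (fun=> 0) b = fun=> 0.
Proof.
by apply/funext => vs; rewrite /wshuf big1// => m _; rewrite mul0r mulr0.
Qed.

Lemma wshuf0r a : wshuf a (fun=> 0) = fun=> 0.
Proof.
by apply/funext => vs; rewrite /wshuf big1// => m _; rewrite !mulr0.
Qed.

Lemma wshuf_suml (I : Type) (r : seq I) P (F : I -> seq E -> R) b vs :
  wshuf (fun w => \sum_(i <- r | P i) F i w) b vs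
  = \sum_(i <- r | P i) wshuf (F i) b vs.
Proof.
rewrite /wshuf exchange_big; apply: eq_bigr => m _ /=.
by rewrite big_distrl big_distrr.
Qed.

Lemma wshuf_sumr (I : Type) (r : seq I) P a (F : I -> seq E -> R) vs :
  wshuf a (fun w => \sum_(i <- r | P i) F i w) vs
  = \sum_(i <- r | P i) wshuf a (F i) vs.
Proof.
rewrite /wshuf exchange_big; apply: eq_bigr => m _ /=.
by rewrite !big_distrr.
Qed.

Lemma contr_wsgn v a : contr v (wsgn a) = fun w => - wsgn (contr v a) w.
Proof. by apply/funext => w; rewrite /contr /wsgn /= exprS; ring. Qed.

Lemma wsgnK a : wsgn (wsgn a) = a.
Proof.
by apply/funext => w; rewrite /wsgn mulrA -exprMn mulrNN mulr1 expr1n mul1r.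
Qed.

Lemma wshufNl a b vs : wshuf (fun w => - a w) b vs = - wshuf a b vs.
Proof.
rewrite -[RHS]mulN1r -wshufZl; congr wshuf.
by apply/funext => w; rewrite mulN1r.
Qed.

Lemma wshufNr a b vs : wshuf a (fun w => - b w) vs = - wshuf a b vs.
Proof.
rewrite -[RHS]mulN1r -wshufZr; congr wshuf.
by apply/funext => w; rewrite mulN1r.
Qed.

Lemma wsgn_wshuf a b : wsgn (wshuf a b) = wshuf (wsgn a) (wsgn b).
Proof.
apply/funext => vs; elim: vs a b => [|v vs IH] a b.
  by rewrite wshuf_nil /wsgn wshuf_nil /= !expr0; ring.
rewrite wshuf_cons !contr_wsgn wshufNl wshufNr -!IH /wsgn wshuf_cons /= exprS.
by rewrite /wsgn; ring.
Qed.

Lemma contr_wshuf v a b :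
  contr v (wshuf a b)
  = fun w => wshuf (contr v a) b w + wshuf (wsgn a) (contr v b) w.
Proof. by apply/funext => w; rewrite /contr wshuf_cons. Qed.

Lemma wshufA a b c : wshuf a (wshuf b c) = wshuf (wshuf a b) c.
Proof.
apply/funext => vs; elim: vs a b c => [|v vs IH] a b c.
  by rewrite !wshuf_nil mulrA.
rewrite !wshuf_cons !contr_wshuf wshufDr wshufDl !IH wsgn_wshuf.
by rewrite addrA.
Qed.

Lemma contr_wunit v : contr v wunit = fun=> 0.
Proof. by apply/funext => w. Qed.

Lemma wsgn_wunit : wsgn wunit = wunit.
Proof.
by apply/funext => -[|v w]; rewrite /wsgn /wunit /= ?expr0 ?mul1r // mulr0.
Qed.

Lemma wshuf1l b : wshuf wunit b = b.
Proof.
apply/funext => vs; elim: vs b => [|v vs IH] b.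
  by rewrite wshuf_nil mul1r.
by rewrite wshuf_cons contr_wunit wshuf0l wsgn_wunit IH add0r.
Qed.

Lemma wshuf1r a : wshuf a wunit = a.
Proof.
apply/funext => vs; elim: vs a => [|v vs IH] a.
  by rewrite wshuf_nil mulr1.
by rewrite wshuf_cons contr_wunit wshuf0r IH addr0.
Qed.

Definition whom (k : nat) a := forall w, size w != k -> a w = 0.

Lemma whom_contr k v a : whom k a -> whom k.-1 (contr v a).
Proof.
move=> ha w hw; rewrite /contr ha //=.
by apply: contra hw => /eqP <-.
Qed.

Lemma whom_contr0 v a : whom 0 a -> contr v a = fun=> 0.
Proof. by move=> ha; apply/funext => w; rewrite /contr ha. Qed.

Lemma whom_wsgn k a : whom k a -> wsgn a = fun w => (-1) ^+ k * a w.
Proof.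
move=> ha; apply/funext => w; rewrite /wsgn.
by have [->//|hw] := eqVneq (size w) k; rewrite ha // !mulr0.
Qed.

Lemma whom_wshuf k l a b : whom k a -> whom l b -> whom (k + l) (wshuf a b).
Proof.
move=> ha hb w hw; rewrite /wshuf big1 // => m _.
have [h1|h1] := eqVneq (size (mask m w)) k; last by rewrite ha // mul0r mulr0.
rewrite hb ?mulr0 //; apply: contra hw => /eqP <-; rewrite -h1.
rewrite !size_mask ?size_map ?size_tuple // count_map.
rewrite -[X in X == _](size_tuple m) -(count_predC id m).
by apply/eqP; congr (_ + _)%N; apply: eq_count.
Qed.

Lemma whom_wunit : whom 0 wunit.
Proof. by move=> w; rewrite /wunit => /negbTE ->. Qed.

(** Contracting with the first letter lowers one of the two degrees by one, so the induction runs
    over all [k] and [l]. Degree 0 is split off because contraction kills it, and the exponents of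
    the other cases would be wrong there. *)
Lemma wshufC k l a b : whom k a -> whom l b ->
  wshuf a b = fun w => (-1) ^+ (k * l) * wshuf b a w.
Proof.
move=> ha hb; apply/funext => vs.
elim: vs k l a b ha hb => [|v vs IH] k l a b ha hb.
  rewrite !wshuf_nil.
  case: k ha => [|k] ha; first by rewrite mul0n expr0; ring.
  by rewrite ha // mul0r !mulr0.
rewrite !wshuf_cons (whom_wsgn _ _ ha) (whom_wsgn _ _ hb) !wshufZl.
case: k ha => [|k] ha.
  case: l hb => [|l] hb.
    by rewrite (whom_contr0 _ _ ha) (whom_contr0 _ _ hb) !wshuf0l !wshuf0r; ring.
  rewrite (whom_contr0 _ _ ha) wshuf0l !wshuf0r.
  have /= hb' := whom_contr _ v _ hb.
  by rewrite (IH _ _ _ _ ha hb') !mul0n; ring.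
have /= ha' := whom_contr _ v _ ha.
rewrite (IH _ _ _ _ ha' hb).
case: l hb => [|l] hb.
  by rewrite (whom_contr0 _ _ hb) wshuf0l !wshuf0r !muln0 expr0; ring.
have /= hb' := whom_contr _ v _ hb.
rewrite (IH _ _ _ _ ha hb').
rewrite !mulnS !mulSn !exprD !exprS.
set x := (-1) ^+ k; set y := (-1) ^+ l; set z := (-1) ^+ (k * l).
have hy : y * y = 1 by rewrite -exprMn mulrNN mulr1 expr1n.
set P := wshuf b _ _; set T := wshuf _ a _.
(* The two sides differ by the factor y * y = 1, which [ring] cannot know. *)
transitivity (y * y * (x * z * P) - x * y * z * T); last by ring.
by rewrite hy; ring.
Qed.

Lemma wshuf_odd_sq k a : whom k a -> odd k -> wshuf a a = fun=> 0.
Proof.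
move=> ha hk; apply/funext => w.
have := congr1 (@^~ w) (wshufC _ _ _ _ ha ha) => /=.
rewrite -signr_odd oddM hk /= expr1 mulN1r => /eqP.
by rewrite -addr_eq0 -mulr2n mulrn_eq0 /= => /eqP.
Qed.

End WordProduct.

(** * Multilinear and alternating functions on words *)

Section WordForms.
Context {R : realType} {E : lmodType R}.
Implicit Types (a b c : seq E -> R) (v : E) (vs w : seq E).

Lemma multilinear_contr v a : multilinear a -> multilinear (contr v a).
Proof. by move=> ha s1 s2 c u u'; have := ha (v :: s1) s2 c u u'. Qed.

Lemma multilinear_wsgn a : multilinear a -> multilinear (wsgn a).
Proof.
move=> ha s1 s2 c u u'; rewrite /wsgn ha !size_cat /=; ring.
Qed.

Lemma multilinear_wshuf a b :
  multilinear a -> multilinear b -> multilinear (wshuf a b).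
Proof.
move=> ha hb s1; elim: s1 a b ha hb => [|x s1 IH] a b ha hb s2 c u v /=.
  rewrite !wshuf_cons.
  have E1 : contr (c *: u + v) a = fun w => c * contr u a w + contr v a w.
    by apply/funext => w; have := ha [::] w c u v.
  have E2 : contr (c *: u + v) b = fun w => c * contr u b w + contr v b w.
    by apply/funext => w; have := hb [::] w c u v.
  by rewrite E1 E2 wshufDl wshufDr wshufZl wshufZr; ring.
rewrite !wshuf_cons !IH //; first by ring.
- exact: multilinear_wsgn.
- exact: multilinear_contr.
- exact: multilinear_contr.
Qed.

(** For multilinear functions this is equivalent to [is_alternating], but two equal neighbours are
    removed by two successive contractions, so this form fits the recursion on the first letter. *)
Definition adj_alternating a :=
  forall s1 s2 v, a (s1 ++ v :: v :: s2) = 0.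

Lemma alternating_adj a : is_alternating a -> adj_alternating a.
Proof. by move=> ha s1 s2 v; exact: (ha s1 [::] s2 v). Qed.

(** Polarisation: expand the vanishing value on the repeated letter u + v. The scalar 1 only matches
    the shape of [multilinear]. *)
Lemma adj_swap a : multilinear a -> adj_alternating a ->
  forall s1 s2 u v, a (s1 ++ u :: v :: s2) = - a (s1 ++ v :: u :: s2).
Proof.
move=> ma ha s1 s2 u v.
have := ha s1 s2 (1 *: u + v).
rewrite ma.
have h x : a (s1 ++ x :: (1 *: u + v) :: s2)
         = a (s1 ++ x :: u :: s2) + a (s1 ++ x :: v :: s2).
  by have := ma (s1 ++ [:: x]) s2 1 u v; rewrite -!catA /= mul1r.
rewrite !h !ha mul1r add0r addr0 => /eqP; rewrite addr_eq0 => /eqP ->.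
by [].
Qed.

Lemma adj_alternatingP a : multilinear a -> adj_alternating a ->
  is_alternating a.
Proof.
move=> ma ha s1 s2; elim: s2 s1 => [|x s2 IH] s1 s3 v; first exact: ha.
rewrite /= (adj_swap _ ma ha).
by have := IH (s1 ++ [:: x]) s3 v; rewrite -!catA /= => ->; rewrite oppr0.
Qed.

Lemma adj_alternating_contr v a :
  adj_alternating a -> adj_alternating (contr v a).
Proof. by move=> ha s1 s2 u; have := ha (v :: s1) s2 u. Qed.

Lemma adj_alternating_wsgn a :
  adj_alternating a -> adj_alternating (wsgn a).
Proof. by move=> ha s1 s2 u; rewrite /wsgn ha mulr0. Qed.

(** At the repeated letter four terms arise. Those contracting the same factor twice vanish; the two
    mixed ones cancel because contraction anticommutes with the parity automorphism. *)
Lemma adj_alternating_wshuf a b :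
  adj_alternating a -> adj_alternating b -> adj_alternating (wshuf a b).
Proof.
move=> ha hb s1; elim: s1 a b ha hb => [|x s1 IH] a b ha hb s2 v /=.
  have E1 : contr v (contr v a) = fun=> 0.
    by apply/funext => w; exact: (ha [::] w v).
  have E2 : contr v (contr v b) = fun=> 0.
    by apply/funext => w; exact: (hb [::] w v).
  rewrite !wshuf_cons E1 E2 wshuf0l wshuf0r contr_wsgn wshufNl.
  by ring.
rewrite wshuf_cons !IH ?addr0 //.
- exact: adj_alternating_wsgn.
- exact: adj_alternating_contr.
- exact: adj_alternating_contr.
Qed.

Lemma alternating_wshuf a b : multilinear a -> multilinear b ->
  is_alternating a -> is_alternating b -> is_alternating (wshuf a b).
Proof.
move=> ma mb ha hb; apply: adj_alternatingP; first exact: multilinear_wshuf.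
by apply: adj_alternating_wshuf; exact: alternating_adj.
Qed.

Lemma alternating_move a : multilinear a -> is_alternating a ->
  forall s1 s2 v, a (v :: s1 ++ s2) = (-1) ^+ size s1 * a (s1 ++ v :: s2).
Proof.
move=> ma /alternating_adj ha s1; elim/last_ind: s1 => [|s1 x IH] s2 v.
  by rewrite /= mul1r.
rewrite cat_rcons IH (adj_swap _ ma ha) size_rcons exprS cat_rcons; ring.
Qed.

Lemma multilinear0 a s1 s2 : multilinear a -> a (s1 ++ 0 :: s2) = 0.
Proof.
move=> ma; have := ma s1 s2 (-1) 0 0.
by rewrite scaler0 addr0 mulN1r addNr.
Qed.

Lemma multilinearZ a s1 s2 (k : R) v : multilinear a ->
  a (s1 ++ k *: v :: s2) = k * a (s1 ++ v :: s2).
Proof.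
by move=> ma; have := ma s1 s2 k v 0; rewrite addr0 multilinear0 // addr0.
Qed.

Lemma multilinear_map_scale a (k : R) : multilinear a -> forall s vs,
  a (s ++ map (fun v => k *: v) vs) = k ^+ size vs * a (s ++ vs).
Proof.
move=> ma s vs; elim: vs s => [|v vs IH] s /=; first by rewrite mul1r.
by rewrite multilinearZ //; have := IH (rcons s v); rewrite !cat_rcons => ->; rewrite exprS mulrA.
Qed.

Lemma multilinear_sum a (I : Type) (r : seq I) (c : I -> R) (v : I -> E) s1 s2 :
  multilinear a ->
  a (s1 ++ (\sum_(i <- r) c i *: v i) :: s2)
  = \sum_(i <- r) c i * a (s1 ++ v i :: s2).
Proof.
move=> ma; elim: r => [|i r IH]; first by rewrite !big_nil multilinear0.
by rewrite !big_cons ma IH.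
Qed.

End WordForms.

(** * Smooth functions on open sets *)

Section DiffBasics.
Context {R : realType}.

(** Turns an explicit epsilon estimate for a candidate differential into both differentiability and
    the value of the differential. *)
Lemma differentiable_crit {V W : normedModType R} (f : V -> W) x
    (L : {linear V -> W}) :
  continuous L ->
  (forall eps : R, 0 < eps ->
    \forall h \near (0 : V), `|f (h + x) - f x - L h| <= eps * `|h|) ->
  differentiable f x /\ 'd f x = L :> (V -> W).
Proof.
move=> Lc fL.
have E : f \o shift x = cst (f x) + L +o_ (0 : V) id.
  apply/eqaddoP => eps eps0; have := fL eps eps0.
  apply: filterS => h /=; rewrite !fctE /=.
  by rewrite opprD addrA.
have D := diff_unique Lc E; split=> //.
by apply/diff_locallyP; rewrite D.
Qed.

Lemma differentiable_small {V W : normedModType R} (f : V -> W) x :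
  differentiable f x -> forall eps : R, 0 < eps ->
    \forall h \near (0 : V), `|f (h + x) - f x - 'd f x h| <= eps * `|h|.
Proof.
move=> /diff_locally/eqaddoP df eps eps0; have := df eps eps0.
by apply: filterS => h /=; rewrite !fctE /= opprD addrA.
Qed.

Lemma near_eq_differentiable {V W : normedModType R} (f g : V -> W) x :
  (\forall y \near x, f y = g y) -> differentiable f x -> differentiable g x.
Proof.
move=> fg df.
have [] // := differentiable_crit g x ('d f x) _ _.
  exact: diff_continuous.
move=> eps eps0.
have fgx := nbhs_singleton fg.
have fg0 : \forall h \near (0 : V), f (h + x) = g (h + x).
  move: fg; rewrite (near_shift (0 : V) x) subr0.
  by apply: filterS => h.
near=> h; rewrite -fgx -(near fg0 h) //.
near: h; exact: differentiable_small.
Unshelve. all: by end_near. Qed.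

End DiffBasics.

Section CkTheory.
Context {R : realType}.

Section Domain.
Context {E : normedModType R}.
Implicit Types (V : set E) (f g : E -> R) (k : nat).

Lemma CkS k V f : Ck k.+1 V f -> Ck k V f.
Proof.
elim: k f => [|k IH] f /= [df Df].
  by move=> x Vx; apply/differentiable_continuous/df.
by split=> // v; apply: IH; apply: Df.
Qed.

Lemma Ck_le k l V f : (k <= l)%N -> Ck l V f -> Ck k V f.
Proof.
elim: l k => [|l IH] k; first by rewrite leqn0 => /eqP ->.
by rewrite leq_eqVlt => /orP[/eqP-> //|kl] /CkS; exact: IH.
Qed.

Lemma Ck_sub k V V' f : V' `<=` V -> Ck k V f -> Ck k V' f.
Proof.
move=> VV; elim: k f => [|k IH] f /=; first by move=> cf x /VV; exact: cf.
by move=> [df Df]; split=> [x /VV|v]; [exact: df|apply: IH].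
Qed.

(** [Ck] is a condition at each point of the set on derivatives of the globally defined function, so
    it glues over unions. It will glue a product with a bump function to the region where the bump
    vanishes. *)
Lemma Ck_union k V V' f : Ck k V f -> Ck k V' f -> Ck k (V `|` V') f.
Proof.
elim: k f => [|k IH] f /=; first by move=> c1 c2 x [/c1|/c2].
move=> [df Df] [df' Df']; split=> [x [/df|/df']|v] //; exact: IH.
Qed.

Lemma Ck_eq k V f g : open V -> (forall x, V x -> f x = g x) ->
  Ck k V f -> Ck k V g.
Proof.
move=> oV; elim: k f g => [|k IH] f g fg /=.
  move=> cf x Vx; change (g @ x --> g x); rewrite -(fg _ Vx).
  apply: cvg_trans (cf x Vx); apply: near_eq_cvg.
  by near=> y; apply: fg; near: y; exact: open_nbhs_nbhs.
move=> [df Df]; split=> [x Vx|v].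
  apply: near_eq_differentiable (df x Vx).
  by near=> y; apply: fg; near: y; exact: open_nbhs_nbhs.
apply: IH (Df v) => x Vx; apply: near_eq_derive.
by near=> y; apply: fg; near: y; exact: open_nbhs_nbhs.
Unshelve. all: by end_near. Qed.

Lemma Ck_cst k V (c : R) : Ck k V (fun=> c).
Proof.
elim: k c => [|k IH] c /=; first by move=> x _; exact: cst_continuous.
split=> [x _|v]; first exact: differentiable_cst.
have -> : (fun x : E => 'D_v (fun=> c) x) = fun=> 0; last exact: IH.
by apply/funext => x; rewrite derive_cst.
Qed.

Lemma CkD k V f g : open V ->
  Ck k V f -> Ck k V g -> Ck k V (fun x => f x + g x).
Proof.
move=> oV; elim: k f g => [|k IH] f g /=.
  by move=> cf cg x Vx; apply: continuousD; [exact: cf|exact: cg].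
move=> [df Df] [dg Dg]; split=> [x Vx|v].
  by apply: differentiableD; [exact: df|exact: dg].
apply: Ck_eq (IH _ _ (Df v) (Dg v)) => // x Vx; apply/esym/deriveD.
  exact/diff_derivable/df.
exact/diff_derivable/dg.
Qed.

Lemma CkM k V f g : open V ->
  Ck k V f -> Ck k V g -> Ck k V (fun x => f x * g x).
Proof.
move=> oV; elim: k f g => [|k IH] f g.
  by move=> cf cg x Vx; apply: continuousM; [exact: cf|exact: cg].
move=> hf hg; have [df Df] := hf; have [dg Dg] := hg; split=> [x Vx|v].
  by apply: differentiableM; [exact: df|exact: dg].
apply: Ck_eq (CkD _ _ _ _ oV (IH _ _ (CkS _ _ _ hf) (Dg v))
                 (IH _ _ (CkS _ _ _ hg) (Df v))) => // x Vx.
apply/esym/deriveM.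
  exact/diff_derivable/df.
exact/diff_derivable/dg.
Qed.

Lemma CkZ k V (c : R) f : open V -> Ck k V f -> Ck k V (fun x => c * f x).
Proof. by move=> oV; apply: CkM => //; exact: Ck_cst. Qed.

Lemma Ck_sum k V (I : Type) (r : seq I) (P : pred I) (F : I -> E -> R) : open V ->
  (forall i, P i -> Ck k V (F i)) -> Ck k V (fun x => \sum_(i <- r | P i) F i x).
Proof.
move=> oV hF; elim: r => [|i r IH].
  have -> : (fun x => \sum_(i <- [::] | P i) F i x) = fun=> 0; last exact: Ck_cst.
  by apply/funext => x; rewrite big_nil.
have -> : (fun x => \sum_(j <- i :: r | P j) F j x) =
    fun x => (if P i then F i x else 0) + \sum_(j <- r | P j) F j x.
  by apply/funext => x; rewrite big_cons; case: ifP => // _; rewrite add0r.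
by apply: CkD => //; case Pi : (P i); [exact: hF|exact: Ck_cst].
Qed.

End Domain.

Lemma derive_coord {n} (x v : 'rV[R]_n) i :
  'D_v (fun y : 'rV[R]_n => y 0 i) x = v 0 i.
Proof.
have := derive_mx (@derivable_id R _ x v); rewrite derive_id => /matrixP/(_ 0 i).
by rewrite mxE.
Qed.

Lemma Ck_coord k n (V : set 'rV[R]_n) i : Ck k V (fun x => x 0 i).
Proof.
case: k => [|k] /=; first by move=> x _; exact: coord_continuous.
split=> [x _|v]; first exact: differentiable_coord.
have -> : (fun x : 'rV[R]_n => 'D_v (fun y : 'rV[R]_n => y 0 i) x) = fun=> v 0 i.
  by apply/funext => x; rewrite derive_coord.
exact: Ck_cst.
Qed.

Section Composition.
Context {E : normedModType R} {p : nat}.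

Lemma differentiable_row (g : 'I_p -> E -> R) x :
  (forall i, differentiable (g i) x) ->
  differentiable (fun y => \row_i g i y) x.
Proof.
move=> dg.
have -> : (fun y => \row_i g i y) = \sum_(i < p) (fun y => g i y *: 'e_i); last first.
  by apply: differentiable_sum => i; exact: differentiableZl.
apply/funext => y; rewrite fct_sumE [LHS]row_sum_delta.
by apply: eq_bigr => i _; rewrite mxE.
Qed.

Lemma continuous_row (g : 'I_p -> E -> R) (x : E) :
  (forall i, {for x, continuous (g i)}) ->
  {for x, continuous (fun y => \row_i g i y)}.
Proof.
move=> cg.
have -> : (fun y => \row_i g i y) = \sum_(i < p) (fun y => g i y *: 'e_i); last first.
  elim/big_ind : _ => [|f1 f2 c1 c2|i _].
  - exact: (@cst_continuous _ _ (0 : 'rV[R]_p)).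
  - exact: continuousD.
  - by apply: continuousZr_tmp; exact: cg.
apply/funext => y; rewrite fct_sumE [LHS]row_sum_delta.
by apply: eq_bigr => i _; rewrite mxE.
Qed.

Lemma derive_rowE (phi : 'rV[R]_p -> R) y v : differentiable phi y ->
  'D_v phi y = \sum_i 'D_('e_i) phi y * v 0 i.
Proof.
move=> dphi; rewrite deriveE // [in LHS](row_sum_delta v) linear_sum.
by apply: eq_bigr => i _; rewrite linearZ /= deriveE // mulrC.
Qed.

Lemma derive_comp_row (phi : 'rV[R]_p -> R) (g : 'I_p -> E -> R) x v :
  (forall i, differentiable (g i) x) ->
  differentiable phi (\row_i g i x) ->
  'D_v (fun y => phi (\row_i g i y)) x
  = \sum_i 'D_('e_i) phi (\row_i g i x) * 'D_v (g i) x.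
Proof.
move=> dg dphi; have dG := differentiable_row _ _ dg.
rewrite deriveE; last exact: differentiable_comp.
rewrite -[fun y => _]/(phi \o (fun y => \row_i g i y)) diff_comp //=.
rewrite -!deriveE // derive_rowE //; apply: eq_bigr => i _; congr (_ * _).
rewrite (_ : g i = (fun M : 'rV_p => M 0 i) \o (fun y => \row_i g i y));
  last by apply/funext => y /=; rewrite mxE.
rewrite [RHS]deriveE; last first.
  by apply: differentiable_comp => //; exact: differentiable_coord.
rewrite diff_comp //=; last exact: differentiable_coord.
rewrite deriveE // -[RHS]deriveE ?derive_coord //; exact: differentiable_coord.
Qed.

(** The induction on [k] quantifies over [phi]: a derivative of the composite is a sum of products
    of a composite with a partial derivative of [phi], to which the induction hypothesis applies,
    and a derivative of some [g i]. Higher chain rules never appear. *)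
Lemma Ck_comp k (O : set 'rV[R]_p) (V : set E) (phi : 'rV[R]_p -> R)
    (g : 'I_p -> E -> R) :
  open V -> (forall x, V x -> O (\row_i g i x)) ->
  Ck k O phi -> (forall i, Ck k V (g i)) ->
  Ck k V (fun x => phi (\row_i g i x)).
Proof.
move=> oV VO; elim: k phi => [|k IH] phi.
  move=> cphi cg x Vx.
  apply: continuous_comp; last exact/cphi/VO.
  by apply: continuous_row => i; exact: cg.
move=> hphi hg; have [dphi Dphi] := hphi.
split=> [x Vx|v].
  apply: differentiable_comp; last exact/dphi/VO.
  by apply: differentiable_row => i; have [dg _] := hg i; exact: dg.
apply: (@Ck_eq _ _ _ (fun x => \sum_i 'D_('e_i) phi (\row_i g i x) * 'D_v (g i) x)) => //.
  move=> x Vx; rewrite derive_comp_row //; last exact/dphi/VO.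
  by move=> i; have [dg _] := hg i; exact: dg.
apply: Ck_sum => // i _; apply: CkM => //; last by have [_] := hg i; exact.
by apply: (IH ('D_('e_i) phi)) => [|j]; [exact: Dphi|exact: CkS].
Qed.

End Composition.

Lemma open_preimage_row {E : normedModType R} {p : nat} (O : set 'rV[R]_p) (V : set E)
    (g : 'I_p -> E -> R) : open V -> open O -> (forall i, Ck 0 V (g i)) ->
  open (V `&` [set x | O (\row_i g i x)]).
Proof.
move=> oV oO cg; rewrite openE => x [Vx Ox].
have c : {for x, continuous (fun y => \row_i g i y)}.
  by apply: continuous_row => i; exact: cg.
apply: (@filterI _ (nbhs x)); first exact: open_nbhs_nbhs.
by apply: (c O); exact: open_nbhs_nbhs.
Qed.

End CkTheory.

(** * Integrals along rays *)

Section SegmentIntegral.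
Context {R : realType}.
Implicit Types (a b c : R) (f g : R -> R).

Definition itg a b f : R := \int[lebesgue_measure]_(t in `[a, b]) f t.

Definition icont a b f := {within `[a, b], continuous f}.

Lemma icontP a b f : icont a b f <->
  forall t, a <= t <= b -> f @ within `[a, b] (nbhs t) --> f t.
Proof.
split=> [/subspace_continuousP H t tab|H]; last apply/subspace_continuousP => t /=.
  by apply: H => /=; rewrite in_itv.
by rewrite in_itv /=; apply: H.
Qed.

Lemma icont_cst a b c : icont a b (fun=> c).
Proof. by move=> x; exact: cst_continuous. Qed.

Lemma icontD a b f g : icont a b f -> icont a b g -> icont a b (fun t => f t + g t).
Proof. by move=> cf cg x; apply: continuousD; [exact: cf|exact: cg]. Qed.

Lemma icontM a b f g : icont a b f -> icont a b g -> icont a b (fun t => f t * g t).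
Proof. by move=> cf cg x; apply: continuousM; [exact: cf|exact: cg]. Qed.

Lemma icontZ a b c f : icont a b f -> icont a b (fun t => c * f t).
Proof. by move=> cf; apply: icontM => //; exact: icont_cst. Qed.

Lemma icont_sum a b (I : Type) (r : seq I) (P : pred I) (F : I -> R -> R) :
  (forall i, P i -> icont a b (F i)) ->
  icont a b (fun x => \sum_(i <- r | P i) F i x).
Proof.
move=> hF; elim: r => [|i r IH].
  have -> : (fun x => \sum_(i <- [::] | P i) F i x) = fun=> 0; last exact: icont_cst.
  by apply/funext => x; rewrite big_nil.
have -> : (fun x => \sum_(j <- i :: r | P j) F j x) =
    fun x => (if P i then F i x else 0) + \sum_(j <- r | P j) F j x.
  by apply/funext => x; rewrite big_cons; case: ifP => // _; rewrite add0r.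
by apply: icontD => //; case Pi : (P i); [exact: hF|exact: icont_cst].
Qed.

Lemma icont_continuous a b f : continuous f -> icont a b f.
Proof. by move=> cf; exact: continuous_subspaceT. Qed.

Lemma icont_exp a b j : icont a b (fun t => t ^+ j).
Proof. by apply: icont_continuous; exact: exprn_continuous. Qed.

Lemma icont_eq a b f g : {in `[a, b], f =1 g} -> icont a b f -> icont a b g.
Proof.
move=> fg cf; apply: (subspace_eq_continuous _ cf) => x.
by rewrite inE => /= /fg.
Qed.

Lemma icont_abs a b f : icont a b f -> icont a b (fun t => `|f t|).
Proof.
by move=> cf x; exact: (cvg_norm (cf x)).
Qed.

Lemma icont_sub a b c d f : a <= c -> d <= b -> icont a b f -> icont c d f.
Proof.
move=> ac db; apply: continuous_subspaceW => x /=.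
by rewrite !in_itv /= => /andP[xc xd]; rewrite (le_trans ac) //= (le_trans xd).
Qed.

Lemma integrable_icont a b f : icont a b f ->
  lebesgue_measure.-integrable `[a, b] (EFin \o f).
Proof.
by move=> cf; apply: continuous_compact_integrable => //; exact: segment_compact.
Qed.

Lemma eq_itg a b f g : (forall t, a <= t <= b -> f t = g t) ->
  itg a b f = itg a b g.
Proof. by move=> fg; apply: eq_Rintegral => t; rewrite inE /= in_itv; exact: fg. Qed.

Lemma itgD a b f g : icont a b f -> icont a b g ->
  itg a b (fun t => f t + g t) = itg a b f + itg a b g.
Proof. by move=> cf cg; rewrite /itg RintegralD //; exact: integrable_icont. Qed.

Lemma itgZ a b c f : icont a b f -> itg a b (fun t => c * f t) = c * itg a b f.
Proof. by move=> cf; rewrite /itg RintegralZl //; exact: integrable_icont. Qed.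

Lemma itg0 a b : itg a b (fun=> 0) = 0.
Proof. by rewrite /itg Rintegral_cst // mul0r. Qed.

Lemma itg_sum a b (I : Type) (r : seq I) (P : pred I) (F : I -> R -> R) :
  (forall i, P i -> icont a b (F i)) ->
  itg a b (fun x => \sum_(i <- r | P i) F i x)
  = \sum_(i <- r | P i) itg a b (F i).
Proof.
move=> hF; elim: r => [|i r IH].
  by rewrite big_nil -[RHS](itg0 a b); apply: eq_itg => t _; rewrite big_nil.
rewrite big_cons.
case: ifPn => Pi; last first.
  by rewrite -IH; apply: eq_itg => t _; rewrite big_cons (negbTE Pi).
rewrite -IH -itgD.
- by apply: eq_itg => t _; rewrite big_cons Pi.
- exact: hF.
- exact: icont_sum.
Qed.

Lemma le_itg a b f g : icont a b f -> icont a b g ->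
  (forall t, a <= t <= b -> f t <= g t) -> itg a b f <= itg a b g.
Proof.
move=> cf cg fg; apply: le_Rintegral => //; try exact: integrable_icont.
Qed.

Lemma abs_itg a b f : icont a b f -> `|itg a b f| <= itg a b (fun t => `|f t|).
Proof. by move=> cf; apply: le_normr_Rintegral => //; exact: integrable_icont. Qed.

Lemma itg_cst a b c : a <= b -> itg a b (fun=> c) = c * (b - a).
Proof.
move=> ab; rewrite /itg Rintegral_cst //= lebesgue_measure_itv /= lte_fin.
case: ltgtP ab => // ab _; last by rewrite ab subrr.
Qed.

Lemma itg_bound a b c f : a <= b -> icont a b f ->
  (forall t, a <= t <= b -> `|f t| <= c) -> `|itg a b f| <= c * (b - a).
Proof.
move=> ab cf fc; apply: le_trans (abs_itg _ _ _ cf) _.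
by rewrite -itg_cst //; apply: le_itg => //; [exact: icont_abs|exact: icont_cst].
Qed.

Lemma itg_split a b c f : a <= c -> c <= b -> icont a b f ->
  itg a b f = itg a c f + itg c b f.
Proof.
move=> ac cb cf; apply/eqP; rewrite addrC -subr_eq; apply/eqP.
rewrite /itg Rintegral_itvB ?bnd_simp //; last exact: integrable_icont.
rewrite Rintegral_itv_obnd_cbnd //.
have := integrable_icont _ _ _ (icont_sub _ _ _ _ _ ac (lexx b) cf).
apply: integrableS => //= t /=; rewrite !in_itv /= => /andP[/ltW -> ->] //.
Qed.

End SegmentIntegral.

(** * Differentiation of integrals along rays *)

Section RayIntegral.
Context {R : realType} {n : nat}.
Implicit Types (x y v h : 'rV[R]_n) (V : set 'rV[R]_n) (g : 'rV[R]_n -> R).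

(** The tube lemma for a compact segment. *)
Lemma near_segment {T : Type} (F : set_system T) (P : R -> T -> Prop) (a b : R)
    {FF : Filter F} :
  (forall t, a <= t <= b -> \forall t' \near t & k \near F, P t' k) ->
  \forall k \near F, forall t, a <= t <= b -> P t k.
Proof.
move=> H.
have /compact_near_coveringP/(_ _ F (fun k t => P t k) FF) := @segment_compact R a b.
move=> /(_ _)/wrap[t /=|]; first by rewrite in_itv /=; exact: H.
by apply: filterS => k hk t tab; apply: hk; rewrite /= in_itv.
Qed.

(** Uniform continuity along the segment. The perturbation [k] is free at each [t], so that it can
    be t (y - x) when the end point of the ray moves and s (t h) at an intermediate point of the
    mean value theorem. *)
Lemma ray_unif (a b : R) V (phi : 'rV[R]_n -> R) x : open V -> Ck 0 V phi ->
  (forall t, a <= t <= b -> V (t *: x)) ->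
  forall eps : R, 0 < eps -> \forall k \near (0 : 'rV[R]_n), forall t, a <= t <= b ->
    V (t *: x + k) /\ `|phi (t *: x + k) - phi (t *: x)| <= eps.
Proof.
move=> oV cphi Vx eps eps0; apply: (@near_segment _ (nbhs (0 : 'rV[R]_n)) (fun t k => V (t *: x + k) /\
  `|phi (t *: x + k) - phi (t *: x)| <= eps) a b) => t tab.
have c1 : z.1 *: x + z.2 @[z --> (t, (0 : 'rV[R]_n))] --> t *: x.
  rewrite -[X in _ --> X]addr0; apply: cvgD; last exact: cvg_snd.
  by apply: cvgZr_tmp; exact: cvg_fst.
have c2 : z.1 *: x @[z --> (t, (0 : 'rV[R]_n))] --> t *: x.
  by apply: cvgZr_tmp; exact: cvg_fst.
have cx := cphi _ (Vx _ tab).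
have p1 : phi (z.1 *: x + z.2) @[z --> (t, (0 : 'rV[R]_n))] --> phi (t *: x).
  exact: (cvg_comp _ _ c1 cx).
have p2 : phi (z.1 *: x) @[z --> (t, (0 : 'rV[R]_n))] --> phi (t *: x).
  exact: (cvg_comp _ _ c2 cx).
have n1 : \forall z \near (t, (0 : 'rV[R]_n)), V (z.1 *: x + z.2).
  by apply: c1; apply: open_nbhs_nbhs; split=> //; exact: Vx.
have e2 : 0 < eps / 2 by rewrite divr_gt0.
have n2 : \forall z \near (t, (0 : 'rV[R]_n)),
    `|phi (t *: x) - phi (z.1 *: x + z.2)| < eps / 2.
  by move/cvgrPdist_lt : p1 => /(_ _ e2).
have n3 : \forall z \near (t, (0 : 'rV[R]_n)),
    `|phi (t *: x) - phi (z.1 *: x)| < eps / 2.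
  by move/cvgrPdist_lt : p2 => /(_ _ e2).
near=> z; split; first by near: z.
have h2 : `|phi (t *: x) - phi (z.1 *: x + z.2)| < eps / 2 by near: z.
have h3 : `|phi (t *: x) - phi (z.1 *: x)| < eps / 2 by near: z.
rewrite (_ : _ - _ = (phi (t *: x) - phi (z.1 *: x)) - (phi (t *: x) - phi (z.1 *: x + z.2))); last by ring.
apply: le_trans (ler_normB _ _) _.
by rewrite [leRHS]splitr ltW // ltrD.
Unshelve. all: by end_near. Qed.

(** Differentiating in x brings out a factor t, so the weight t^j makes this family of integrals
    stable under differentiation; the power also matches the one in the homotopy operator. *)
Definition ray_int (a b : R) j g x : R := itg a b (fun t => t ^+ j * g (t *: x)).

Lemma icont_ray (a b : R) V g x : open V -> Ck 0 V g ->
  (forall t, a <= t <= b -> V (t *: x)) -> icont a b (fun t => g (t *: x)).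
Proof.
move=> oV cg Vx; apply: continuous_in_subspaceT => t.
rewrite inE /= in_itv => tab.
apply: (@continuous_comp _ _ _ (fun s : R => s *: x) g); last exact/cg/Vx.
exact: scalel_continuous.
Qed.

Lemma icont_ray_exp (a b : R) V g x j : open V -> Ck 0 V g ->
  (forall t, a <= t <= b -> V (t *: x)) ->
  icont a b (fun t => t ^+ j * g (t *: x)).
Proof.
by move=> oV cg Vx; apply: icontM; [exact: icont_exp|exact: icont_ray cg Vx].
Qed.

Lemma norm_exp_le1 (a b t : R) j : 0 <= a -> b <= 1 -> a <= t <= b -> `|t ^+ j| <= 1.
Proof.
move=> a0 b1 /andP[at_ tb]; have t0 := le_trans a0 at_.
by rewrite normrX ger0_norm // exprn_ile1 // (le_trans tb).
Qed.

Lemma ray_int_continuous (a b : R) j V g x : 0 <= a -> a <= b -> b <= 1 ->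
  open V -> Ck 0 V g -> (forall t, a <= t <= b -> V (t *: x)) ->
  {for x, continuous (ray_int a b j g)}.
Proof.
move=> a0 ab b1 oV cg Vx.
change (ray_int a b j g y @[y --> x] --> ray_int a b j g x).
apply/(@cvgrPdist_le _ _ _ (nbhs x)) => eps eps0.
have H := ray_unif _ _ _ _ _ oV cg Vx _ eps0.
have [d d0 hd] : exists2 d : R, 0 < d & forall k : 'rV[R]_n, `|k| < d ->
    forall t, a <= t <= b -> V (t *: x + k) /\ `|g (t *: x + k) - g (t *: x)| <= eps.
  case/nbhs_ballP : H => d /= d0 hd; exists d => // k kd; apply: hd.
  by rewrite -ball_normE /= sub0r normrN.
apply/nbhs_ballP; exists d => //= y; rewrite -ball_normE /= => xy.
have yt t : a <= t <= b -> V (t *: y) /\ `|g (t *: y) - g (t *: x)| <= eps.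
  move=> tab; have := hd (t *: (y - x)) _ t tab.
  rewrite -scalerDr [x + _]addrC subrK; apply.
  rewrite normrZ distrC; apply: le_lt_trans xy.
  by rewrite ler_piMl // -[t]expr1 (norm_exp_le1 _ _ _ _ a0 b1 tab).
have Vy t tab := proj1 (yt t tab).
have cx := icont_ray_exp _ _ _ _ _ j oV cg Vx.
have cy := icont_ray_exp _ _ _ _ _ j oV cg Vy.
have -> : ray_int a b j g x - ray_int a b j g y
    = itg a b (fun t => t ^+ j * g (t *: x) + (-1) * (t ^+ j * g (t *: y))).
  by rewrite itgD //; [rewrite itgZ // mulN1r|exact: icontZ].
apply: le_trans (itg_bound _ _ eps _ ab _ _) _.
- by apply: icontD => //; exact: icontZ.
- move=> t tab; rewrite mulN1r -mulrBr normrM distrC.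
  apply: le_trans (proj2 (yt t tab)).
  by rewrite ler_piMl // (norm_exp_le1 _ _ _ _ a0 b1 tab).
- by rewrite ler_piMr ?(ltW eps0) //; lra.
Qed.

Lemma derive_along_line V g y h (s : R) : Ck 1 V g -> V (y + s *: h) ->
  is_derive s 1 (fun s : R => g (y + s *: h)) ('D_h g (y + s *: h)).
Proof.
move=> [dg _] Vs.
have dl : is_diff s (fun s : R => y + s *: h) ( *:%R^~ h).
  have := is_diffD (is_diff_cst y s) (is_diff_scalel s h).
  by rewrite add0r.
have dc : differentiable (fun s : R => g (y + s *: h)) s.
  by apply: (@differentiable_comp _ _ _ _ (fun s : R => y + s *: h)) => //; exact: dg.
apply: DeriveDef; first exact: diff_derivable.
rewrite deriveE // -[fun s : R => g _]/(g \o (fun s : R => y + s *: h)).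
rewrite diff_comp //; last exact: dg.
by rewrite /= diff_val scale1r deriveE //; exact: dg.
Qed.

Lemma mean_value_line V g y h : Ck 1 V g -> (forall s : R, 0 <= s <= 1 -> V (y + s *: h)) ->
  exists2 s : R, 0 <= s <= 1 & g (y + h) - g y = 'D_h g (y + s *: h).
Proof.
move=> cg Vs.
have D (s : R) : 0 <= s <= 1 ->
    is_derive s 1 (fun s : R => g (y + s *: h)) ('D_h g (y + s *: h)).
  by move=> s01; exact: (derive_along_line _ _ _ _ _ cg (Vs s s01)).
have [||s s01] := @MVT_segment R (fun s : R => g (y + s *: h))
    (fun s : R => 'D_h g (y + s *: h)) 0 1 ler01.
- move=> s; rewrite in_itv /= => /andP[s0 s1]; apply: D.
  by rewrite !ltW.
- apply: continuous_in_subspaceT => s; rewrite inE /= in_itv /= => s01.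
  apply: differentiable_continuous; apply/derivable1_diffP.
  by have [] := D s s01.
rewrite scale1r scale0r addr0 subr0 mulr1 => ->; exists s => //.
Qed.

Lemma norm_coord (h : 'rV[R]_n) i : `|h 0 i| <= `|h|.
Proof.
rewrite [leRHS]/Num.norm /= mx_normrE.
by apply: (le_bigmax _ (fun i : 'I_1 * 'I_n => `|h i.1 i.2|) (0, i)).
Qed.

(** Differentiation under the integral sign. For each t the increment of g is a derivative at an
    intermediate point by the mean value theorem, and uniform continuity of the partial derivatives
    along the ray bounds the error by eps times the norm of h. *)
Lemma ray_int_differentiable (a b : R) j V g x : 0 <= a -> a <= b -> b <= 1 ->
  open V -> Ck 1 V g -> (forall t, a <= t <= b -> V (t *: x)) ->
  differentiable (ray_int a b j g) x /\
  forall v, 'D_v (ray_int a b j g) x = ray_int a b j.+1 (fun y => 'D_v g y) x.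
Proof.
move=> a0 ab b1 oV cg Vx.
have [dg Dg] := cg.
have c0g := CkS _ _ _ cg.
pose L (h : 'rV[R]_n) : R := ray_int a b j.+1 (fun y => 'D_h g y) x.
have LE h : L h = \sum_i h 0 i * ray_int a b j.+1 (fun y => 'D_('e_i) g y) x.
  rewrite /L /ray_int.
  transitivity (itg a b (fun t => \sum_i h 0 i * (t ^+ j.+1 * 'D_('e_i) g (t *: x)))).
    apply: eq_itg => t tab; rewrite derive_rowE; last exact/dg/Vx.
    by rewrite big_distrr; apply: eq_bigr => i _ /=; ring.
  rewrite itg_sum => [|i _]; last first.
    by apply: icontZ; exact: (icont_ray_exp _ _ _ _ _ _ oV (Dg _)).
  apply: eq_bigr => i _; rewrite itgZ //.
  exact: (icont_ray_exp _ _ _ _ _ _ oV (Dg _)).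
have Llin : linear L.
  move=> k u v; rewrite !LE scaler_sumr -big_split; apply: eq_bigr => i _ /=.
  by rewrite !mxE mulrDl -mulrA.
pose LM := GRing.isLinear.Build _ _ _ _ L Llin.
pose LL : {linear 'rV[R]_n -> R} := HB.pack L LM.
have Lc : continuous LL.
  move=> h; rewrite (_ : (LL : _ -> _) = fun h => \sum_i h 0 i * ray_int a b j.+1 (fun y => 'D_('e_i) g y) x); last exact/funext.
  have := @Ck_sum R _ 0 [set: 'rV[R]_n] 'I_n (index_enum 'I_n) xpredT
    (fun i (h : 'rV[R]_n) => h 0 i * ray_int a b j.+1 (fun y => 'D_('e_i) g y) x) openT; move=> /(_ _)/wrap[|/(_ h I)//].
  move=> i _; apply: CkM; [exact: openT|exact: Ck_coord|exact: Ck_cst].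
suff [] : differentiable (ray_int a b j g) x /\ 'd (ray_int a b j g) x = LL :> (_ -> _).
  by move=> df dE; split=> [//|v]; rewrite (deriveE v df) dE.
apply: differentiable_crit => // eps eps0.
(* The error is shared among the n coordinates; n + 1 keeps the divisor nonzero when n = 0. *)
have eps'0 : 0 < eps / n.+1%:R by rewrite divr_gt0.
pose P (i : 'I_n) (k : 'rV[R]_n) := forall t, a <= t <= b -> V (t *: x + k) /\
  `|'D_('e_i) g (t *: x + k) - 'D_('e_i) g (t *: x)| <= eps / n.+1%:R.
have H : \forall k \near (0 : 'rV[R]_n), forall i, P i k.
  apply: (@filter_forall _ _ P (nbhs (0 : 'rV[R]_n))) => i.
  exact: (ray_unif _ _ _ _ _ oV (Dg _) Vx).
have H0 := ray_unif _ _ _ _ _ oV c0g Vx _ eps0.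
have [d d0 hd] : exists2 d : R, 0 < d & forall k : 'rV[R]_n, `|k| < d ->
    forall t, a <= t <= b -> V (t *: x + k) /\
    forall i, `|'D_('e_i) g (t *: x + k) - 'D_('e_i) g (t *: x)| <= eps / n.+1%:R.
  have HH : nbhs (0 : 'rV[R]_n) [set k | (forall i, P i k) /\
      forall t, a <= t <= b -> V (t *: x + k) /\ `|g (t *: x + k) - g (t *: x)| <= eps].
    exact: filterI H H0.
  case/nbhs_ballP: HH => d /= d0 hd; exists d => // k kd t tab.
  have [] := hd k; first by rewrite -ball_normE /= sub0r normrN.
  by move=> h1 h2; split=> [|i]; [have [] := h2 t tab|have [] := h1 i t tab].
apply/nbhs_ballP; exists d => //= h; rewrite -ball_normE /= sub0r normrN => hd'.
have small (s t : R) : 0 <= s <= 1 -> a <= t <= b -> `|s *: (t *: h)| < d.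
  move=> /andP[s0 s1] /andP[at_ tb]; apply: le_lt_trans hd'.
  have t0 := le_trans a0 at_; have t1 := le_trans tb b1.
  by rewrite !normrZ mulrA ler_piMl // !ger0_norm // mulr_ile1.
have Vs (s t : R) : 0 <= s <= 1 -> a <= t <= b -> V (t *: x + s *: (t *: h)).
  by move=> s01 tab; have [] := hd _ (small s t s01 tab) t tab.
have Vy (t : R) : a <= t <= b -> V (t *: (h + x)).
  move=> tab; have := Vs 1 t _ tab; rewrite scale1r scalerDr addrC; apply.
  by rewrite ler01 lexx.
have cx := icont_ray_exp _ _ _ _ _ j oV c0g Vx.
have cy := icont_ray_exp _ _ _ _ _ j oV c0g Vy.
have cD := icont_ray_exp _ _ _ _ _ j.+1 oV (Dg h) Vx.
have -> : ray_int a b j g (h + x) - ray_int a b j g x - L h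
  = itg a b (fun t => (t ^+ j * g (t *: (h + x)) + (-1) * (t ^+ j * g (t *: x)))
      + (-1) * (t ^+ j.+1 * 'D_h g (t *: x))).
  rewrite itgD; [|by apply: icontD => //; exact: icontZ|exact: icontZ].
  by rewrite itgD //; [rewrite !itgZ // !mulN1r|exact: icontZ].
apply: le_trans (itg_bound _ _ (eps * `|h|) _ ab _ _) _.
- by apply: icontD; [apply: icontD|] => //; exact: icontZ.
- move=> t tab.
  have [s s01 E] := mean_value_line _ _ (t *: x) (t *: h) cg (fun s s01 => Vs s t s01 tab).
  rewrite (_ : _ + _ = t ^+ j * (g (t *: x + t *: h) - g (t *: x) - t * 'D_h g (t *: x))); last first.
    by rewrite scalerDr [t *: h + _]addrC exprS; ring.
  rewrite E normrM; apply: (@le_trans _ _ (1 * (eps * `|h|))); last by rewrite mul1r.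
  apply: ler_pM => //; first exact: norm_exp_le1 a0 b1 tab.
  rewrite !derive_rowE; [|exact/dg/Vx|exact/dg/Vs].
  rewrite big_distrr -sumrB /=.
  apply: le_trans (ler_norm_sum _ _ _) _.
  apply: (@le_trans _ _ (\sum_(i < n) (eps / n.+1%:R * `|h|))).
    apply: ler_sum => i _; rewrite mxE.
    rewrite (_ : _ - _ = ('D_('e_i) g (t *: x + s *: (t *: h)) - 'D_('e_i) g (t *: x)) * (t * h 0 i)); last by ring.
    rewrite normrM ler_pM //.
      by have [_] := hd _ (small s t s01 tab) t tab; apply.
    rewrite normrM; apply: le_trans (norm_coord h i).
    by rewrite ler_piMl // -[t]expr1 (norm_exp_le1 _ _ _ _ a0 b1 tab).
  rewrite sumr_const card_ord -[(_ * `|h|) *+ n]mulr_natr mulrAC ler_wpM2r //.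
  rewrite -mulrA ler_piMr ?(ltW eps0) // mulrC ler_pdivrMr // mul1r.
  by rewrite ler_nat.
- by rewrite ler_piMr ?mulr_ge0 ?(ltW eps0) //; lra.
Qed.

Lemma open_ray_domain (a b : R) V : open V ->
  open [set x | forall t, a <= t <= b -> V (t *: x)].
Proof.
move=> oV; rewrite openE => x /= Vx.
rewrite /interior /=; apply: (@near_segment _ (nbhs x) (fun t y => V (t *: y)) a b) => t tab.
have c : z.1 *: z.2 @[z --> (t, x)] --> t *: x.
  by apply: cvgZ; [exact: cvg_fst|exact: cvg_snd].
by apply: (c V); apply: open_nbhs_nbhs; split=> //; exact: Vx.
Qed.

Lemma ray_int_Ck k (a b : R) j V g : 0 <= a -> a <= b -> b <= 1 ->
  open V -> Ck k V g -> Ck k [set x | forall t, a <= t <= b -> V (t *: x)] (ray_int a b j g).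
Proof.
move=> a0 ab b1 oV; elim: k j g => [|k IH] j g cg.
  by move=> x Vx; exact: ray_int_continuous cg Vx.
have c1 : Ck 1 V g by exact: (Ck_le _ _ _ _ _ cg).
split=> [x Vx|v].
  by have [] := ray_int_differentiable _ _ j _ _ x a0 ab b1 oV c1 Vx.
have [_ Dg] := cg.
apply: Ck_eq (IH j.+1 _ (Dg v)); first exact: open_ray_domain.
move=> x Vx; apply/esym.
by have [_ ->] := ray_int_differentiable _ _ j _ _ x a0 ab b1 oV c1 Vx.
Qed.

End RayIntegral.

(** * Smooth functions on sets with dense interior *)

Section SmoothOn.
Context {R : realType} {n : nat}.
Implicit Types (N V : set 'rV[R]_n) (f g : 'rV[R]_n -> R) (x y v : 'rV[R]_n).

(* What makes [derive_on] independent of the chosen local extension. *)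
Definition dense_interior N :=
  forall x V, N x -> open V -> V x -> exists2 y, V y & N^° y.

(** Move from the image of x in a chart by a small multiple of (1, ..., 1), which points strictly
    inside all the faces at once, and come back by the inverse chart. *)
Lemma submanifold_dense_interior N :
  submanifold_with_corners N -> dense_interior N.
Proof.
move=> hN x V0 Nx oV0 V0x.
have [V [V' [phi [psi [k [[oV Vx oV' sphi spsi] [hphi hpsi hNV]]]]]]] := hN x Nx.
have [V'z psiz] := hphi x Vx.
have phi0 (i : 'I_n) : (i < k)%N -> 0 <= phi x 0 i by apply: (proj1 (hNV x Vx)).
pose z (eps : R) : 'rV[R]_n := phi x + eps *: const_mx 1.
have cz : z eps @[eps --> 0] --> phi x.
  rewrite -[X in _ --> X]addr0 -(scale0r (const_mx 1 : 'rV[R]_n)).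
  by apply: cvgD; [exact: cvg_cst|apply: cvgZr_tmp; exact: cvg_id].
have cpsi := spsi 0%N _ V'z.
have cy : psi (z eps) @[eps --> 0] --> x.
  by rewrite -[X in _ --> X]psiz; exact: (cvg_comp _ _ cz cpsi).
have n1 : \forall eps \near (0 : R), V' (z eps).
  by apply: cz; exact: open_nbhs_nbhs.
have n2 : \forall eps \near (0 : R), V0 (psi (z eps)).
  by apply: cy; exact: open_nbhs_nbhs.
have [d /= d0 hd] : nbhs_ball (0 : R) [set eps | V' (z eps) /\ V0 (psi (z eps))].
  by apply/nbhs_ballP; exact: filterI n1 n2.
have [V'e V0e] : V' (z (d / 2)) /\ V0 (psi (z (d / 2))).
  apply: hd; rewrite -ball_normE /= sub0r normrN gtr0_norm ?divr_gt0 //.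
  by rewrite ltr_pdivrMr // ltr_pMr // ltr1n.
exists (psi (z (d / 2))) => //.
have [Vy phiy] := hpsi _ V'e.
set y := psi _ in Vy phiy *.
have cphi := sphi 0%N _ Vy.
(* Strict positivity of the first k coordinates is an open condition, unlike the weak inequalities
   defining N, so it puts a whole neighbourhood of y inside N. *)
pose P (i : 'I_n) (y' : 'rV[R]_n) := (i < k)%N -> 0 < phi y' 0 i.
have Hpos : \forall y' \near y, forall i, P i y'.
  apply: (@filter_forall _ _ P (nbhs y)) => i; rewrite /P.
  case ik : (i < k)%N; last by apply: filterE.
  have ci : phi y' 0 i @[y' --> y] --> phi y 0 i.
    apply: (@continuous_comp _ _ _ phi (fun M : 'rV[R]_n => M 0 i) y) => //.
    exact: coord_continuous.
  have pos : 0 < phi y 0 i.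
    by rewrite phiy !mxE mulr1 ltr_wpDl ?divr_gt0 //; exact: phi0.
  by apply: (@filterS _ (nbhs y) _ _ _ _ (cvgr_gt _ ci _ pos)).
have HV : nbhs y V by exact: open_nbhs_nbhs.
apply: (@filterS _ (nbhs y) _ _ _ _ (filterI HV Hpos)) => y' [Vy' Py'].
by apply/(hNV _ Vy') => i ik; apply: ltW; exact: Py'.
Qed.

Lemma local_extensionI N f x V V' g : open V' -> V' x ->
  local_extension N f x V g -> local_extension N f x (V `&` V') g.
Proof.
move=> oV' V'x [oV Vx sg fg]; split => //; first exact: openI.
- by move=> k; apply: Ck_sub (sg k) => y [].
- by move=> y [Vy _]; exact: fg.
Qed.

Lemma local_extension_at N f x y V g : V y ->
  local_extension N f x V g -> local_extension N f y V g.
Proof. by move=> Vy []. Qed.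

Lemma smooth_Ck_derive V g k v : smooth V g -> Ck k V (fun x => 'D_v g x).
Proof. by move=> /(_ k.+1)[_]; apply. Qed.

Lemma smooth_derive V g v : smooth V g -> smooth V (fun x => 'D_v g x).
Proof. by move=> sg k; exact: smooth_Ck_derive. Qed.

Lemma smooth_differentiable V g x : smooth V g -> V x -> differentiable g x.
Proof. by move=> /(_ 1%N)[dg _] Vx; exact: dg. Qed.

Context (N : set 'rV[R]_n) (dN : dense_interior N).

(** If two extensions had different derivatives at x, these would differ on a neighbourhood by
    continuity, hence at some interior point of N; but there both extensions coincide with f
    nearby. *)
Lemma derive_onE f x V g v : N x -> local_extension N f x V g ->
  derive_on N f x v = 'D_v g x.
Proof.
move=> Nx Hg; rewrite /derive_on.
case: xgetP => [D _ [V' [g' [Hg' ->]]]|/(_ ('D_v g x))]; last first.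
  by case; exists V, g.
case: Hg' => oV' V'x sg' fg'; case: Hg => oV Vx sg fg.
apply/eqP; apply/negPn/negP => neq.
pose dD y := 'D_v g' y - 'D_v g y.
have cD : dD y @[y --> x] --> dD x.
  have c1 : 'D_v g' y @[y --> x] --> 'D_v g' x.
    exact: (smooth_Ck_derive _ _ 0%N v sg' x V'x).
  have c2 : 'D_v g y @[y --> x] --> 'D_v g x.
    exact: (smooth_Ck_derive _ _ 0%N v sg x Vx).
  exact: (cvgB c1 c2).
have Dx0 : 0 < `|dD x| by rewrite normr_gt0 subr_eq0.
have nD : \forall y \near x, 0 < `|dD y|.
  exact: cvgr_gt _ (cvg_norm cD) _ Dx0.
have nV : \forall y \near x, V y by exact: open_nbhs_nbhs.
have nV' : \forall y \near x, V' y by exact: open_nbhs_nbhs.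
have HH : [set y | 0 < `|dD y| /\ V y /\ V' y]^° x.
  exact: (filterI nD (filterI nV nV')).
have [y /interior_subset/= [Dy [Vy V'y]] Ny] := dN _ _ Nx (open_interior _) HH.
have : 'D_v g' y = 'D_v g y.
  apply: near_eq_derive.
  have nV2 : \forall y0 \near y, V y0 by exact: open_nbhs_nbhs.
  have nV'2 : \forall y0 \near y, V' y0 by exact: open_nbhs_nbhs.
  apply: (@filterS _ (nbhs y) _ _ _ _ (filterI Ny (filterI nV2 nV'2))) => y0 [Ny0 [Vy0 V'y0]].
  by rewrite fg' // fg.
by move=> E; move: Dy; rewrite /dD E subrr normr0 ltxx.
Qed.

Lemma local_extension_eq f g x V h : (forall y, N y -> f y = g y) ->
  local_extension N f x V h -> local_extension N g x V h.
Proof.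
by move=> fg [oV Vx sh fh]; split => // y Vy Ny; rewrite fh // fg.
Qed.

Lemma smooth_on_eq f g : (forall y, N y -> f y = g y) ->
  smooth_on N f -> smooth_on N g.
Proof.
move=> fg sf x Nx; have [V [h Hh]] := sf x Nx.
by exists V, h; exact: local_extension_eq Hh.
Qed.

Lemma derive_on_eq f g x v : (forall y, N y -> f y = g y) ->
  derive_on N f x v = derive_on N g x v.
Proof.
move=> fg; rewrite /derive_on; congr xget; apply/seteqP; split=> D [V [h [Hh ->]]];
  exists V, h; split=> //; apply: local_extension_eq Hh => // y Ny.
by rewrite fg.
Qed.

Lemma smooth_on_cst (c : R) : smooth_on N (fun=> c).
Proof.
move=> x Nx; exists setT, (fun=> c); split=> //; first exact: openT.
by move=> k; exact: Ck_cst.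
Qed.

Lemma derive_on_cst (c : R) x v : N x -> derive_on N (fun=> c) x v = 0.
Proof.
move=> Nx; rewrite (@derive_onE _ _ setT (fun=> c)) ?derive_cst //.
by split=> //; [exact: openT|move=> k; exact: Ck_cst].
Qed.

Lemma smooth_on_coord i : smooth_on N (fun x => x 0 i).
Proof.
move=> x Nx; exists setT, (fun x => x 0 i); split=> //; first exact: openT.
by move=> k; exact: Ck_coord.
Qed.

Lemma derive_on_coord i x v : N x -> derive_on N (fun x => x 0 i) x v = v 0 i.
Proof.
move=> Nx; rewrite (@derive_onE _ _ setT (fun x => x 0 i)) ?derive_coord //.
by split=> //; [exact: openT|move=> k; exact: Ck_coord].
Qed.

Lemma local_extension2 f g x : smooth_on N f -> smooth_on N g -> N x ->
  exists V f' g', local_extension N f x V f' /\ local_extension N g x V g'.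
Proof.
move=> sf sg Nx; have [V [f' Hf]] := sf x Nx; have [V' [g' Hg]] := sg x Nx.
exists (V `&` V'), f', g'; case: (Hf) => oV Vx _ _; case: (Hg) => oV' V'x _ _.
split; first exact: local_extensionI.
by rewrite setIC; exact: local_extensionI.
Qed.

Lemma local_extensionD f g x V f' g' :
  local_extension N f x V f' -> local_extension N g x V g' ->
  local_extension N (fun y => f y + g y) x V (fun y => f' y + g' y).
Proof.
move=> [oV Vx sf ff] [_ _ sg gg]; split=> //.
  by move=> k; exact: CkD.
by move=> y Vy Ny; rewrite ff // gg.
Qed.

Lemma local_extensionM f g x V f' g' :
  local_extension N f x V f' -> local_extension N g x V g' ->
  local_extension N (fun y => f y * g y) x V (fun y => f' y * g' y).
Proof.
move=> [oV Vx sf ff] [_ _ sg gg]; split=> //.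
  by move=> k; exact: CkM.
by move=> y Vy Ny; rewrite ff // gg.
Qed.

Lemma smooth_onD f g : smooth_on N f -> smooth_on N g ->
  smooth_on N (fun y => f y + g y).
Proof.
move=> sf sg x Nx; have [V [f' [g' [Hf Hg]]]] := local_extension2 _ _ _ sf sg Nx.
by exists V, (fun y => f' y + g' y); exact: local_extensionD.
Qed.

Lemma smooth_onM f g : smooth_on N f -> smooth_on N g ->
  smooth_on N (fun y => f y * g y).
Proof.
move=> sf sg x Nx; have [V [f' [g' [Hf Hg]]]] := local_extension2 _ _ _ sf sg Nx.
by exists V, (fun y => f' y * g' y); exact: local_extensionM.
Qed.

Lemma derive_onD f g x v : smooth_on N f -> smooth_on N g -> N x ->
  derive_on N (fun y => f y + g y) x v = derive_on N f x v + derive_on N g x v.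
Proof.
move=> sf sg Nx; have [V [f' [g' [Hf Hg]]]] := local_extension2 _ _ _ sf sg Nx.
have [_ Vx sf' _] := Hf; have [_ _ sg' _] := Hg.
rewrite (derive_onE _ _ _ _ _ Nx Hf) (derive_onE _ _ _ _ _ Nx Hg).
rewrite (derive_onE _ _ _ _ _ Nx (local_extensionD _ _ _ _ _ _ Hf Hg)).
by apply: deriveD; apply: diff_derivable; apply: smooth_differentiable Vx.
Qed.

Lemma derive_onM f g x v : smooth_on N f -> smooth_on N g -> N x ->
  derive_on N (fun y => f y * g y) x v
  = derive_on N f x v * g x + f x * derive_on N g x v.
Proof.
move=> sf sg Nx; have [V [f' [g' [Hf Hg]]]] := local_extension2 _ _ _ sf sg Nx.
have [_ Vx sf' ff'] := Hf; have [_ _ sg' gg'] := Hg.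
rewrite (derive_onE _ _ _ _ _ Nx Hf) (derive_onE _ _ _ _ _ Nx Hg).
rewrite (derive_onE _ _ _ _ _ Nx (local_extensionM _ _ _ _ _ _ Hf Hg)).
rewrite -ff' // -gg' // addrC [X in _ + X]mulrC.
by apply: deriveM; apply: diff_derivable; apply: smooth_differentiable Vx.
Qed.

Lemma smooth_onZ (c : R) f : smooth_on N f -> smooth_on N (fun y => c * f y).
Proof. by apply: smooth_onM; exact: smooth_on_cst. Qed.

Lemma derive_onZ (c : R) f x v : smooth_on N f -> N x ->
  derive_on N (fun y => c * f y) x v = c * derive_on N f x v.
Proof.
move=> sf Nx; rewrite derive_onM ?derive_on_cst ?mul0r ?add0r //.
exact: smooth_on_cst.
Qed.

Lemma smooth_on_sum (I : Type) (r : seq I) (P : pred I) (F : I -> 'rV[R]_n -> R) :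
  (forall i, P i -> smooth_on N (F i)) ->
  smooth_on N (fun x => \sum_(i <- r | P i) F i x).
Proof.
move=> hF; elim: r => [|i r IH].
  by apply: smooth_on_eq (smooth_on_cst 0) => y _; rewrite big_nil.
case Pi : (P i); last by apply: smooth_on_eq IH => y _; rewrite big_cons Pi.
by apply: smooth_on_eq (smooth_onD _ _ (hF i Pi) IH) => y _; rewrite big_cons Pi.
Qed.

Lemma derive_on_sum (I : Type) (r : seq I) (P : pred I) (F : I -> 'rV[R]_n -> R) x v :
  (forall i, P i -> smooth_on N (F i)) -> N x ->
  derive_on N (fun x => \sum_(i <- r | P i) F i x) x v
  = \sum_(i <- r | P i) derive_on N (F i) x v.
Proof.
move=> hF Nx; elim: r => [|i r IH].
  rewrite big_nil -[RHS](derive_on_cst 0 x v Nx).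
  by apply: derive_on_eq => y _; rewrite big_nil.
rewrite big_cons; case: ifPn => Pi; last first.
  by rewrite -IH; apply: derive_on_eq => y _; rewrite big_cons (negbTE Pi).
rewrite -IH -derive_onD //; [|exact: hF|exact: smooth_on_sum].
by apply: derive_on_eq => y _; rewrite big_cons Pi.
Qed.

Lemma derive_on_linear f x (c : R) u v : smooth_on N f -> N x ->
  derive_on N f x (c *: u + v) = c * derive_on N f x u + derive_on N f x v.
Proof.
move=> sf Nx; have [V [g Hg]] := sf x Nx; have [_ Vx sg _] := Hg.
rewrite !(derive_onE _ _ _ _ _ Nx Hg).
have dg := smooth_differentiable _ _ _ sg Vx.
by rewrite !deriveE // linearP.
Qed.

Lemma smooth_on_derive f v : smooth_on N f -> smooth_on N (fun x => derive_on N f x v).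
Proof.
move=> sf x Nx; have [V [g Hg]] := sf x Nx; have [oV Vx sg fg] := Hg.
exists V, (fun y => 'D_v g y); split=> //; first exact: smooth_derive.
move=> y Vy Ny; by rewrite (derive_onE _ _ _ _ _ Ny (local_extension_at _ _ _ _ _ _ Vy Hg)).
Qed.

Lemma local_extension_family (I : finType) (f : I -> 'rV[R]_n -> R) x :
  (forall i, smooth_on N (f i)) -> N x ->
  exists V (g : I -> 'rV[R]_n -> R), [/\ open V, V x & forall i, local_extension N (f i) x V (g i)].
Proof.
move=> sf Nx.
have /choice[W /choice[g Hg]] : forall i, exists V g, local_extension N (f i) x V g.
  by move=> i; exact: sf.
have oW : open [set y | forall i, W i y].
  rewrite openE => y Wy; rewrite /interior /=.
  apply: (@filter_forall _ _ (fun i y => W i y) (nbhs y)) => i.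
  by apply: open_nbhs_nbhs; split; [have [] := Hg i|exact: Wy].
have Wx : [set y | forall i, W i y] x by move=> i; have [] := Hg i.
exists [set y | forall i, W i y], g; split=> // i.
have [oWi Wix sg fg] := Hg i; split=> //.
  by move=> k; apply: Ck_sub (sg k) => y; exact.
by move=> y Wy Ny; apply: fg => //; exact: Wy.
Qed.

Lemma local_extension_comp {p} (O : set 'rV[R]_p) (phi : 'rV[R]_p -> R)
    (f g : 'I_p -> 'rV[R]_n -> R) x V :
  open O -> smooth O phi -> (forall y, N y -> O (\row_i f i y)) -> N x ->
  open V -> V x -> (forall i, local_extension N (f i) x V (g i)) ->
  local_extension N (fun y => phi (\row_i f i y)) x
    (V `&` [set y | O (\row_i g i y)]) (fun y => phi (\row_i g i y)).
Proof.
move=> oO sphi fO Nx oV Vx Hg.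
have fgE y : V y -> N y -> \row_i f i y = \row_i g i y.
  by move=> Vy Ny; apply/rowP => i; rewrite !mxE; have [_ _ _ ->] := Hg i.
have oVO : open (V `&` [set y | O (\row_i g i y)]).
  by apply: open_preimage_row => // i; have [_ _ /(_ 0%N)] := Hg i.
split=> //.
- by split=> //=; rewrite -fgE //; exact: fO.
- move=> k; apply: (Ck_comp k O) => //; first by move=> y [].
  by move=> i; have [_ _ sg _] := Hg i; apply: Ck_sub (sg k) => y [].
- by move=> y [Vy _] Ny; rewrite fgE.
Qed.

Lemma smooth_on_comp {p} (O : set 'rV[R]_p) (phi : 'rV[R]_p -> R)
    (f : 'I_p -> 'rV[R]_n -> R) :
  open O -> smooth O phi -> (forall y, N y -> O (\row_i f i y)) ->
  (forall i, smooth_on N (f i)) -> smooth_on N (fun y => phi (\row_i f i y)).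
Proof.
move=> oO sphi fO sf x Nx.
have [V [g [oV Vx Hg]]] := local_extension_family _ _ _ sf Nx.
exists (V `&` [set y | O (\row_i g i y)]), (fun y => phi (\row_i g i y)).
exact: local_extension_comp.
Qed.

Lemma derive_on_comp {p} (O : set 'rV[R]_p) (phi : 'rV[R]_p -> R)
    (f : 'I_p -> 'rV[R]_n -> R) x v :
  open O -> smooth O phi -> (forall y, N y -> O (\row_i f i y)) ->
  (forall i, smooth_on N (f i)) -> N x ->
  derive_on N (fun y => phi (\row_i f i y)) x v
  = \sum_i 'D_('e_i) phi (\row_i f i x) * derive_on N (f i) x v.
Proof.
move=> oO sphi fO sf Nx.
have [V [g [oV Vx Hg]]] := local_extension_family _ _ _ sf Nx.
have H := local_extension_comp O phi f g x V oO sphi fO Nx oV Vx Hg.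
rewrite (derive_onE _ _ _ _ _ Nx H).
have fgE : \row_i f i x = \row_i g i x.
  by apply/rowP => i; rewrite !mxE; have [_ _ _ ->] := Hg i.
rewrite derive_comp_row.
- by rewrite fgE; apply: eq_bigr => i _; rewrite (derive_onE _ _ _ _ _ Nx (Hg i)).
- by move=> i; have [_ _ sg _] := Hg i; exact: smooth_differentiable sg Vx.
- by rewrite -fgE; have [dphi _] := sphi 1%N; exact/dphi/fO.
Qed.

End SmoothOn.

(** * Functions on a star-shaped set along its rays *)

Section RaysInStarShaped.
Context {R : realType} {n : nat} (N : set 'rV[R]_n).
Context (dN : dense_interior N) (starN : star_shaped N).
Implicit Types (V : set 'rV[R]_n) (f g : 'rV[R]_n -> R) (x y v : 'rV[R]_n).

Lemma star_ray x (t : R) : N x -> 0 <= t <= 1 -> N (t *: x).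
Proof. by move=> Nx t01; apply: (proj2 starN). Qed.

Lemma near_ray V x (t : R) : open V -> V (t *: x) -> \forall s \near t, V (s *: x).
Proof.
move=> oV Vx; have c : s *: x @[s --> t] --> t *: x by exact: scalel_continuous.
by apply: (c V); exact: open_nbhs_nbhs.
Qed.

Lemma icont_on_ray f x : smooth_on N f -> N x -> icont 0 1 (fun t => f (t *: x)).
Proof.
move=> sf Nx; apply/icontP => t t01; have Ntx := star_ray _ _ Nx t01.
have [V [g [oV Vx sg fg]]] := sf _ Ntx.
rewrite -(fg _ Vx Ntx).
have c : g (s *: x) @[s --> t] --> g (t *: x).
  apply: (@continuous_comp _ _ _ (fun s : R => s *: x) g).
    exact: scalel_continuous.
  exact: (sg 0%N).
have cw : g (s *: x) @[s --> within `[0, 1] (nbhs t)] --> g (t *: x).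
  exact: cvg_within_filter.
apply: cvg_trans cw; apply: near_eq_cvg.
have nV := near_ray _ _ _ oV Vx.
apply: filterS nV => s Vs; rewrite /= in_itv /= => s01.
by rewrite fg //; exact: star_ray.
Qed.

(** The end points are excluded because the ray may leave N there, where the values of f are
    arbitrary. The fundamental theorem asks only for continuity at the ends. *)
Lemma derive_on_ray f x (t : R) : smooth_on N f -> N x -> 0 < t < 1 ->
  is_derive t 1 (fun s : R => f (s *: x)) (derive_on N f (t *: x) x).
Proof.
move=> sf Nx /andP[t0 t1].
have Ntx : N (t *: x) by apply: star_ray => //; rewrite !ltW.
have [V [g Hg]] := sf _ Ntx; have [oV Vx sg fg] := Hg.
rewrite (derive_onE _ dN _ _ _ _ _ Ntx Hg).
have D := derive_along_line V g 0 x t (sg 1%N); rewrite !add0r in D.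
apply: near_eq_is_derive (D Vx).
have nV := near_ray _ _ _ oV Vx.
have n0 : \forall s \near t, 0 < s by exact: lt_nbhsr.
have n1 : \forall s \near t, s < 1 by exact: lt_nbhsl.
near=> s; rewrite add0r; apply: fg.
  by near: s.
apply: star_ray => //; apply/andP; split; apply: ltW; by near: s.
Unshelve. all: by end_near. Qed.

(* A Lebesgue number for the segment [0, x]: cutting the integral over rays at the
   multiples of 1/(m+1), each piece extends smoothly near x with the help of a
   single local extension of f, and no partition of unity is needed. *)
Lemma ray_subdivision f x : smooth_on N f -> N x ->
  exists m : nat, forall t, 0 <= t <= 1 -> exists V g,
    local_extension N f (t *: x) V g /\
    forall s, `|s - t| <= m.+1%:R^-1 -> V (s *: x).
Proof.
move=> sf Nx.
pose P (t : R) (m : nat) := exists V g, local_extension N f (t *: x) V g /\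
    forall s, `|s - t| <= m.+1%:R^-1 -> V (s *: x).
suff : \forall m \near \oo, forall t, 0 <= t <= 1 -> P t m.
  by move=> [m _ /(_ m (leqnn m))]; exists m.
apply: near_segment => t t01.
have [V [g Hg]] := sf _ (star_ray _ _ Nx t01); have [oV Vx _ _] := Hg.
have /nbhs_ballP[d /= d0 hd] := near_ray _ _ _ oV Vx.
have d2 : 0 < d / 2 by rewrite divr_gt0.
exists (ball t (d / 2), [set m | m.+1%:R^-1 < d / 2]).
  split; first exact: nbhsx_ballx.
  exact: (near_infty_natSinv_lt (PosNum d2)).
move=> [s m] /= [+ hm]; rewrite -ball_normE /= => hs.
have Vs r : `|r - s| <= m.+1%:R^-1 -> V (r *: x).
  move=> hr; apply: hd; rewrite -ball_normE /=.
  rewrite (_ : t - r = (t - s) - (r - s)); last by ring.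
  apply: le_lt_trans (ler_normB _ _) _.
  by rewrite [ltRHS]splitr ltrD // (le_lt_trans hr).
exists V, g; split=> //.
by apply: local_extension_at Hg; apply: Vs; rewrite subrr normr0.
Qed.

Lemma itg_point (a : R) (f : R -> R) : itg a a f = 0.
Proof. by rewrite /itg set_itv1 Rintegral_set1. Qed.

Lemma icont_on_ray_exp j f x : smooth_on N f -> N x ->
  icont 0 1 (fun t => t ^+ j * f (t *: x)).
Proof.
by move=> sf Nx; apply: icontM; [exact: icont_exp|exact: icont_on_ray].
Qed.

Lemma ray_int_local j f x : smooth_on N f -> N x ->
  exists V G, local_extension N (ray_int 0 1 j f) x V G /\
    forall v, 'D_v G x = ray_int 0 1 j.+1 (fun y => derive_on N f y v) x.
Proof.
move=> sf Nx; have [m Hm] := ray_subdivision _ _ sf Nx.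
pose M : R := m.+1%:R.
have M0 : 0 < M by rewrite ltr0n.
suff H i : (i <= m.+1)%N -> exists V G,
    local_extension N (fun y => ray_int 0 (i%:R / M) j f y) x V G /\
    forall v, 'D_v G x = ray_int 0 (i%:R / M) j.+1 (fun y => derive_on N f y v) x.
  by have := H m.+1 (leqnn _); rewrite divff // gt_eqF.
elim: i => [_|i IH im].
  exists setT, (fun=> 0); split.
    split=> //; [exact: openT|by move=> k; exact: Ck_cst|].
    by move=> y _ _; rewrite /ray_int mul0r itg_point.
  by move=> v; rewrite derive_cst /ray_int mul0r itg_point.
have [V [G [[oV Vx sG fG] DG]]] := IH (ltnW im).
set a := i%:R / M; set b := i.+1%:R / M.
have a0 : 0 <= a by rewrite divr_ge0 ?ler0n // ltW.
have ab : a <= b by rewrite ler_pM2r ?invr_gt0 // ler_nat.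
have b1 : b <= 1 by rewrite ler_pdivrMr // mul1r ler_nat.
have b0 := le_trans a0 ab; have a1 := le_trans ab b1.
have [|V' [g [Hg HV']]] := Hm a; first by rewrite a0.
have [oV' V'x sg fg] := Hg.
(* The piece has length 1/(m+1), exactly the radius guaranteed around its left end, so a single
   extension g serves all of it. *)
have Vt t : a <= t <= b -> V' (t *: x).
  move=> /andP[at_ tb]; apply: HV'; rewrite ger0_norm ?subr_ge0 // lerBlDr.
  apply: le_trans tb _; rewrite /b -addn1 natrD mulrDl addrC lerD2r.
  by rewrite mul1r.
have t01 t : a <= t <= b -> 0 <= t <= 1.
  by move=> /andP[at_ tb]; rewrite (le_trans a0) // (le_trans tb).
pose VF := [set y : 'rV[R]_n | forall t, a <= t <= b -> V' (t *: y)].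
have oVF : open VF by exact: open_ray_domain.
have sI : smooth VF (ray_int a b j g) by move=> k; exact: ray_int_Ck.
exists (V `&` VF), (fun y => G y + ray_int a b j g y); split.
  split.
  - exact: openI.
  - by split.
  - move=> k; apply: CkD; first exact: openI.
      by apply: Ck_sub (sG k) => y [].
    by apply: Ck_sub (sI k) => y [].
  - move=> y [Vy VFy] Ny; rewrite fG // /ray_int.
    rewrite (itg_split 0 b a) //; last first.
      by apply: icont_sub (icont_on_ray_exp j _ _ sf Ny).
    congr (_ + _); apply: eq_itg => t tab; rewrite fg //; first exact: VFy.
    by apply: star_ray => //; exact: t01.
move=> v; have [dI DI] := ray_int_differentiable _ _ j _ _ _ a0 ab b1 oV' (sg 1%N) Vt.
transitivity ('D_v G x + 'D_v (ray_int a b j g) x).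
  apply: deriveD; last exact: diff_derivable.
  by apply: diff_derivable; exact: smooth_differentiable sG Vx.
rewrite DG DI /ray_int.
rewrite (itg_split 0 b a) //; last first.
  apply: icont_sub (icont_on_ray_exp j.+1 _ _ (smooth_on_derive _ dN _ v sf) Nx) => //.
congr (_ + _); apply: eq_itg => t tab; rewrite (derive_onE _ dN _ _ V' g) //.
  by apply: star_ray => //; exact: t01.
by apply: local_extension_at Hg; exact: Vt.
Qed.

Lemma smooth_on_ray_int j f : smooth_on N f -> smooth_on N (ray_int 0 1 j f).
Proof. by move=> sf x Nx; have [V [G [HG _]]] := ray_int_local j _ _ sf Nx; exists V, G. Qed.

Lemma derive_on_ray_int j f x v : smooth_on N f -> N x ->
  derive_on N (ray_int 0 1 j f) x v
  = ray_int 0 1 j.+1 (fun y => derive_on N f y v) x.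
Proof.
move=> sf Nx; have [V [G [HG DG]]] := ray_int_local j _ _ sf Nx.
by rewrite (derive_onE _ dN _ _ _ _ _ Nx HG).
Qed.

Lemma FTC_ray (F F' : R -> R) : icont 0 1 F -> icont 0 1 F' ->
  (forall t : R, 0 < t < 1 -> is_derive t 1 F (F' t)) -> itg 0 1 F' = F 1 - F 0.
Proof.
move=> cF cF' dF.
rewrite /itg /Rintegral (@continuous_FTC2 _ F' F 0 1) //.
- split.
  + by move=> t; rewrite in_itv /= => t01; have [] := dF t t01.
  + by have := (continuous_within_itvP F ltr01).1 cF => -[].
  + by have := (continuous_within_itvP F ltr01).1 cF => -[].
- move=> t; rewrite in_itv /= => t01; rewrite derive1E.
  by have [_] := dF t t01.
Qed.

End RaysInStarShaped.

(** * Homogeneous coordinates *)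

Section Grading.
Context {R : realType} {W : vectType R} (gr : nat -> {vspace W}).
Context {p : nat} (e : p.-tuple W) (deg : 'I_p -> nat).
Context (hgr : is_grading gr) (he : homogeneous_basis gr e deg).

Lemma coord_sum_basis (k : 'I_p -> R) j : coord e j (\sum_i k i *: e`_i) = k j.
Proof. by rewrite coord_sum_free //; apply: basis_free; exact: (proj1 he). Qed.

Lemma sum_coord_basis w : w = \sum_i coord e i w *: e`_i.
Proof. by apply: coord_basis (proj1 he) _; rewrite memvf. Qed.

Lemma coord_param0 (x : 'rV[R]_p) i :
  coord e i (param0 e deg x) = if deg i == 0%N then x 0 i else 0.
Proof.
rewrite /param0 (_ : \sum_(_ | _) _ = \sum_j (if deg j == 0%N then x 0 j else 0) *: e`_j).
  exact: coord_sum_basis.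
rewrite big_mkcond; apply: eq_bigr => j _; case: ifP => // _; by rewrite scale0r.
Qed.

Lemma deg_lt K : (forall k, (K <= k)%N -> gr k = 0%VS) -> forall i, (deg i < K)%N.
Proof.
move=> grK i; rewrite ltnNge; apply/negP => /grK g0.
have := proj2 he i; rewrite g0 memv0 => /eqP ei0.
have := coord_sum_basis (fun j => (j == i)%:R) i.
rewrite eqxx (bigD1 i) //= eqxx ei0 scaler0 add0r big1 ?linear0 => [/eqP|j ji].
  by rewrite eq_sym oner_eq0.
by rewrite (negbTE ji) scale0r.
Qed.

(** Compares two decompositions of w along the direct sum: [u] groups the basis expansion by degree,
    [v] puts all of w in degree k. Uniqueness makes the other groups vanish. *)
Lemma coord_homogeneous k w i : w \in gr k -> deg i != k -> coord e i w = 0.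
Proof.
move=> wk ik; have [K [grK _ dK]] := hgr.
have degK := deg_lt _ grK.
case: (ltnP k K) => kK; last first.
  by move: wk; rewrite (grK _ kK) memv0 => /eqP ->; rewrite linear0.
pose u (l : 'I_K) := \sum_(j | deg j == l) coord e j w *: e`_j.
pose v (l : 'I_K) := if l == Ordinal kK then w else 0.
have hu (l : 'I_K) : true -> u l \in gr l.
  move=> _; apply: memv_suml => j /eqP <-; apply: memvZ; exact: (proj2 he).
have hv (l : 'I_K) : true -> v l \in gr l.
  by move=> _; rewrite /v; case: eqP => [->|_] //; rewrite mem0v.
have E : \sum_l u l == \sum_l v l.
  apply/eqP; rewrite [RHS](bigD1 (Ordinal kK)) //= {1}/v eqxx.
  rewrite [X in _ + X]big1 => [|l lk]; last by rewrite /v (negbTE lk).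
  rewrite addr0 [RHS]sum_coord_basis [RHS](partition_big (fun j => Ordinal (degK j)) xpredT) //=.
have /forallP/(_ (Ordinal (degK i))) : [forall l, u l == v l].
  by rewrite -(directv_sum_unique dK u v hu hv).
rewrite {1}/v -val_eqE /= (negbTE ik) => /eqP ui.
have := coord_sum_basis (fun j => if deg j == deg i then coord e j w else 0) i.
rewrite eqxx => <-; transitivity (coord e i (u (Ordinal (degK i)))); last by rewrite ui linear0.
congr (coord e i _).
rewrite /u [RHS]big_mkcond; apply: eq_bigr => j _ /=.
by case: ifP => // _; rewrite scale0r.
Qed.

(** A section over W^0 of the surjection [param0], which is not injective when some basis vector has
    nonzero degree. *)
Definition coord0 (w : W) : 'rV[R]_p := \row_i (if deg i == 0%N then coord e i w else 0).

Lemma param0_coord0 w : w \in gr 0%N -> param0 e deg (coord0 w) = w.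
Proof.
move=> w0; rewrite [RHS]sum_coord_basis /param0 big_mkcond; apply: eq_bigr => i _.
rewrite mxE; case: ifPn => [-> //|i0].
by rewrite (coord_homogeneous _ _ _ w0) ?scale0r.
Qed.

Lemma coord0_param0 x i : coord0 (param0 e deg x) 0 i = if deg i == 0%N then x 0 i else 0.
Proof. by rewrite mxE coord_param0; case: eqP. Qed.

Lemma homogeneous_coord k w : (forall i, deg i != k -> coord e i w = 0) -> w \in gr k.
Proof.
move=> H; rewrite [w]sum_coord_basis; apply: memv_suml => i _.
have [ik|ik] := eqVneq (deg i) k; last by rewrite H // scale0r mem0v.
by apply: memvZ; rewrite -ik; exact: (proj2 he).
Qed.

End Grading.

(** * Point derivations of smooth functions *)

Section Bump.
Context {R : realType}.

(* The functions s^(-k) exp(-1/s), whose span is stable under differentiation. *)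
Definition flat (k : nat) (s : R) : R :=
  if 0 < s then s^-1 ^+ k * expR (- s^-1) else 0.

(** The m-th power of z <= exp z at z = y / (m + 1); m + 1 instead of m avoids a division by
    zero. *)
Lemma expr_le_expR m (y : R) : 0 <= y -> y ^+ m <= m.+1%:R ^+ m * expR y.
Proof.
move=> y0; have M0 : 0 < m.+1%:R :> R by rewrite ltr0n.
have h : y / m.+1%:R <= expR (y / m.+1%:R).
  by apply: le_trans (expR_ge1Dx _); rewrite lerDr.
have h0 : 0 <= y / m.+1%:R by rewrite divr_ge0 // ltW.
have : (y / m.+1%:R) ^+ m <= expR (y / m.+1%:R) ^+ m by rewrite lerXn2r // nnegrE ltW // expR_gt0.
rewrite expr_div_n ler_pdivrMr ?exprn_gt0 // mulrC => H; apply: le_trans H _.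
rewrite ler_pM2l ?exprn_gt0 // -expRM_natl ler_expR.
rewrite mulrC -mulrA ler_piMr // mulrC ler_pdivrMr // mul1r ler_nat; exact: leqnSn.
Qed.

(** A quadratic bound is what gives derivative 0 at the origin. It comes from y^(k+2) <= C exp y at
    y = 1/s, two powers of which are traded for s^2. *)
Lemma flat_bound k : exists2 C : R, 0 < C & forall s, `|flat k s| <= C * s ^+ 2.
Proof.
exists (k.+3%:R ^+ k.+2); first by rewrite exprn_gt0 // ltr0n.
move=> s; rewrite /flat; case: ifPn => s0; last first.
  by rewrite normr0; apply: mulr_ge0; [exact: exprn_ge0|exact: sqr_ge0].
have si : 0 <= s^-1 by rewrite invr_ge0 ltW.
rewrite ger0_norm ?mulr_ge0 ?exprn_ge0 ?expR_ge0 //.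
have := expr_le_expR k.+2 _ si.
rewrite expRN ler_pdivrMr ?expR_gt0 // => H.
rewrite mulrAC -ler_pdivrMr ?exprn_gt0 //.
by rewrite -exprVn -exprD addn2.
Qed.

Lemma is_derive_flat k (s : R) :
  is_derive s 1 (flat k) (- k%:R * flat k.+1 s + flat k.+2 s).
Proof.
have [s0|s0|->] := ltgtP s 0.
- rewrite /flat ltNge (ltW s0) /= mulr0 addr0.
  apply: (@near_eq_is_derive _ _ _ (cst 0)).
  have := lt_nbhsl s0; apply: filterS => r r0; by rewrite /flat ltNge ltW.
- rewrite /flat s0.
  apply: (@near_eq_is_derive _ _ _ (fun r : R => r^-1 ^+ k * expR (- r^-1))).
    by near=> r; rewrite /flat ifT //; near: r; exact: lt_nbhsr.
  have sn0 : s != 0 by rewrite gt_eqF.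
  have d1 : is_derive s 1 (fun r : R => r^-1) (- s ^- 2 *: 1).
    exact: is_deriveV sn0 (is_derive_id s 1).
  have d2 := @is_deriveX R _ (fun r : R => r^-1) k s 1 _ d1.
  have d3 := is_derive1_comp (is_derive_expR _) (is_deriveN d1).
  have d4 := is_deriveM d2 d3.
  apply: is_derive_eq.
    rewrite (_ : (fun r : R => _) = (fun r : R => r^-1) ^+ k * (expR \o - (fun r : R => r^-1))).
      exact: d4.
    by apply/funext => r; rewrite exprfctE.
  rewrite exprfctE /= !fctE /GRing.scale /= -exprVn; case: k {d2 d4} => [|k]; first by rewrite expr0; ring.
  by rewrite /= !exprS; ring.
- rewrite /flat ltxx mulr0 addr0 -/(flat k).
  have [C C0 HC] := flat_bound k.
  have [||df dE] := differentiable_crit (flat k) 0 (\0 : {linear R -> R}).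
  + exact: cst_continuous.
  + move=> eps eps0.
    have : \forall h \near (0 : R), `|h| < eps / C by apply: nbhs0_lt; rewrite divr_gt0.
    apply: filterS => h /ltW; rewrite ler_pdivlMr // => hC.
    rewrite addr0 {2}/flat ltxx !subr0; apply: le_trans (HC h) _.
    rewrite -real_normK ?num_real // expr2 mulrA ler_wpM2r // mulrC.
    by [].
  apply: DeriveDef; first exact: diff_derivable.
  by rewrite deriveE // dE.
Unshelve. all: by end_near. Qed.

Lemma Ck_flat {E : normedModType R} j k (V : set E) (q : E -> R) :
  open V -> smooth V q -> Ck j V (fun x => flat k (q x)).
Proof.
move=> oV sq; elim: j k => [|j IH] k.
  move=> x Vx; apply: (@continuous_comp _ _ _ q (flat k)); first exact: (sq 0%N).
  apply: differentiable_continuous; apply/derivable1_diffP.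
  by have [] := is_derive_flat k (q x).
have dflat x : differentiable (flat k) (q x).
  by apply/derivable1_diffP; have [] := is_derive_flat k (q x).
have dq x : V x -> differentiable q x by have [dq _] := sq 1%N; exact: dq.
split=> [x Vx|v]; first by apply: (@differentiable_comp _ _ _ _ q (flat k)) => //; exact: dq.
apply: (@Ck_eq _ _ _ _ (fun x => (- k%:R * flat k.+1 (q x) + flat k.+2 (q x)) * 'D_v q x)) => //.
  move=> x Vx; rewrite [RHS]deriveE; last first.
    by apply: (@differentiable_comp _ _ _ _ q (flat k)) => //; exact: dq.
  rewrite -[fun y => flat k _]/(flat k \o q) diff_comp //; last exact: dq.
  rewrite /= -['d q x v]deriveE; last exact: dq.
  rewrite deriv1E; last by have [] := is_derive_flat k (q x).
  by rewrite derive1E mulrC; have [_ ->] := is_derive_flat k (q x).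
apply: CkM => //; last by have [_] := sq j.+1; apply.
by apply: CkD => //; apply: CkZ.
Qed.

End Bump.

Section Hadamard.
Context {R : realType}.

Lemma derive_translate {p} (F : 'rV[R]_p -> R) y0 (z v : 'rV[R]_p) :
  'D_v (fun z => F (y0 + z)) z = 'D_v F (y0 + z).
Proof.
apply: (congr1 (fun g : R -> R => lim (g @ 0^'))); apply/funext => h /=.
by rewrite addrCA.
Qed.

(** The ball is star-shaped, so the increment of F is the integral of its radial derivative; h_i is
    the integral of the i-th partial derivative along the ray. *)
Lemma hadamard {p} (O : set 'rV[R]_p) (F : 'rV[R]_p -> R) y0 :
  open O -> smooth O F -> O y0 ->
  exists (r : R) (h : 'I_p -> 'rV[R]_p -> R),
  [/\ 0 < r, forall i, smooth (ball (0 : 'rV[R]_p) r) (h i),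
      forall i, h i 0 = 'D_('e_i) F y0 &
      forall z, `|z| < r -> O (y0 + z) /\
        F (y0 + z) - F y0 = \sum_i z 0 i * h i z].
Proof.
move=> oO sF Oy0.
have [r /= r0 hr] : nbhs_ball y0 O by apply/nbhs_ballP; exact: open_nbhs_nbhs.
have Oz (z : 'rV[R]_p) : `|z| < r -> O (y0 + z).
  by move=> zr; apply: hr; rewrite -ball_normE /= opprD addrA subrr add0r normrN.
pose B := ball (0 : 'rV[R]_p) r.
have BE z : B z <-> `|z| < r by rewrite /B -ball_normE /= sub0r normrN.
have oB : open B by exact: ball_open.
pose G (z : 'rV[R]_p) := F (y0 + z).
have sG : smooth B G.
  move=> k; have -> : G = fun z => F (\row_i (y0 0 i + z 0 i)).
    by apply/funext => z; rewrite /G; congr F; apply/rowP => i; rewrite !mxE.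
  apply: (Ck_comp k O) => //.
    move=> z /BE zr; have := Oz _ zr; congr O.
    by apply/rowP => i; rewrite !mxE.
  by move=> i; apply: CkD => //; [exact: Ck_cst|exact: Ck_coord].
have Bt (t : R) z : B z -> 0 <= t <= 1 -> B (t *: z).
  move=> /BE zr /andP[t0 t1]; apply/BE; apply: le_lt_trans zr.
  by rewrite normrZ ger0_norm // ler_piMl.
pose h (i : 'I_p) := ray_int 0 1 0 (fun z => 'D_('e_i) G z).
exists r, h; split => //.
- move=> i k; have := ray_int_Ck k 0 1 0 B (fun z => 'D_('e_i) G z) (lexx 0) ler01 (lexx 1) oB.
  move=> /(_ (smooth_Ck_derive _ _ _ _ sG)); apply: Ck_sub => z Bz t t01.
  exact: Bt.
- move=> i; rewrite /h /ray_int -[RHS](mulr1) -[X in _ * X](subr0 1) -itg_cst //.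
  apply: eq_itg => t _; rewrite expr0 mul1r scaler0.
  by rewrite derive_translate addr0.
- move=> z zr; have Bz := (BE z).2 zr; split; first exact: Oz.
  have Btz t : 0 <= t <= 1 -> B (t *: z) by exact: Bt.
  have cD i : icont 0 1 (fun t => 'D_('e_i) G (t *: z)).
    exact: (icont_ray 0 1 B _ z oB (smooth_Ck_derive _ _ 0%N _ sG) Btz).
  have E : itg 0 1 (fun t => 'D_z G (t *: z)) = G (1 *: z) - G (0 *: z).
    apply: (FTC_ray (fun t => G (t *: z)) (fun t => 'D_z G (t *: z))).
    - exact: (icont_ray 0 1 B _ z oB (sG 0%N) Btz).
    - exact: (icont_ray 0 1 B _ z oB (smooth_Ck_derive _ _ 0%N _ sG) Btz).
    - move=> t /andP[t0 t1]; have := derive_along_line B G 0 z t (sG 1%N).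
      rewrite !add0r => D; have := D (Btz t _); rewrite !ltW // => /(_ isT).
      by congr is_derive; apply/funext => s; rewrite add0r.
  rewrite scale1r scale0r /G addr0 in E; rewrite -E.
  transitivity (itg 0 1 (fun t => \sum_i z 0 i * 'D_('e_i) G (t *: z))).
    apply: eq_itg => t t01; rewrite derive_rowE; last exact: smooth_differentiable sG (Btz _ t01).
    by apply: eq_bigr => i _; rewrite mulrC.
  rewrite itg_sum => [|i _]; last exact: icontZ.
  apply: eq_bigr => i _; rewrite itgZ //; congr (_ * _).
  by apply: eq_itg => t _; rewrite expr0 mul1r.
Qed.

End Hadamard.

Section PointDerivation.
Context {R : realType} {W : vectType R} (gr : nat -> {vspace W}).
Context {p : nat} (e : p.-tuple W) (deg : 'I_p -> nat).
Context (hgr : is_grading gr) (he : homogeneous_basis gr e deg).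
Context (U : set W) (hU0 : forall w, U w -> w \in gr 0%N) (hU : open_in_W0 e deg U).

Let O : set 'rV[R]_p := param0 e deg @^-1` U.
Notation sfun := (smooth_fun e deg U).

Lemma smooth_fun_patch (f : W -> R) :
  smooth O (f \o param0 e deg) -> sfun (patch (cst 0) U f).
Proof.
move=> sf; split=> [k|w nUw]; last by rewrite patchN // notin_setE.
apply: Ck_eq (sf k) => // y Oy /=.
by rewrite patchT // inE.
Qed.

Lemma smooth_funM f g : sfun f -> sfun g -> sfun (fun w => f w * g w).
Proof.
move=> [sf f0] [sg g0]; split=> [k|w nUw]; last by rewrite f0 // mul0r.
exact: (CkM _ _ (f \o param0 e deg) (g \o param0 e deg)).
Qed.

Lemma smooth_funD f g : sfun f -> sfun g -> sfun (fun w => f w + g w).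
Proof.
move=> [sf f0] [sg g0]; split=> [k|w nUw]; last by rewrite f0 // g0 // addr0.
exact: (CkD _ _ (f \o param0 e deg) (g \o param0 e deg)).
Qed.

Lemma smooth_funZ c f : sfun f -> sfun (fun w => c * f w).
Proof.
move=> [sf f0]; split=> [k|w nUw]; last by rewrite f0 // mulr0.
exact: (CkZ _ _ c (f \o param0 e deg)).
Qed.

Lemma smooth_fun0 : sfun (fun=> 0).
Proof. by split=> // k; exact: Ck_cst. Qed.

Lemma smooth_fun_sum (I : Type) (r : seq I) (P : pred I) (F : I -> W -> R) :
  (forall i, P i -> sfun (F i)) -> sfun (fun w => \sum_(i <- r | P i) F i w).
Proof.
move=> hF; split=> [k|w nUw]; last first.
  by rewrite big1 // => i /hF[_]; exact.
apply: (@Ck_sum _ _ k O I r P (fun i => F i \o param0 e deg)) => // i /hF[sF _].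
exact: sF.
Qed.

Lemma smooth_fun_cst c : sfun (patch (cst 0) U (fun=> c)).
Proof. by apply: smooth_fun_patch => k; exact: Ck_cst. Qed.

Lemma smooth_fun_coord i : sfun (patch (cst 0) U (coord e i)).
Proof.
apply: smooth_fun_patch => k.
have -> : coord e i \o param0 e deg = fun y : 'rV[R]_p => (deg i == 0%N)%:R * y 0 i.
  by apply/funext => y /=; rewrite (coord_param0 gr) //; case: eqP; rewrite ?mul1r ?mul0r.
by apply: CkZ => //; exact: Ck_coord.
Qed.

Lemma patchU (f : W -> R) w : U w -> patch (cst 0) U f w = f w.
Proof. by move=> Uw; rewrite patchT // inE. Qed.

(* The two factors [psi] make both [(coord e i - coord e i u0) psi] and [k i]
   smooth on all of [U], as is needed to apply a derivation to the product. *)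
Lemma hadamard_bump f u0 : U u0 -> sfun f ->
  exists (psi : W -> R) (k : 'I_p -> W -> R),
  [/\ sfun psi, psi u0 != 0, forall i, sfun (k i),
      forall i, k i u0 = 'D_('e_i) (f \o param0 e deg) (coord0 e deg u0) * psi u0 &
      forall w, U w -> (f w - f u0) * (psi w * psi w)
        = \sum_(i | deg i == 0%N)
            ((coord e i w - coord e i u0) * psi w) * k i w].
Proof.
move=> Uu0 [sf f0].
pose y0 := coord0 e deg u0.
have py0 : param0 e deg y0 = u0 by exact: (param0_coord0 _ _ _ hgr he _ (hU0 _ Uu0)).
have Oy0 : O y0 by rewrite /O /= py0.
have [r [h [r0 sh h0 hF]]] := hadamard _ _ _ hU sf Oy0.
(* The bump will be [flat 0] of q. It is positive at u0, where q = r^2 / 2; and q >= 0 bounds each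
   squared coordinate by r^2 / 2 < r^2, so w stays strictly inside the sup-norm ball of Hadamard's
   lemma. *)
pose q (w : W) := r ^+ 2 / 2 - \sum_(i | deg i == 0%N) (coord e i w - coord e i u0) ^+ 2.
have sq : smooth O (q \o param0 e deg).
  move=> k.
  have -> : q \o param0 e deg = fun y : 'rV[R]_p => r ^+ 2 / 2 + (-1) *
      \sum_(i | deg i == 0%N) ((y 0 i - coord e i u0) * (y 0 i - coord e i u0)).
    apply/funext => y /=; rewrite /q mulN1r; congr (_ - _); apply: eq_bigr => i i0.
    by rewrite (coord_param0 gr) // i0 expr2.
  apply: CkD => //; first exact: Ck_cst.
  apply: CkZ => //; apply: Ck_sum => // i _.
  by apply: CkM => //; (apply: CkD => //; [exact: Ck_coord|exact: Ck_cst]).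
pose psi := patch (cst 0) U (fun w => flat 0 (q w)).
pose k i := patch (cst 0) U (fun w => h i (coord0 e deg w - y0) * flat 0 (q w)).
have small w : 0 <= q w -> `|coord0 e deg w - y0| < r.
  rewrite subr_ge0 => hq.
  rewrite [ltLHS]/Num.norm /= mx_normrE.
  apply/bigmax_ltP; split=> // -[a i] _ /=; rewrite !mxE.
  case: ifPn => i0; last by rewrite subrr normr0.
  rewrite -(@ltr_pXn2r _ 2) ?nnegrE ?normr_ge0 ?(ltW r0) // real_normK ?num_real //.
  apply: le_lt_trans (_ : r ^+ 2 / 2 < _).
    apply: le_trans hq; rewrite (bigD1 i) //= lerDl.
    by apply: sumr_ge0 => j _; exact: sqr_ge0.
  by rewrite ltr_pdivrMr // ltr_pMr ?exprn_gt0 // ltr1n.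
exists psi, k; split.
- by apply: smooth_fun_patch => j; exact: (Ck_flat j 0 O (q \o param0 e deg)).
- rewrite /psi patchU // /flat /q big1 => [|i _]; last by rewrite subrr expr0n.
  rewrite subr0 divr_gt0 ?exprn_gt0 // expr0 mul1r.
  by rewrite gt_eqF // expR_gt0.
- move=> i; apply: smooth_fun_patch => j.
  (* Two open sets cover O: on V1 the Hadamard coefficients are smooth, and on V2, where q < 0, the
     product with the bump is identically 0. *)
  pose V1 := O `&` [set y | ball (0 : 'rV[R]_p) r (\row_l (coord0 e deg (param0 e deg y) 0 l - y0 0 l))].
  pose V2 := O `&` [set y | q (param0 e deg y) < 0].
  have cl m l : Ck m O (fun y : 'rV[R]_p => coord0 e deg (param0 e deg y) 0 l - y0 0 l).
    have -> : (fun y : 'rV[R]_p => coord0 e deg (param0 e deg y) 0 l - y0 0 l)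
        = fun y : 'rV[R]_p => (deg l == 0%N)%:R * y 0 l + - y0 0 l.
      apply/funext => y; rewrite (coord0_param0 gr) //.
      by case: (deg l == 0%N); rewrite ?mul1r ?mul0r.
    by apply: CkD => //; [apply: CkZ => //; exact: Ck_coord|exact: Ck_cst].
  have oV1 : open V1 by apply: open_preimage_row => //; exact: ball_open.
  have oV2 : open V2.
    rewrite openE => y [Oy qy].
    have cq : q (param0 e deg z) @[z --> y] --> q (param0 e deg y) by exact: (sq 0%N).
    apply: (@filterI _ (nbhs y)); first exact: open_nbhs_nbhs.
    exact: (cvgr_lt _ cq _ qy).
  have VE : O `<=` V1 `|` V2.
    move=> y Oy; have [qy|qy] := ltP (q (param0 e deg y)) 0; first by right.
    left; split=> //=; rewrite -ball_normE /= sub0r normrN.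
    rewrite (_ : \row_l _ = coord0 e deg (param0 e deg y) - y0); first exact: small.
    by apply/rowP => l; rewrite !mxE.
  apply: (Ck_sub _ _ _ _ VE); apply: Ck_union.
    apply: (@Ck_eq _ _ _ _ (fun y => h i (\row_l (coord0 e deg (param0 e deg y) 0 l - y0 0 l))
        * flat 0 (q (param0 e deg y)))) => //.
      move=> y _ /=; congr (h i _ * _); by apply/rowP => l; rewrite !mxE.
    apply: CkM => //.
      apply: (Ck_comp _ (ball (0 : 'rV[R]_p) r)) => //; first by move=> y [].
        exact: sh.
      by move=> l; apply: Ck_sub (cl j l) => y [].
    apply: (Ck_flat j 0 V1 (q \o param0 e deg)) => // m.
    by apply: Ck_sub (sq m) => y [].
  apply: (@Ck_eq _ _ _ _ (fun=> 0)) => //; last exact: Ck_cst.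
  by move=> y [_ qy] /=; rewrite /flat ltNge ltW // mulr0.
- move=> i; rewrite /k /psi !patchU // subrr h0.
  by congr (_ * _).
- move=> w Uw; rewrite /psi patchU //.
  have [qw|qw] := boolP (0 < q w); last first.
    rewrite /flat (negbTE qw) !mulr0 big1 // => i _; by rewrite mulr0 mul0r.
  have [_ E] := hF _ (small _ (ltW qw)).
  rewrite [y0 + _]addrCA subrr addr0 in E.
  rewrite /= py0 (param0_coord0 _ _ _ hgr he _ (hU0 _ Uw)) in E.
  rewrite E big_distrl [RHS]big_mkcond; apply: eq_bigr => i _ /=.
  rewrite /k patchU // !mxE; case: ifP => _; first by ring.
  by rewrite subrr !mul0r.
Qed.

(** D kills constants. Apply it to the identity of [hadamard_bump]: f - f(u0) and the centred
    coordinates vanish at u0, so only their own derivatives survive, each multiplied by psi(u0)^2,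
    which can be cancelled. *)
Lemma point_derivation (D : (W -> R) -> R) f u0 : U u0 ->
  (forall c a b, sfun a -> sfun b ->
    D (fun w => c * a w + b w) = c * D a + D b) ->
  (forall a b, sfun a -> sfun b ->
    D (fun w => a w * b w) = a u0 * D b + D a * b u0) ->
  sfun f ->
  D f = \sum_(i | deg i == 0%N) 'D_('e_i) (f \o param0 e deg) (coord0 e deg u0)
    * D (patch (cst 0) U (coord e i)).
Proof.
move=> Uu0 Dlin DM sf.
have [psi [k [spsi psi0 sk ku0 E]]] := hadamard_bump _ _ Uu0 sf.
pose one := patch (cst 0) U (fun=> 1 : R).
have sone : sfun one by exact: smooth_fun_cst.
have D0 : D (fun=> 0) = 0.
  transitivity (-1 * D (fun=> 0) + D (fun=> 0)); last by rewrite mulN1r addNr.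
  rewrite -(Dlin _ _ _ smooth_fun0 smooth_fun0); congr D.
  by apply/funext => w; rewrite mulr0 addr0.
have D1 : D one = 0.
  have := DM _ _ sone sone.
  have -> : (fun w => one w * one w) = one.
    by apply/funext => w; rewrite /one /patch; case: ifP; rewrite ?mulr1 ?mulr0.
  by rewrite /one patchU // mul1r mulr1 => /eqP; rewrite -subr_eq0 opprD addrA subrr add0r oppr_eq0 => /eqP.
have Dsum (I : Type) (r : seq I) (P : pred I) (F : I -> W -> R) :
    (forall i, P i -> sfun (F i)) ->
    D (fun w => \sum_(i <- r | P i) F i w) = \sum_(i <- r | P i) D (F i).
  move=> hF; elim: r => [|i r IH].
    rewrite big_nil -[RHS]D0; congr D; apply/funext => w; by rewrite big_nil.
  rewrite big_cons; case Pi : (P i); last first.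
    by rewrite -IH; congr D; apply/funext => w; rewrite big_cons Pi.
  have := Dlin 1 _ _ (hF i Pi) (smooth_fun_sum _ r P F hF).
  rewrite mul1r IH => <-; congr D; apply/funext => w.
  by rewrite big_cons Pi mul1r.
pose x i := fun w => (- coord e i u0) * one w + patch (cst 0) U (coord e i) w.
have sx i : sfun (x i).
  by apply: smooth_funD; [exact: smooth_funZ|exact: smooth_fun_coord].
have Dx i : D (x i) = D (patch (cst 0) U (coord e i)).
  by rewrite Dlin ?D1 ?mulr0 ?add0r //; exact: smooth_fun_coord.
have x0 i : x i u0 = 0.
  by rewrite /x /one !patchU // mulr1 addNr.
pose f1 := fun w => (- f u0) * one w + f w.
have sf1 : sfun f1 by apply: smooth_funD => //; exact: smooth_funZ.
have Df1 : D f1 = D f by rewrite Dlin // D1 mulr0 add0r.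
have f1u0 : f1 u0 = 0 by rewrite /f1 /one patchU // mulr1 addNr.
have E1 : (fun w => f1 w * (psi w * psi w))
    = fun w => \sum_(i | deg i == 0%N) (x i w * psi w) * k i w.
  apply/funext => w; have [Uw|nUw] := pselect (U w); last first.
    by have [_ p0] := spsi; rewrite p0 // !mulr0 big1 // => i _; rewrite mulr0 mul0r.
  transitivity ((f w - f u0) * (psi w * psi w)).
    by rewrite /f1 /one patchU // mulr1 addrC.
  rewrite E //; apply: eq_bigr => i _; congr (_ * _ * _).
  by rewrite /x /one !patchU // mulr1 addrC.
have := congr1 D E1.
rewrite DM //; last exact: smooth_funM.
rewrite f1u0 mul0r add0r Df1 Dsum => [|i _]; last first.
  by apply: smooth_funM => //; exact: smooth_funM.
move=> H; apply: (mulIf (mulf_neq0 psi0 psi0)); rewrite H big_distrl.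
apply: eq_bigr => i _.
rewrite DM //; last exact: smooth_funM.
by rewrite DM // x0 !mul0r !add0r Dx ku0 /=; ring.
Qed.

End PointDerivation.

(** * Exterior derivative and homotopy operator *)

Section ExteriorDerivative.
Context {R : realType} {n : nat} (N : set 'rV[R]_n).
Context (dN : dense_interior N).
Notation form := (dform 'rV[R]_n R).
Implicit Types (a b : form) (x y v : 'rV[R]_n) (vs w : seq 'rV[R]_n).

Definition smooth_form a := forall vs, smooth_on N (fun x => a x vs).

Lemma smooth_form_contr v a : smooth_form a -> smooth_form (fun y => contr v (a y)).
Proof. by move=> sa vs; exact: (sa (v :: vs)). Qed.

Lemma smooth_form_wsgn a : smooth_form a -> smooth_form (fun y => wsgn (a y)).
Proof. by move=> sa vs; apply: smooth_onZ; exact: sa. Qed.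

Lemma smooth_form_wedge a b : smooth_form a -> smooth_form b ->
  smooth_form (fwedge a b).
Proof.
move=> sa sb vs; apply: smooth_on_sum => m _; apply: smooth_onZ.
by apply: smooth_onM; [exact: sa|exact: sb].
Qed.

Lemma smooth_formN a : smooth_form a -> smooth_form (fun y w => - a y w).
Proof.
move=> sa vs; apply: smooth_on_eq (smooth_onZ _ (-1) _ (sa vs)) => y _.
by rewrite mulN1r.
Qed.

Lemma ext_d_nil a x : ext_d N a x [::] = 0.
Proof. by rewrite /ext_d big_ord0. Qed.

(** Cartan's formula for the constant vector field v, the counterpart for d of the recursion
    [wshuf_cons]. *)
Lemma ext_d_cons a x v vs : ext_d N a x (v :: vs)
  = derive_on N (fun y => a y vs) x v - ext_d N (fun y => contr v (a y)) x vs.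
Proof.
rewrite /ext_d /= big_ord_recl /= drop0 expr0 mul1r; congr (_ + _).
rewrite -sumrN; apply: eq_bigr => i _ /=.
by rewrite /bump /= add1n exprS mulN1r mulNr.
Qed.

Lemma ext_d_eq a b x vs : (forall y w, N y -> a y w = b y w) ->
  ext_d N a x vs = ext_d N b x vs.
Proof.
move=> ab; apply: eq_bigr => i _; congr (_ * _).
by apply: derive_on_eq => y Ny; exact: ab.
Qed.

Lemma ext_d_lin (k : R) a b x vs : smooth_form a -> smooth_form b -> N x ->
  ext_d N (fun y w => k * a y w + b y w) x vs
  = k * ext_d N a x vs + ext_d N b x vs.
Proof.
move=> sa sb Nx; rewrite /ext_d big_distrr -big_split; apply: eq_bigr => i _ /=.
rewrite derive_onD // ?derive_onZ //; first by ring.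
all: first [exact: sa|exact: sb|by apply: smooth_onZ; exact: sa].
Qed.

Lemma ext_dD a b x vs : smooth_form a -> smooth_form b -> N x ->
  ext_d N (fun y w => a y w + b y w) x vs = ext_d N a x vs + ext_d N b x vs.
Proof.
move=> sa sb Nx; rewrite -[X in X + _]mul1r -ext_d_lin //.
by apply: ext_d_eq => y w _; rewrite mul1r.
Qed.

Lemma ext_d0 x vs : N x -> ext_d N (fun _ _ => 0) x vs = 0.
Proof.
by move=> Nx; rewrite /ext_d big1 // => i _; rewrite derive_on_cst // mulr0.
Qed.

Lemma ext_dN a x vs : smooth_form a -> N x ->
  ext_d N (fun y w => - a y w) x vs = - ext_d N a x vs.
Proof.
move=> sa Nx; rewrite -[RHS]mulN1r -[RHS]addr0 -(ext_d0 x vs Nx) -ext_d_lin //.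
  by apply: ext_d_eq => y w _; rewrite mulN1r addr0.
by move=> w; exact: smooth_on_cst.
Qed.

Lemma ext_d_wsgn a x : smooth_form a -> N x ->
  ext_d N (fun y => wsgn (a y)) x = fun w => - wsgn (ext_d N a x) w.
Proof.
move=> sa Nx; apply/funext => vs; elim: vs a sa => [|v vs IH] a sa.
  by rewrite /wsgn !ext_d_nil mulr0 oppr0.
rewrite ext_d_cons.
have sc := smooth_form_contr v a sa.
rewrite (@ext_d_eq _ (fun y w => - wsgn (contr v (a y)) w)); last first.
  by move=> y w _; rewrite contr_wsgn.
rewrite ext_dN //; last exact: smooth_form_wsgn.
rewrite IH // /wsgn ext_d_cons /= exprS derive_onZ //; ring.
Qed.

Lemma derive_on_wshuf a b x v vs : smooth_form a -> smooth_form b -> N x ->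
  derive_on N (fun y => wshuf (a y) (b y) vs) x v
  = wshuf (fun w => derive_on N (fun y => a y w) x v) (b x) vs
    + wshuf (a x) (fun w => derive_on N (fun y => b y w) x v) vs.
Proof.
move=> sa sb Nx; rewrite /wshuf derive_on_sum //; last first.
  move=> m _; apply: smooth_onZ; apply: smooth_onM; [exact: sa|exact: sb].
rewrite -big_split; apply: eq_bigr => m _ /=.
rewrite derive_onZ //; last by apply: smooth_onM; [exact: sa|exact: sb].
by rewrite derive_onM //; ring.
Qed.

(** Follows by induction on the word: both sides obey a first-letter recursion, from Cartan's
    formula and from the antiderivation property of contraction. *)
Lemma ext_d_wedge a b x : smooth_form a -> smooth_form b -> N x ->
  ext_d N (fwedge a b) x
  = fun w => wshuf (ext_d N a x) (b x) w + wshuf (wsgn (a x)) (ext_d N b x) w.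
Proof.
move=> sa sb Nx; apply/funext => vs; elim: vs a b sa sb => [|v vs IH] a b sa sb.
  by rewrite !wshuf_nil !ext_d_nil mul0r mulr0 addr0.
have sca := smooth_form_contr v a sa; have scb := smooth_form_contr v b sb.
have ssa := smooth_form_wsgn a sa.
rewrite ext_d_cons derive_on_wshuf //.
rewrite (@ext_d_eq _ (fun y w => fwedge (fun y => contr v (a y)) b y w
    + fwedge (fun y => wsgn (a y)) (fun y => contr v (b y)) y w)); last first.
  by move=> y w _; rewrite contr_wshuf.
rewrite ext_dD //; [|exact: smooth_form_wedge|exact: smooth_form_wedge].
rewrite !IH // !wshuf_cons contr_wsgn ext_d_wsgn // wsgnK wshufNl wshufNl.
have -> : contr v (ext_d N a x) = fun w => derive_on N (fun y => a y w) x v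
    + - ext_d N (fun y => contr v (a y)) x w.
  by apply/funext => w; rewrite /contr ext_d_cons.
have -> : contr v (ext_d N b x) = fun w => derive_on N (fun y => b y w) x v
    + - ext_d N (fun y => contr v (b y)) x w.
  by apply/funext => w; rewrite /contr ext_d_cons.
rewrite wshufDl wshufDr wshufNl wshufNr; ring.
Qed.

Lemma smooth_form_ext_d a : smooth_form a -> smooth_form (ext_d N a).
Proof.
move=> sa vs; apply: smooth_on_sum => i _; apply: smooth_onZ.
by apply: smooth_on_derive => //; exact: sa.
Qed.

Lemma multilinear_ext_d a x : smooth_form a -> (forall y, N y -> multilinear (a y)) ->
  N x -> multilinear (ext_d N a x).
Proof.
move=> + + Nx s1; elim: s1 a => [|u s1 IH] a sa ma s2 c v v'.
  rewrite /= !ext_d_cons derive_on_linear //.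
  rewrite (@ext_d_eq _ (fun y w => c * contr v (a y) w + contr v' (a y) w)); last first.
    by move=> y w Ny; exact: (ma y Ny [::]).
  rewrite ext_d_lin; [|exact: smooth_form_contr|exact: smooth_form_contr|exact: Nx].
  by rewrite mulrBr opprD addrACA.
rewrite /= !ext_d_cons IH; [|exact: smooth_form_contr|]; last first.
  by move=> y Ny; apply: multilinear_contr; exact: ma.
rewrite (@derive_on_eq _ _ _ _ (fun y => c * a y (s1 ++ v :: s2) + a y (s1 ++ v' :: s2))); last first.
  by move=> y Ny; exact: ma.
rewrite derive_onD ?derive_onZ //; first by ring.
all: first [exact: sa|by apply: smooth_onZ; exact: sa].
Qed.

Lemma whom_ext_d k a x : (forall y, N y -> whom k (a y)) -> N x ->
  whom k.+1 (ext_d N a x).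
Proof.
move=> ha Nx vs hvs; rewrite /ext_d big1 // => i _.
rewrite (@derive_on_eq _ _ _ _ (fun=> 0)) ?derive_on_cst ?mulr0 // => y Ny.
apply: ha => //; apply: contra hvs => /eqP <-.
have h := ltn_ord i; rewrite size_cat size_take size_drop h; lia.
Qed.

End ExteriorDerivative.

(** * The homotopy operator and its formula *)

Section HomotopyOperator.
Context {R : realType} {n : nat} (N : set 'rV[R]_n).
Context (dN : dense_interior N) (starN : star_shaped N).
Notation form := (dform 'rV[R]_n R).
Implicit Types (a b : form) (x y v : 'rV[R]_n) (vs w : seq 'rV[R]_n).

Lemma diff_ray_map x (t : R) (h : 'rV[R]_n * R) :
  'd (@ray_map R n) (x, t) h = t *: h.1 + h.2 *: x.
Proof.
pose L (h : 'rV[R]_n * R) : 'rV[R]_n := t *: h.1 + h.2 *: x.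
have Llin : linear L.
  move=> k u v; rewrite /L /= !scalerDr !scalerDl !scalerA /=.
  by rewrite [t * k]mulrC addrACA.
pose LM := GRing.isLinear.Build _ _ _ _ L Llin.
pose LL : {linear ('rV[R]_n * R)%type -> 'rV[R]_n} := HB.pack L LM.
have Lc : continuous LL.
  move=> z; change (t *: h.1 + h.2 *: x @[h --> z] --> t *: z.1 + z.2 *: x).
  apply: cvgD; first by apply: cvgZl_tmp; exact: cvg_fst.
  by apply: cvgZr_tmp; exact: cvg_snd.
have [] // : differentiable (@ray_map R n) (x, t) /\ 'd (@ray_map R n) (x, t) = LL :> (_ -> _).
  apply: differentiable_crit => // eps eps0.
  apply/nbhs_ballP; exists eps => //= k; rewrite -ball_normE /= sub0r normrN => keps.
  (* (x, t) -> t x is bilinear, so its first-order remainder is exactly the quadratic term. *)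
  rewrite (_ : _ - _ = k.2 *: k.1); last first.
    by rewrite /ray_map /LL /= /L; apply/rowP => i; rewrite !mxE; ring.
  rewrite normrZ; apply: ler_pM => //.
    apply: le_trans (ltW keps); rewrite prod_normE /=; by rewrite le_max lexx orbT.
  by rewrite prod_normE /= le_max lexx.
by move=> _ ->.
Qed.

(** The differential of (x, t) -> t x sends the t-direction to x and (v, 0) to t v; each of the
    remaining vectors contributes one factor t. *)
Lemma homotopy_opE a x vs : (forall y, N y -> multilinear (a y)) -> N x ->
  homotopy_op a x vs = itg 0 1 (fun t => t ^+ size vs * a (t *: x) (x :: vs)).
Proof.
move=> ma Nx; apply: eq_itg => t t01.
rewrite /interior_product /pullback /partial_t /ray_map /= diff_ray_map /=.
rewrite scaler0 add0r scale1r -map_comp.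
rewrite (eq_map (g := fun v => t *: v)); last first.
  by move=> v /=; rewrite diff_ray_map /= scale0r addr0.
have := multilinear_map_scale (a (t *: x)) t _ [:: x] vs; apply.
by apply: ma; exact: star_ray.
Qed.

Lemma multilinear_row a x w : multilinear (a x) ->
  forall y, a x (y :: w) = \sum_i y 0 i * a x ('e_i :: w).
Proof.
move=> ma y; rewrite {1}[y]row_sum_delta.
exact: (multilinear_sum _ _ _ _ _ [::] w ma).
Qed.

(** In the homotopy operator x is both the end point of the ray and an argument of the form.
    Expanding the argument in coordinates leaves ray integrals of fixed functions, which can be
    differentiated. *)
Lemma homotopy_op_row a x w : smooth_form N a -> (forall y, N y -> multilinear (a y)) -> N x ->
  homotopy_op a x w = \sum_i x 0 i * ray_int 0 1 (size w) (fun y => a y ('e_i :: w)) x.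
Proof.
move=> sa ma Nx; rewrite homotopy_opE //.
transitivity (itg 0 1 (fun t => \sum_i x 0 i * (t ^+ size w * a (t *: x) ('e_i :: w)))).
  apply: eq_itg => t t01; rewrite multilinear_row; last by apply: ma; exact: star_ray.
  by rewrite big_distrr; apply: eq_bigr => i _ /=; ring.
rewrite itg_sum => [|i _]; last first.
  apply: icontZ; exact: (icont_on_ray_exp _ _ _ _ _ (sa _)).
apply: eq_bigr => i _; rewrite itgZ //.
exact: (icont_on_ray_exp _ _ _ _ _ (sa _)).
Qed.

Lemma smooth_form_homotopy a : smooth_form N a -> (forall y, N y -> multilinear (a y)) ->
  smooth_form N (homotopy_op a).
Proof.
move=> sa ma w.
apply: (@smooth_on_eq _ _ _ (fun x => \sum_i x 0 i * ray_int 0 1 (size w) (fun y => a y ('e_i :: w)) x)).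
  by move=> y Ny; rewrite homotopy_op_row.
apply: smooth_on_sum => i _; apply: smooth_onM; first exact: smooth_on_coord.
exact: smooth_on_ray_int.
Qed.

Lemma derive_on_homotopy a x v w : smooth_form N a -> (forall y, N y -> multilinear (a y)) ->
  N x -> derive_on N (fun y => homotopy_op a y w) x v
  = itg 0 1 (fun t => t ^+ size w * a (t *: x) (v :: w))
  + itg 0 1 (fun t => t ^+ (size w).+1 * derive_on N (fun y => a y (x :: w)) (t *: x) v).
Proof.
move=> sa ma Nx.
rewrite (@derive_on_eq _ _ _ _ (fun x => \sum_i x 0 i * ray_int 0 1 (size w) (fun y => a y ('e_i :: w)) x)); last first.
  by move=> y Ny; rewrite homotopy_op_row.
have sI i : smooth_on N (ray_int 0 1 (size w) (fun y => a y ('e_i :: w))).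
  exact: smooth_on_ray_int.
have sD i : smooth_on N (fun y => derive_on N (fun z => a z ('e_i :: w)) y v).
  by apply: smooth_on_derive => //; exact: sa.
rewrite derive_on_sum //; last first.
  by move=> i _; apply: smooth_onM => //; exact: smooth_on_coord.
under eq_bigr => i _.
  rewrite derive_onM //; last exact: smooth_on_coord.
  rewrite derive_on_coord // derive_on_ray_int //.
over.
rewrite big_split /=; congr (_ + _).
  transitivity (itg 0 1 (fun t => \sum_i v 0 i * (t ^+ size w * a (t *: x) ('e_i :: w)))).
    rewrite itg_sum => [|i _].
      apply: eq_bigr => i _; rewrite itgZ //.
      exact: (icont_on_ray_exp _ _ _ _ _ (sa _)).
    apply: icontZ; exact: (icont_on_ray_exp _ _ _ _ _ (sa _)).
  apply: eq_itg => t t01; rewrite [a _ (v :: w)]multilinear_row; last by apply: ma; exact: star_ray.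
  by rewrite big_distrr; apply: eq_bigr => i _ /=; ring.
transitivity (itg 0 1 (fun t => \sum_i x 0 i * (t ^+ (size w).+1 * derive_on N (fun z => a z ('e_i :: w)) (t *: x) v))).
  rewrite itg_sum => [|i _].
    apply: eq_bigr => i _; rewrite itgZ //.
    exact: (icont_on_ray_exp _ _ _ _ _ (sD i)).
  apply: icontZ; exact: (icont_on_ray_exp _ _ _ _ _ (sD i)).
apply: eq_itg => t t01; have Ntx := star_ray _ starN _ _ Nx t01.
rewrite (@derive_on_eq _ _ _ (fun y => a y (x :: w)) (fun y => \sum_i x 0 i * a y ('e_i :: w))); last first.
  by move=> y Ny; rewrite multilinear_row //; exact: ma.
rewrite derive_on_sum //; last by move=> i _; apply: smooth_onZ; exact: sa.
rewrite big_distrr; apply: eq_bigr => i _ /=; rewrite derive_onZ //; first by ring.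
Qed.

(** The terms that differentiate along the letters of vs cancel between d h and h d. What remains is
    the integral of the t-derivative of t^k a(t x)(vs), with k the length of vs; its value at t = 0
    is nonzero only if k = 0. *)
Lemma homotopy_formula a x vs : is_form N a -> N x ->
  ext_d N (homotopy_op a) x vs + homotopy_op (ext_d N a) x vs
  = a x vs - (size vs == 0%N)%:R * a 0 vs.
Proof.
move=> [ma aa sa] Nx.
have sd : smooth_form N (ext_d N a) by exact: smooth_form_ext_d.
rewrite [X in _ + X]homotopy_opE //; last by move=> y Ny; exact: multilinear_ext_d.
pose k := size vs.
pose w (i : 'I_(size vs)) := take i vs ++ drop i.+1 vs.
pose vi (i : 'I_(size vs)) := nth 0 vs i.
have sw i : (size (w i)).+1 = k.
  by have := ltn_ord i; rewrite /w /k size_cat size_take size_drop => h; rewrite h; lia.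
(* For k = 0 the truncated exponent is harmless, since this term only occurs multiplied by k. *)
have cvs : icont 0 1 (fun t => t ^+ k.-1 * a (t *: x) vs).
  exact: (icont_on_ray_exp _ _ _ _ _ (sa _)).
have cD i : icont 0 1 (fun t => t ^+ k * derive_on N (fun y => a y (x :: w i)) (t *: x) (vi i)).
  apply: (icont_on_ray_exp _ starN _ (fun y => derive_on N (fun y => a y (x :: w i)) y (vi i))) => //.
  by apply: smooth_on_derive => //; exact: sa.
have cDx : icont 0 1 (fun t => t ^+ k * derive_on N (fun y => a y vs) (t *: x) x).
  apply: (icont_on_ray_exp _ starN _ (fun y => derive_on N (fun y => a y vs) y x)) => //.
  by apply: smooth_on_derive => //; exact: sa.
have E1 : ext_d N (homotopy_op a) x vs = itg 0 1 (fun t => k%:R * (t ^+ k.-1 * a (t *: x) vs))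
    + \sum_(i < size vs) (-1) ^+ i * itg 0 1 (fun t => t ^+ k * derive_on N (fun y => a y (x :: w i)) (t *: x) (vi i)).
  rewrite itgZ // mulr_natl -[X in _ *+ X]card_ord -sumr_const -big_split.
  apply: eq_bigr => i _ /=; rewrite derive_on_homotopy // -/(w i) -/(vi i) mulrDr sw.
  congr (_ + _); rewrite -itgZ; last exact: (icont_on_ray_exp _ _ _ _ _ (sa _)).
  apply: eq_itg => t t01; rewrite -[k in RHS](sw i) /= mulrCA; congr (_ * _).
  have Ntx := star_ray _ starN _ _ Nx t01.
  (* Putting the i-th letter back in its place costs (-1)^i, which cancels the sign in d; hence k
     equal terms. *)
  rewrite (alternating_move _ (ma _ Ntx) (aa _ Ntx)) size_take ltn_ord.
  rewrite mulrA -exprMn mulrNN mulr1 expr1n mul1r; congr (a _ _).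
  by rewrite -[RHS](cat_take_drop i vs) [in RHS](drop_nth 0).
have E2 : itg 0 1 (fun t => t ^+ k * ext_d N a (t *: x) (x :: vs))
  = itg 0 1 (fun t => t ^+ k * derive_on N (fun y => a y vs) (t *: x) x)
  + - \sum_(i < size vs) (-1) ^+ i * itg 0 1 (fun t => t ^+ k * derive_on N (fun y => a y (x :: w i)) (t *: x) (vi i)).
  pose S t := \sum_(i < size vs) (-1) ^+ i * (t ^+ k * derive_on N (fun y => a y (x :: w i)) (t *: x) (vi i)).
  have cS : icont 0 1 S.
    by apply: icont_sum => i _; exact: (icontZ _ _ _ _ (cD i)).
  have -> : \sum_(i < size vs) (-1) ^+ i * itg 0 1 (fun t => t ^+ k * derive_on N (fun y => a y (x :: w i)) (t *: x) (vi i)) = itg 0 1 S.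
    rewrite /S itg_sum => [|i _]; last exact: (icontZ _ _ _ _ (cD i)).
    by apply: eq_bigr => i _; rewrite (itgZ _ _ _ _ (cD i)).
  rewrite -mulN1r -(itgZ _ _ _ _ cS) -(itgD _ _ _ _ cDx (icontZ _ _ (-1) _ cS)) /S.
  apply: eq_itg => t t01; rewrite ext_d_cons mulrBr mulN1r; congr (_ - _).
  rewrite /ext_d big_distrr; apply: eq_bigr => i _ /=.
  by rewrite /contr /w /vi; ring.
rewrite E1 -/k E2 addrACA subrr addr0 -itgD //; last exact: icontZ.
have D (t : R) : 0 < t < 1 -> is_derive t 1 (fun s : R => s ^+ k * a (s *: x) vs)
    (k%:R * (t ^+ k.-1 * a (t *: x) vs) + t ^+ k * derive_on N (fun y => a y vs) (t *: x) x).
  move=> t01; have d1 := derive_on_ray N dN starN _ x t (sa vs) Nx t01.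
  have d2 : is_derive t 1 (fun s : R => s ^+ k) (k%:R * t ^+ k.-1).
    have := @is_deriveX R _ (@id R) k t 1 1 (is_derive_id t 1).
    by rewrite exprfctE /= /GRing.scale /= mulr1.
  have d3 := is_deriveM d2 d1.
  apply: is_derive_eq.
  by rewrite /GRing.scale /=; ring.
have := FTC_ray _ _ _ _ D; rewrite scale1r scale0r expr1n mul1r => ->.
- by rewrite expr0n.
- exact: (icont_on_ray_exp _ _ _ _ _ (sa _)).
- by apply: icontD => //; exact: icontZ.
Qed.

Lemma is_form_homotopy a : is_form N a -> is_form N (homotopy_op a).
Proof.
move=> [ma aa sa]; split.
- move=> x Nx s1 s2 c u v; rewrite !homotopy_opE // !size_cat /=.
  rewrite -itgZ; last exact: (icont_on_ray_exp _ _ _ _ _ (sa _)).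
  rewrite -itgD; [|apply: icontZ|]; [|exact: (icont_on_ray_exp _ _ _ _ _ (sa _))..].
  apply: eq_itg => t t01; have Ntx := star_ray _ starN _ _ Nx t01.
  by have := ma _ Ntx (x :: s1) s2 c u v => /= ->; ring.
- move=> x Nx s1 s2 s3 v; rewrite homotopy_opE // -[RHS](itg0 0 1).
  apply: eq_itg => t t01; have Ntx := star_ray _ starN _ _ Nx t01.
  by have := aa _ Ntx (x :: s1) s2 s3 v => /= ->; rewrite mulr0.
- exact: smooth_form_homotopy.
Qed.

Lemma whom_homotopy k a x : (forall y, N y -> multilinear (a y)) ->
  (forall y, N y -> whom k.+1 (a y)) -> N x -> whom k (homotopy_op a x).
Proof.
move=> ma ha Nx vs hvs; rewrite homotopy_opE // -[RHS](itg0 0 1).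
apply: eq_itg => t t01; rewrite ha ?mulr0 //; exact: star_ray.
Qed.

End HomotopyOperator.

(** * Substitution of forms for generators *)

Section WordMonomials.
Context {R : realType} {E : Type}.
Implicit Types (a b c : seq E -> R).

Lemma wshufZrE a k b : wshuf a (fun w => k * b w) = fun w => k * wshuf a b w.
Proof. by apply/funext => w; rewrite wshufZr. Qed.

Lemma whom_big p (F : 'I_p -> seq E -> R) (f : 'I_p -> nat) :
  (forall i, whom (f i) (F i)) ->
  whom (\sum_i f i)%N (\big[wshuf/wunit]_i F i).
Proof.
move=> hF; apply: (big_ind2 (fun a (k : nat) => whom k a)) => //.
- exact: whom_wunit.
- by move=> a k b l; exact: whom_wshuf.
Qed.

Lemma wshuf_big p (F G : 'I_p -> seq E -> R) (f g : 'I_p -> nat) :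
  (forall i, whom (f i) (F i)) -> (forall i, whom (g i) (G i)) ->
  wshuf (\big[wshuf/wunit]_i F i) (\big[wshuf/wunit]_i G i)
  = fun w => (-1) ^+ (\sum_(i < p) \sum_(j < p | j < i) f i * g j)%N
      * (\big[wshuf/wunit]_i wshuf (F i) (G i)) w.
Proof.
elim: p F G f g => [|p IH] F G f g hF hG.
  by rewrite !big_ord0 wshuf1l; apply/funext => w; rewrite expr0 mul1r.
rewrite !big_ord_recl -!wshufA.
set P := \big[wshuf/wunit]_(i < p) F (lift ord0 i).
set T := \big[wshuf/wunit]_(i < p) G (lift ord0 i).
have hP : whom (\sum_(i < p) f (lift ord0 i))%N P by exact: whom_big.
(* The first G crosses all the later F at once; this is the j = 0 part of the exponent. *)
apply/funext => w; rewrite [wshuf P _]wshufA (wshufC _ _ _ _ hP (hG ord0)).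
rewrite (_ : wshuf (fun _ => _) T = fun w => (-1) ^+ ((\sum_(i < p) f (lift ord0 i)) * g ord0)
   * wshuf (wshuf (G ord0) P) T w); last by apply/funext => u; rewrite wshufZl.
rewrite wshufZrE -wshufA (IH _ _ (fun i => f (lift ord0 i)) (fun i => g (lift ord0 i))) // !wshufZrE mulrA -exprD; congr (_ ^+ _ * _).
rewrite [X in _ = (X + _)%N]big1 ?add0n; last by move=> j; rewrite ltn0.
under [RHS]eq_bigr => i _ do rewrite big_mkcond big_ord_recl /= -big_mkcond /=.
rewrite big_split /= big_distrl /=; congr (_ + _)%N.
Qed.

Definition wpow a k := iter k (wshuf a) wunit.

Lemma wpow_add a k l : wshuf (wpow a k) (wpow a l) = wpow a (k + l).
Proof.
elim: k => [|k IH]; first by rewrite wshuf1l.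
by rewrite addSn [wpow a (_ + _).+1]/wpow iterS -[iter _ _ _]/(wpow a (k + l)) -IH wshufA.
Qed.

Lemma whom_wpow d a k : whom d a -> whom (k * d) (wpow a k).
Proof.
move=> ha; elim: k => [|k IH]; first exact: whom_wunit.
by rewrite mulSn /wpow iterS; exact: whom_wshuf.
Qed.

Lemma wpow_odd d a k : whom d a -> odd d -> (1 < k)%N -> wpow a k = fun=> 0.
Proof.
move=> ha hd; case: k => [|[|k]] // _.
by rewrite /wpow !iterS wshufA (wshuf_odd_sq _ _ ha hd) wshuf0l.
Qed.

Lemma big_wshuf0 p (F : 'I_p -> seq E -> R) i :
  F i = (fun=> 0) -> \big[wshuf/wunit]_i F i = fun=> 0.
Proof.
move=> Fi0; elim: p F i Fi0 => [|p IH] F i Fi0; first by case: i {Fi0}.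
rewrite big_ord_recl; case: (unliftP ord0 i) Fi0 => [j ->|->] Fi0.
  by rewrite (IH _ j Fi0) wshuf0r.
by rewrite Fi0 wshuf0l.
Qed.

Lemma big_wunit p (F : 'I_p -> seq E -> R) :
  (forall i, F i = wunit) -> \big[wshuf/wunit]_i F i = wunit.
Proof.
by move=> HF; apply: (big_ind (fun a => a = wunit)) => // a b -> ->; rewrite wshuf1l.
Qed.

Lemma big_wshuf1 p (F : 'I_p -> seq E -> R) i :
  (forall j, j != i -> F j = wunit) -> \big[wshuf/wunit]_i F i = F i.
Proof.
elim: p F i => [|p IH] F i; first by case: i.
rewrite big_ord_recl; case: (unliftP ord0 i) => [j ->|->] HF.
  rewrite (HF ord0) ?neq_lift // wshuf1l (IH _ j) // => k kj.
  by apply: HF; apply: contra kj => /eqP/lift_inj ->.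
rewrite big_wunit ?wshuf1r // => j; apply: HF.
by rewrite eq_sym neq_lift.
Qed.

Context {p : nat} (deg : 'I_p -> nat) (al : 'I_p -> seq E -> R).
Context (hal : forall i, whom (deg i) (al i)).

Definition wmon (m : @monomial p) : seq E -> R :=
  \big[wshuf/wunit]_(i < p) wpow (al i) (m i).

Lemma whom_wmon m : whom (mdeg deg m) (wmon m).
Proof. by apply: whom_big => i; exact: whom_wpow. Qed.

Lemma wmon_mul m1 m2 : wshuf (wmon m1) (wmon m2)
  = fun w => (-1) ^+ koszul deg m1 m2 * wmon (madd m1 m2) w.
Proof.
rewrite /wmon (wshuf_big _ _ _ _ _ (fun i => whom_wpow _ _ _ (hal i)) (fun i => whom_wpow _ _ _ (hal i))).
apply/funext => w; congr (_ * _ w); apply: eq_bigr => i _.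
by rewrite wpow_add /madd ffunE.
Qed.

Lemma wmon_odd0 (m : @monomial p) i : odd (deg i) -> (1 < m i)%N -> wmon m = fun=> 0.
Proof. by move=> di mi; apply: (big_wshuf0 _ _ i); exact: wpow_odd (hal i) di mi. Qed.

Lemma wmon0 : wmon [ffun=> 0%N] = wunit.
Proof. by rewrite /wmon big_wunit // => i; rewrite ffunE. Qed.

Lemma wmon_delta i : wmon [ffun j => nat_of_bool (j == i)] = al i.
Proof.
rewrite /wmon (big_wshuf1 _ _ i); first by rewrite ffunE eqxx /wpow /= wshuf1r.
by move=> j /negbTE ji; rewrite ffunE ji.
Qed.

End WordMonomials.

(** * Substitution as an algebra morphism, at a point *)

Section Substitution.
Context {R : realType} {W : vectType R} {E : Type}.
Context {p : nat} (e : p.-tuple W) (deg : 'I_p -> nat) (U : set W).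
Notation in_alg := (in_AWU e deg U).
Implicit Types (a b : @prealg R W p) (m : @monomial p).

Lemma in_AWU_support a : in_alg a ->
  exists2 r : seq monomial, uniq r & forall m, m \notin r -> a m = cst 0.
Proof.
move=> [/finite_seqP[s hs] _ _]; exists (undup s); first exact: undup_uniq.
move=> m; rewrite mem_undup => ms; apply: contrapT => am.
have : [set m | a m <> cst 0] m by [].
by rewrite hs /=; apply/negP.
Qed.

Lemma fsum_seq (I : choiceType) (r : seq I) (F : I -> R) : uniq r ->
  (forall i, i \notin r -> F i = 0) -> \sum_(i \in [set: I]) F i = \sum_(i <- r) F i.
Proof.
move=> ur Fr; rewrite [RHS](@bigfs _ _ _ _ _ xpredT) //; last by move=> i _; exact: Fr.
by apply: eq_fsbigl; apply/seteqP; split.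
Qed.

Lemma fsum_seq_cond (I J : choiceType) (r : seq I) (f : I -> J) (y : J) (F : I -> R) : uniq r ->
  (forall i, f i = y -> i \notin r -> F i = 0) ->
  \sum_(i \in [set i | f i = y]) F i = \sum_(i <- r | f i == y) F i.
Proof.
move=> ur Fr; rewrite [RHS](@bigfs _ _ _ _ _ (fun i => f i == y)) //; last first.
  by move=> i /eqP; exact: Fr.
by apply: eq_fsbigl; apply/seteqP; split=> i /= /eqP.
Qed.

Definition wsubst (al : 'I_p -> seq E -> R) (u : W) a : seq E -> R :=
  fun w => \sum_(m \in [set: @monomial p]) a m u * wmon al m w.

Lemma wsubst_seq al u a (r : seq monomial) : uniq r ->
  (forall m, m \notin r -> a m = cst 0) ->
  wsubst al u a = fun w => \sum_(m <- r) a m u * wmon al m w.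
Proof.
move=> ur ar; apply/funext => w; apply: fsum_seq => // m mr.
by rewrite ar // mul0r.
Qed.

Lemma wsubst_lin al u c a b : in_alg a -> in_alg b ->
  wsubst al u (alg_lin c a b) = fun w => c * wsubst al u a w + wsubst al u b w.
Proof.
move=> /in_AWU_support[r ur ar] /in_AWU_support[s us bs].
have ut : uniq (undup (r ++ s)) by exact: undup_uniq.
have h m : m \notin undup (r ++ s) -> a m = cst 0 /\ b m = cst 0.
  by rewrite mem_undup mem_cat negb_or => /andP[/ar -> /bs ->].
rewrite (wsubst_seq _ _ _ _ ut) => [|m /h[am bm]]; last first.
  by apply/funext => w; rewrite /alg_lin am bm /= mulr0 addr0.
rewrite (wsubst_seq _ _ a _ ut) => [|m /h[]//].
rewrite (wsubst_seq _ _ b _ ut) => [|m /h[]//].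
apply/funext => w; rewrite big_distrr -big_split; apply: eq_bigr => m _ /=.
by rewrite /alg_lin; ring.
Qed.

Lemma admissible_madd m1 m2 : ~~ admissible deg (madd m1 m2) ->
  [\/ ~~ admissible deg m1, ~~ admissible deg m2
    | exists2 i, odd (deg i) & (1 < madd m1 m2 i)%N].
Proof.
move=> /forallPn[i]; rewrite negb_and !negb_imply => /orP[/andP[di]|/andP[di]].
  rewrite ffunE addn_eq0 negb_and => /orP[h|h]; [constructor 1|constructor 2];
  by apply/forallPn; exists i; rewrite negb_and !negb_imply di h.
by rewrite -ltnNge => h; constructor 3; exists i.
Qed.

(** [alg_mul] drops every non-admissible monomial. Nothing is lost: if both factors are admissible,
    a non-admissible product repeats an odd generator, and odd forms square to zero. *)
Lemma wsubst_mul al u a b : (forall i, whom (deg i) (al i)) ->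
  in_alg a -> in_alg b ->
  wsubst al u (alg_mul deg a b) = wshuf (wsubst al u a) (wsubst al u b).
Proof.
move=> hal Ha Hb.
have [r ur ar] := in_AWU_support _ Ha; have [s us bs] := in_AWU_support _ Hb.
have [_ aadm _] := Ha; have [_ badm _] := Hb.
pose t := [seq (x, y) | x <- r, y <- s].
have ut : uniq t by apply: allpairs_uniq => // -[? ?] [? ?].
have Ht x : x \notin t -> a x.1 u * b x.2 u = 0.
  move=> xt; have [x1|x1] := boolP (x.1 \in r); last by rewrite ar // mul0r.
  rewrite bs ?mulr0 //; apply: contra xt => x2.
  by apply/allpairsP; exists x; rewrite -surjective_pairing.
pose q := undup [seq madd x.1 x.2 | x <- t].
have uq : uniq q by exact: undup_uniq.
have mulE m : alg_mul deg a b m u = if admissible deg m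
    then \sum_(x <- t | madd x.1 x.2 == m) (-1) ^+ koszul deg x.1 x.2 * (a x.1 u * b x.2 u)
    else 0.
  rewrite /alg_mul; case: ifP => // _; apply: fsum_seq_cond => // x _ xt.
  by rewrite Ht // mulr0.
have mulEw m w : alg_mul deg a b m u * wmon al m w
    = \sum_(x <- t | madd x.1 x.2 == m) (-1) ^+ koszul deg x.1 x.2 * (a x.1 u * b x.2 u) * wmon al m w.
  rewrite mulE -big_distrl /=; case: ifPn => // nadm; rewrite mul0r.
  have [wm|wm] := eqVneq (wmon al m w) 0; first by rewrite wm mulr0.
  rewrite big1 ?mul0r // => x /eqP xm; rewrite -xm in nadm wm.
  have [h|h|[i di mi]] := admissible_madd _ _ nadm.
  - by rewrite aadm // mul0r mulr0.
  - by rewrite badm // !mulr0.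
  - by move: wm; rewrite (wmon_odd0 _ _ hal _ _ di mi) eqxx.
apply/funext => w.
transitivity (\sum_(m <- q) alg_mul deg a b m u * wmon al m w).
  apply: fsum_seq => // m mq; rewrite mulE; case: ifP; rewrite ?mul0r // => _.
  rewrite big_seq_cond big1 ?mul0r // => x /andP[xt /eqP xm].
  by move: mq; rewrite mem_undup -xm (map_f (fun x : monomial * monomial => madd x.1 x.2) xt).
under eq_bigr do rewrite mulEw.
rewrite (exchange_big_dep xpredT) //=.
transitivity (\sum_(x <- t) (-1) ^+ koszul deg x.1 x.2 * (a x.1 u * b x.2 u) * wmon al (madd x.1 x.2) w).
  rewrite big_seq [RHS]big_seq; apply: eq_bigr => x xt.
  rewrite big_mkcond (bigD1_seq (madd x.1 x.2)) //=; last first.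
    by rewrite mem_undup (map_f (fun x : monomial * monomial => madd x.1 x.2) xt).
  rewrite eqxx big1 ?addr0 // => i /negbTE im; by rewrite eq_sym im.
rewrite (wsubst_seq _ _ _ _ ur ar) (wsubst_seq _ _ _ _ us bs).
rewrite wshuf_suml big_allpairs; apply: eq_bigr => m1 _.
rewrite wshuf_sumr; apply: eq_bigr => m2 _ /=.
by rewrite wshufZl wshufZr (wmon_mul _ _ hal) /=; ring.
Qed.

Lemma whom_wsubst al u a k : (forall i, whom (deg i) (al i)) ->
  alg_homogeneous deg k a -> whom k (wsubst al u a).
Proof.
move=> hal ha w hw; apply: fsbig1 => m _.
have [->|/ha mk] := pselect (a m = cst 0); first by rewrite mul0r.
by rewrite (whom_wmon _ _ hal) ?mulr0 // mk.
Qed.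

Lemma wsubst_gen al u i : (forall i, whom (deg i) (al i)) -> U u ->
  (deg i = 0%N -> al i [::] = coord e i u) ->
  wsubst al u (alg_gen e deg U i) = al i.
Proof.
move=> hal Uu ali; apply/funext => w.
pose m := if deg i == 0%N then [ffun=> 0%N] else [ffun j => nat_of_bool (j == i)] : monomial.
rewrite (wsubst_seq _ _ _ [:: m]) //; last first.
  move=> m'; rewrite inE => /negbTE mm; rewrite /alg_gen; apply/funext => u'.
  rewrite /patch; case: ifP => // _; move: mm; rewrite /m.
  by case: (deg i == 0%N) => ->; rewrite ?mul0r.
rewrite big_seq1 /alg_gen patchT ?inE // /m; case: eqP => [di|di].
  rewrite eqxx mul1r wmon0 -ali //; case: w => [|v w]; rewrite /wunit /= ?mulr1 ?mulr0 //.
  by rewrite hal // di.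
by rewrite eqxx mul1r wmon_delta.
Qed.

End Substitution.

(** * One-term elements, and the action of Q on functions *)

Section SingleTerms.
Context {R : realType} {W : vectType R} (gr : nat -> {vspace W}).
Context {p : nat} (e : p.-tuple W) (deg : 'I_p -> nat).
Context (hgr : is_grading gr) (he : homogeneous_basis gr e deg).
Context (U : set W) (hU0 : forall w, U w -> w \in gr 0%N) (hU : open_in_W0 e deg U).
Notation in_alg := (in_AWU e deg U).
Notation sfun := (smooth_fun e deg U).
Implicit Types (a b : @prealg R W p) (m : @monomial p) (f g : W -> R).

Definition single f m : @prealg R W p := fun m' => if m' == m then f else cst 0.

Definition one_mon : @monomial p := [ffun=> 0%N].

(** A generator of degree 0 is a function, so it lives in the coefficient and its monomial is
    trivial. *)
Definition gen_mon i : @monomial p :=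
  if deg i == 0%N then one_mon else [ffun j => nat_of_bool (j == i)].

Lemma single_neq f m m' : m' != m -> single f m m' = cst 0.
Proof. by rewrite /single => /negbTE ->. Qed.

Lemma single_eq f m : single f m m = f.
Proof. by rewrite /single eqxx. Qed.

Lemma in_alg_single f m : admissible deg m -> sfun f -> in_alg (single f m).
Proof.
move=> am sf; split.
- apply: (sub_finite_set _ (finite_set1 m)) => m' /= H; apply: contrapT => /eqP mm.
  by apply: H; rewrite single_neq.
- by move=> m' nm'; rewrite single_neq //; apply: contraNneq nm' => ->.
- move=> m'; rewrite /single; case: ifP => // _; exact: smooth_fun0.
Qed.

Lemma homogeneous_single f m : alg_homogeneous deg (mdeg deg m) (single f m).
Proof.
by move=> m' H; congr mdeg; apply/eqP/negPn/negP => mm; apply: H; rewrite single_neq.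
Qed.

Lemma admissible_one : admissible deg one_mon.
Proof.
by apply/forallP => i; rewrite ffunE eqxx implybT /=; apply/implyP.
Qed.

Lemma admissible_gen i : admissible deg (gen_mon i).
Proof.
rewrite /gen_mon; case: ifPn => [_|di]; first exact: admissible_one.
apply/forallP => j; rewrite ffunE; have [->|ji] := eqVneq j i.
  by rewrite (negbTE di) /= implybT.
by rewrite eqxx implybT /=; apply/implyP.
Qed.

Lemma mdeg_one : mdeg deg one_mon = 0%N.
Proof. by rewrite /mdeg big1 // => i _; rewrite ffunE. Qed.

Lemma mdeg_gen i : mdeg deg (gen_mon i) = deg i.
Proof.
rewrite /gen_mon; case: eqP => [->|_]; first exact: mdeg_one.
rewrite /mdeg (bigD1 i) //= ffunE eqxx mul1n big1 ?addn0 // => j /negbTE ji.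
by rewrite ffunE ji.
Qed.

Lemma alg_gen_single i : alg_gen e deg U i
  = single (patch (cst 0) U (if deg i == 0%N then coord e i : W -> R else fun=> 1)) (gen_mon i).
Proof.
apply/funext => m; apply/funext => w; rewrite /alg_gen /single /gen_mon /one_mon /patch.
case: (deg i == 0%N); case: eqP => _; case: ifP => //= _; by rewrite ?mul1r ?mul0r.
Qed.

Lemma smooth_fun_gen i :
  sfun (patch (cst 0) U (if deg i == 0%N then coord e i : W -> R else fun=> 1)).
Proof.
case: ifP => _; first exact: (smooth_fun_coord gr).
exact: smooth_fun_cst.
Qed.

Lemma in_alg_gen i : in_alg (alg_gen e deg U i).
Proof.
rewrite alg_gen_single; apply: in_alg_single; first exact: admissible_gen.
exact: smooth_fun_gen.
Qed.

Lemma homogeneous_gen i : alg_homogeneous deg (deg i) (alg_gen e deg U i).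
Proof. by rewrite alg_gen_single -{1}(mdeg_gen i); exact: homogeneous_single. Qed.

Lemma alg_mul_single f g m1 m2 : admissible deg (madd m1 m2) ->
  alg_mul deg (single f m1) (single g m2)
  = single (fun w => (-1) ^+ koszul deg m1 m2 * (f w * g w)) (madd m1 m2).
Proof.
move=> am; apply/funext => m; apply/funext => w; rewrite /alg_mul.
rewrite (@fsum_seq_cond _ _ _ [:: (m1, m2)]) //; last first.
  move=> [x1 x2] _; rewrite inE xpair_eqE negb_and => /orP[h|h] /=.
    by rewrite single_neq // mul0r mulr0.
  by rewrite [single g _ _]single_neq // !mulr0.
rewrite big_cons big_nil /= !single_eq addr0 eq_sym /single.
have [->|_] := eqVneq m (madd m1 m2); first by rewrite am.
by case: ifP.
Qed.

Lemma in_alg_mul a b : in_alg a -> in_alg b -> in_alg (alg_mul deg a b).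
Proof.
move=> ia ib.
have [r ur ar] := in_AWU_support _ _ _ _ ia; have [s us bs] := in_AWU_support _ _ _ _ ib.
have [_ _ sa] := ia; have [_ _ sb] := ib.
pose t := [seq (x, y) | x <- r, y <- s].
have ut : uniq t by apply: allpairs_uniq => // -[? ?] [? ?].
have mulE m : alg_mul deg a b m = if admissible deg m
    then fun w => \sum_(x <- t | madd x.1 x.2 == m) (-1) ^+ koszul deg x.1 x.2 * (a x.1 w * b x.2 w)
    else cst 0.
  apply/funext => w; rewrite /alg_mul; case: ifP => // _; apply: fsum_seq_cond => // x _ xt.
  have [x1|x1] := boolP (x.1 \in r); last by rewrite ar // mul0r mulr0.
  rewrite bs ?mulr0 //; apply: contra xt => x2.
  by apply/allpairsP; exists x; rewrite -surjective_pairing.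
split.
- apply: (sub_finite_set _ (finite_seq [seq madd x.1 x.2 | x <- t])) => m /= H.
  apply: contrapT => /negP mt; apply: H; rewrite mulE; case: ifP => // _.
  apply/funext => w; rewrite big_seq_cond big1 // => x /andP[xt /eqP xm].
  by move: mt; rewrite -xm (map_f (fun x : monomial * monomial => madd x.1 x.2) xt).
- by move=> m /negbTE am; rewrite mulE am.
- move=> m; rewrite mulE; case: ifP => _; last exact: smooth_fun0.
  apply: smooth_fun_sum => // x _; apply: smooth_funZ => //; exact: smooth_funM.
Qed.

Lemma madd1m m : madd one_mon m = m.
Proof. by apply/ffunP => i; rewrite !ffunE. Qed.

Lemma maddm1 m : madd m one_mon = m.
Proof. by apply/ffunP => i; rewrite !ffunE addn0. Qed.

Lemma koszul1m m : koszul deg one_mon m = 0%N.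
Proof. by rewrite /koszul big1 // => i _; rewrite big1 // => j _; rewrite ffunE. Qed.

Lemma koszulm1 m : koszul deg m one_mon = 0%N.
Proof.
by rewrite /koszul big1 // => i _; rewrite big1 // => j _; rewrite ffunE mul0n muln0.
Qed.

Lemma alg_mul_single1l f b : in_alg b ->
  alg_mul deg (single f one_mon) b = fun m w => f w * b m w.
Proof.
move=> [_ bm _]; apply/funext => m; apply/funext => w; rewrite /alg_mul.
case: ifPn => am; last by rewrite bm // mulr0.
rewrite (@fsum_seq_cond _ _ _ [:: (one_mon, m)]) //.
  by rewrite big_cons big_nil /= madd1m eqxx koszul1m single_eq expr0 mul1r addr0.
move=> [x1 x2] /= <-; rewrite inE xpair_eqE.
have [->|h] := eqVneq x1 one_mon; first by rewrite madd1m eqxx.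
by rewrite single_neq // mul0r mulr0.
Qed.

Lemma alg_mul_single1r g a : in_alg a ->
  alg_mul deg a (single g one_mon) = fun m w => a m w * g w.
Proof.
move=> [_ am _]; apply/funext => m; apply/funext => w; rewrite /alg_mul.
case: ifPn => adm; last by rewrite am // mul0r.
rewrite (@fsum_seq_cond _ _ _ [:: (m, one_mon)]) //.
  by rewrite big_cons big_nil /= maddm1 eqxx koszulm1 single_eq expr0 mul1r addr0.
move=> [x1 x2] /= <-; rewrite inE xpair_eqE.
have [->|h] := eqVneq x2 one_mon; first by rewrite maddm1 eqxx.
by rewrite [single g _ _]single_neq // !mulr0.
Qed.

Context (Q : @prealg R W p -> @prealg R W p) (hQ : is_differential e deg U Q).

(** Multiplication by a function acts coefficientwise. For fixed m and u, the coefficient of m in Q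
    g at u is therefore a point derivation of g, and [point_derivation] applies. *)
Lemma differential_fun f m u : U u -> sfun f ->
  Q (single f one_mon) m u
  = \sum_(i | deg i == 0%N) 'D_('e_i) (f \o param0 e deg) (coord0 e deg u)
      * Q (alg_gen e deg U i) m u.
Proof.
move=> Uu sf; have [Qin Qlin _ Qmul _] := hQ.
have sin g : sfun g -> in_alg (single g one_mon).
  by apply: in_alg_single; exact: admissible_one.
rewrite (point_derivation gr _ _ hgr he U hU0 hU (fun g => Q (single g one_mon) m u) f u) //.
- apply: eq_bigr => i di; congr (_ * Q _ m u).
  by rewrite alg_gen_single /gen_mon di.
- move=> c g h sg sh.
  rewrite (_ : single _ one_mon = alg_lin c (single g one_mon) (single h one_mon)).
    by rewrite Qlin //; exact: sin.
  apply/funext => m'; apply/funext => w; rewrite /single /alg_lin.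
  by case: eqP => // _; rewrite mulr0 addr0.
- move=> g h sg sh.
  rewrite (_ : single _ one_mon = alg_mul deg (single g one_mon) (single h one_mon)); last first.
    rewrite alg_mul_single1l; last exact: sin.
    apply/funext => m'; apply/funext => w; rewrite /single.
    by case: eqP => // _; rewrite mulr0.
  rewrite (Qmul 0%N); [|exact: sin|exact: sin|]; last first.
    by rewrite -mdeg_one; exact: homogeneous_single.
  rewrite /alg_lin alg_mul_single1l; last by apply: Qin; exact: sin.
  rewrite alg_mul_single1r; last by apply: Qin; exact: sin.
  by rewrite expr0 mul1r.
Qed.

End SingleTerms.

(** * Forms obtained by substituting A *)

Section SubstitutedForms.
Context {R : realType} {n : nat} (N : set 'rV[R]_n).
Context (dN : dense_interior N) (starN : star_shaped N).
Context {W : vectType R} (gr : nat -> {vspace W}).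
Context {p : nat} (e : p.-tuple W) (deg : 'I_p -> nat).
Context (hgr : is_grading gr) (he : homogeneous_basis gr e deg).
Context (U : set W) (hU0 : forall w, U w -> w \in gr 0%N) (hU : open_in_W0 e deg U).
Context (A : dform 'rV[R]_n W) (hA : Omega0_over e N gr U A).
Notation in_alg := (in_AWU e deg U).
Notation sfun := (smooth_fun e deg U).
Notation gen := (alg_gen e deg U).
Notation comp := (component e A).
Implicit Types (a b : @prealg R W p) (m : @monomial p) (f g : W -> R).
Implicit Types (x y v : 'rV[R]_n) (vs w : seq 'rV[R]_n).

Lemma whom_component i y : N y -> whom (deg i) (comp i y).
Proof.
move=> Ny w hw; have [[_ Agr _] _] := hA.
apply: (coord_homogeneous gr _ _ hgr he (size w)); last by rewrite eq_sym.
by apply: Agr => //; rewrite addn0.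
Qed.

Lemma form_monomialE m y : form_monomial e A m y = wmon (fun i => comp i y) m.
Proof.
rewrite /form_monomial /wmon.
rewrite (big_morph (fun F : dform 'rV[R]_n R => F y) (id1 := wunit) (op1 := wshuf)) //.
apply: eq_bigr => i _; rewrite /fwedgeX /wpow.
by elim: (m i) => [//|k IH]; rewrite !iterS -IH.
Qed.

Lemma substituteE a y : substitute e a A y = wsubst (fun i => comp i y) (A y [::]) a.
Proof.
apply/funext => w; rewrite /substitute /wsubst; apply: eq_fsbigr => m _.
by rewrite form_monomialE.
Qed.

Lemma smooth_form_component i : smooth_form N (comp i).
Proof. by have [[Af _ _] _] := hA; have [_ _] := Af i. Qed.

Lemma smooth_form_monomial m : smooth_form N (form_monomial e A m).
Proof.
have s1 : smooth_form N form1 by move=> vs; exact: smooth_on_cst.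
apply: (big_ind (fun F => smooth_form N F)) => //; first exact: smooth_form_wedge.
move=> i _; rewrite /fwedgeX; elim: (m i) => [//|k IH]; rewrite iterS.
by apply: smooth_form_wedge => //; exact: smooth_form_component.
Qed.

Lemma param0_component y : N y -> param0 e deg (\row_i comp i y [::]) = A y [::].
Proof.
move=> Ny; have [_ AU] := hA.
rewrite -[RHS](param0_coord0 gr _ _ hgr he _ (hU0 _ (AU _ Ny))).
rewrite /param0; apply: eq_bigr => i di; by rewrite !mxE di.
Qed.

Lemma coord0_component y : N y -> coord0 e deg (A y [::]) = \row_i comp i y [::].
Proof.
move=> Ny; apply/rowP => i; rewrite !mxE; case: eqP => // /eqP di.
by rewrite (whom_component i _ Ny) // eq_sym.
Qed.

Lemma row_component_U y : N y -> (param0 e deg @^-1` U) (\row_i comp i y [::]).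
Proof. by move=> Ny; rewrite /= param0_component //; have [_] := hA; exact. Qed.

Lemma smooth_on_fun f : sfun f -> smooth_on N (fun y => f (A y [::])).
Proof.
move=> [sf _].
apply: (@smooth_on_eq _ _ _ (fun y => (f \o param0 e deg) (\row_i comp i y [::]))).
  by move=> y Ny /=; rewrite param0_component.
apply: (smooth_on_comp _ (param0 e deg @^-1` U)) => //.
  by move=> y Ny; exact: row_component_U.
by move=> i; exact: smooth_form_component.
Qed.

(** The coefficients are those of [differential_fun], at the same point; this lets d and Q be
    compared term by term on functions. *)
Lemma derive_on_fun f y v : sfun f -> N y ->
  derive_on N (fun y => f (A y [::])) y v
  = \sum_(i | deg i == 0%N) 'D_('e_i) (f \o param0 e deg) (coord0 e deg (A y [::]))
      * derive_on N (fun y => comp i y [::]) y v.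
Proof.
move=> [sf _] Ny.
rewrite (@derive_on_eq _ _ _ _ (fun y => (f \o param0 e deg) (\row_i comp i y [::]))); last first.
  by move=> z Nz /=; rewrite param0_component.
rewrite (derive_on_comp _ dN (param0 e deg @^-1` U)) //; last first.
  - by move=> i; exact: smooth_form_component.
  - by move=> z Nz; exact: row_component_U.
rewrite [RHS]big_mkcond; apply: eq_bigr => i _; case: ifPn => di.
  by rewrite coord0_component.
rewrite (@derive_on_eq _ _ _ _ (fun=> 0)) ?derive_on_cst ?mulr0 // => z Nz.
by rewrite (whom_component i _ Nz) // eq_sym.
Qed.

Lemma smooth_form_substitute a : in_alg a -> smooth_form N (substitute e a A).
Proof.
move=> ia w; have [r ur ar] := in_AWU_support _ _ _ _ ia; have [_ _ sa] := ia.
apply: (@smooth_on_eq _ _ _ (fun y => \sum_(m <- r) a m (A y [::]) * form_monomial e A m y w)).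
  move=> y Ny; rewrite substituteE (wsubst_seq _ _ _ _ ur ar).
  by apply: eq_bigr => m _; rewrite form_monomialE.
apply: smooth_on_sum => m _; apply: smooth_onM; last exact: smooth_form_monomial.
exact: smooth_on_fun.
Qed.

Lemma whom_substitute a k y : alg_homogeneous deg k a -> N y ->
  whom k (substitute e a A y).
Proof.
move=> ha Ny; rewrite substituteE.
by apply: (whom_wsubst deg) => // i; exact: whom_component.
Qed.

Lemma substitute_mul a b y : in_alg a -> in_alg b -> N y ->
  substitute e (alg_mul deg a b) A y = wshuf (substitute e a A y) (substitute e b A y).
Proof.
move=> ia ib Ny; rewrite !substituteE; apply: (wsubst_mul e deg U) => // i.
exact: whom_component.
Qed.

Lemma substitute_lin c a b y : in_alg a -> in_alg b ->
  substitute e (alg_lin c a b) A y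
  = fun w => c * substitute e a A y w + substitute e b A y w.
Proof. by move=> ia ib; rewrite !substituteE; exact: (wsubst_lin e deg U). Qed.

Lemma substitute_gen i y : N y -> substitute e (gen i) A y = comp i y.
Proof.
move=> Ny; rewrite substituteE.
apply: (wsubst_gen e deg U) => //; first by move=> j; exact: whom_component.
by have [_] := hA; exact.
Qed.

Lemma substitute0 y : substitute e (fun _ => cst 0) A y = fun=> 0.
Proof. by apply/funext => w; apply: fsbig1 => m _; rewrite mul0r. Qed.

Lemma is_form_wedge (a b : dform 'rV[R]_n R) : is_form N a -> is_form N b -> is_form N (fwedge a b).
Proof.
move=> [ma aa sa] [mb ab sb]; split.
- by move=> x Nx; apply: multilinear_wshuf; [exact: ma|exact: mb].
- by move=> x Nx; apply: alternating_wshuf; [exact: ma|exact: mb|exact: aa|exact: ab].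
- exact: smooth_form_wedge.
Qed.

Lemma is_form_one : is_form N form1.
Proof.
split=> [x _ s1 s2 c u v|x _ s1 s2 s3 v|vs].
- by rewrite /form1 !size_cat /= !addnS /= mulr0 addr0.
- by rewrite /form1 !size_cat /= !addnS.
- exact: smooth_on_cst.
Qed.

Lemma is_form_monomial m : is_form N (form_monomial e A m).
Proof.
apply: (big_ind (is_form N)); first exact: is_form_one.
  by move=> F G; exact: is_form_wedge.
move=> i _; rewrite /fwedgeX; elim: (m i) => [|k IH]; first exact: is_form_one.
rewrite iterS; apply: is_form_wedge => //.
by have [[Af _ _] _] := hA.
Qed.

Lemma is_form_substitute a : in_alg a -> is_form N (substitute e a A).
Proof.
move=> ia; have [r ur ar] := in_AWU_support _ _ _ _ ia.
have E y w : substitute e a A y w = \sum_(m <- r) a m (A y [::]) * form_monomial e A m y w.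
  rewrite substituteE (wsubst_seq _ _ _ _ ur ar).
  by apply: eq_bigr => m _; rewrite form_monomialE.
split; last exact: smooth_form_substitute.
- move=> x Nx s1 s2 c u v; rewrite !E big_distrr -big_split; apply: eq_bigr => m _ /=.
  have [ma _ _] := is_form_monomial m; rewrite (ma x Nx); ring.
- move=> x Nx s1 s2 s3 v; rewrite E big1 // => m _.
  by have [_ aa _] := is_form_monomial m; rewrite (aa x Nx) mulr0.
Qed.

Context (Q : @prealg R W p -> @prealg R W p) (hQ : is_differential e deg U Q).

(* The failure of substitution to intertwine Q and d: a derivation along the
   substitution morphism, hence controlled by its values on generators. *)
Definition defect a : dform 'rV[R]_n R := fun y w =>
  ext_d N (substitute e a A) y w - substitute e (Q a) A y w.

Lemma defect_lin c a b y w : in_alg a -> in_alg b -> N y ->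
  defect (alg_lin c a b) y w = c * defect a y w + defect b y w.
Proof.
move=> ia ib Ny; have [Qin Qlin _ _ _] := hQ; rewrite /defect.
rewrite (@ext_d_eq _ _ _ _ (fun y w => c * substitute e a A y w + substitute e b A y w)); last first.
  by move=> z u _; rewrite substitute_lin.
rewrite ext_d_lin //; try exact: smooth_form_substitute.
by rewrite Qlin // substitute_lin; [ring|exact: Qin|exact: Qin].
Qed.

Lemma defect_mul k a b y w : in_alg a -> in_alg b -> alg_homogeneous deg k a -> N y ->
  defect (alg_mul deg a b) y w
  = fwedge (defect a) (substitute e b A) y w
    + (-1) ^+ k * fwedge (substitute e a A) (defect b) y w.
Proof.
move=> ia ib ha Ny; have [Qin _ _ Qmul _] := hQ; rewrite /defect.
have sa := smooth_form_substitute _ ia; have sb := smooth_form_substitute _ ib.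
have iQa := Qin _ ia; have iQb := Qin _ ib.
rewrite (@ext_d_eq _ _ _ _ (fwedge (substitute e a A) (substitute e b A))); last first.
  by move=> z u Nz; rewrite substitute_mul.
rewrite ext_d_wedge // (whom_wsgn _ _ (whom_substitute _ _ _ ha Ny)) wshufZl.
rewrite (Qmul k) //.
rewrite substitute_lin; [|exact: in_alg_mul|exact: in_alg_mul].
rewrite !substitute_mul //.
set X := substitute e a A y; set Y := substitute e b A y.
set dX := ext_d N (substitute e a A) y; set dY := ext_d N (substitute e b A) y.
set QX := substitute e (Q a) A y; set QY := substitute e (Q b) A y.
transitivity (wshuf (fun w => dX w + - QX w) Y w
  + (-1) ^+ k * wshuf X (fun w => dY w + - QY w) w); last by [].
by rewrite wshufDl wshufDr wshufNl wshufNr; ring.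
Qed.

End SubstitutedForms.

(** * Domination along a ray *)

Section Domination.
Context {R : realType} (kap : R -> R).
Implicit Types (phi psi : R -> R).

(** With [kap] = 0 this says that [phi] vanishes on [0, 1], so both implications of the theorem use
    the same domination argument. *)
Definition dominated phi :=
  exists2 M : R, 0 <= M & forall t, 0 <= t <= 1 -> `|phi t| <= M * kap t.

Lemma dominated_eq phi psi : (forall t, 0 <= t <= 1 -> phi t = psi t) ->
  dominated phi -> dominated psi.
Proof. by move=> E [M M0 H]; exists M => // t t01; rewrite -E // H. Qed.

Lemma dominated0 : dominated (fun=> 0).
Proof. by exists 0 => // t t01; rewrite normr0 mul0r. Qed.

Lemma dominatedD phi psi : dominated phi -> dominated psi ->
  dominated (fun t => phi t + psi t).
Proof.
move=> [M M0 H] [M' M'0 H']; exists (M + M'); first exact: addr_ge0.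
move=> t t01; apply: le_trans (ler_normD _ _) _; rewrite mulrDl.
by apply: lerD; [exact: H|exact: H'].
Qed.

Lemma dominatedM phi psi (C : R) : dominated phi -> 0 <= C ->
  (forall t, 0 <= t <= 1 -> `|psi t| <= C) -> dominated (fun t => psi t * phi t).
Proof.
move=> [M M0 H] C0 HC; exists (C * M); first exact: mulr_ge0.
move=> t t01; rewrite normrM -mulrA; apply: ler_pM => //; [exact: HC|exact: H].
Qed.

Lemma dominated_sum (I : Type) (r : seq I) (P : pred I) (F : I -> R -> R) :
  (forall i, P i -> dominated (F i)) ->
  dominated (fun t => \sum_(i <- r | P i) F i t).
Proof.
move=> hF; elim: r => [|i r IH].
  by apply: dominated_eq dominated0 => t _; rewrite big_nil.
case Pi : (P i); last by apply: dominated_eq IH => t _; rewrite big_cons Pi.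
by apply: dominated_eq (dominatedD _ _ (hF i Pi) IH) => t _; rewrite big_cons Pi.
Qed.

Lemma icont_bounded (f : R -> R) : icont 0 1 f ->
  exists2 C, 0 <= C & forall t, 0 <= t <= 1 -> `|f t| <= C.
Proof.
move=> cf; have [c _ H] := EVT_max ler01 (icont_abs _ _ _ cf).
by exists `|f c| => // t t01; apply: H; rewrite in_itv.
Qed.

End Domination.

(** * The defect is dominated by the curvature along a ray *)

Section DefectDomination.
Context {R : realType} {n : nat} (N : set 'rV[R]_n).
Context (dN : dense_interior N) (starN : star_shaped N).
Context {W : vectType R} (gr : nat -> {vspace W}).
Context {p : nat} (e : p.-tuple W) (deg : 'I_p -> nat).
Context (hgr : is_grading gr) (he : homogeneous_basis gr e deg).
Context (U : set W) (hU0 : forall w, U w -> w \in gr 0%N) (hU : open_in_W0 e deg U).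
Context (Q : @prealg R W p -> @prealg R W p) (hQ : is_differential e deg U Q).
Context (A : dform 'rV[R]_n W) (hA : Omega0_over e N gr U A).
Context (kap : R -> R).
Context (x : 'rV[R]_n) (Nx : N x) (L : seq 'rV[R]_n).
Notation in_alg := (in_AWU e deg U).
Notation sfun := (smooth_fun e deg U).
Notation gen := (alg_gen e deg U).
Notation comp := (component e A).
Notation dft := (defect N e A Q).
Implicit Types (F G : dform 'rV[R]_n R).

(** Words over a fixed list are stable under taking subwords, hence the condition is stable under
    wedge products with smooth forms, which are bounded on the ray. *)
Definition ray_dominated F := forall w, {subset w <= L} ->
  dominated kap (fun t => F (t *: x) w).

Lemma ray_dominated_eq F G : (forall y w, N y -> F y w = G y w) ->
  ray_dominated F -> ray_dominated G.
Proof.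
move=> FG hF w wL; apply: dominated_eq (hF w wL) => t t01.
by apply: FG; exact: star_ray.
Qed.

Lemma ray_dominatedD F G : ray_dominated F -> ray_dominated G ->
  ray_dominated (fun y w => F y w + G y w).
Proof. by move=> hF hG w wL; apply: dominatedD; [exact: hF|exact: hG]. Qed.

Lemma ray_dominatedM F (f : 'rV[R]_n -> R) : smooth_on N f -> ray_dominated F ->
  ray_dominated (fun y w => f y * F y w).
Proof.
move=> sf hF w wL; have [C C0 HC] := icont_bounded _ (icont_on_ray _ starN _ _ sf Nx).
exact: (dominatedM _ _ _ C (hF w wL) C0 HC).
Qed.

Lemma ray_dominatedZ F (c : R) : ray_dominated F ->
  ray_dominated (fun y w => c * F y w).
Proof. by apply: ray_dominatedM; exact: smooth_on_cst. Qed.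

Lemma ray_dominated_sum (I : Type) (r : seq I) (P : pred I) (F : I -> dform 'rV[R]_n R) :
  (forall i, P i -> ray_dominated (F i)) ->
  ray_dominated (fun y w => \sum_(i <- r | P i) F i y w).
Proof. by move=> hF w wL; apply: dominated_sum => i Pi; exact: hF. Qed.

Lemma ray_dominated_wedgel F G : ray_dominated F -> smooth_form N G ->
  ray_dominated (fwedge F G).
Proof.
move=> hF sG w wL; apply: dominated_sum => m _.
have mL (s : seq bool) : {subset mask s w <= L} by move=> v /mem_mask /wL.
have [C C0 HC] := icont_bounded _ (icont_on_ray _ starN _ _ (sG (mask (map negb m) w)) Nx).
have := dominatedM _ _ _ C (hF _ (mL m)) C0 HC.
move=> /(dominatedM _ _ (fun=> (-1) ^+ shuffle_inv m) `|(-1) ^+ shuffle_inv m|).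
move=> /(_ (normr_ge0 _))/(_ (fun _ _ => lexx _)); apply: dominated_eq => t _.
by rewrite [_ * F _ _]mulrC.
Qed.

Lemma ray_dominated_wedger F G : ray_dominated F -> smooth_form N G ->
  ray_dominated (fwedge G F).
Proof.
move=> hF sG w wL; apply: dominated_sum => m _.
have mL (s : seq bool) : {subset mask s w <= L} by move=> v /mem_mask /wL.
have [C C0 HC] := icont_bounded _ (icont_on_ray _ starN _ _ (sG (mask m w)) Nx).
have := dominatedM _ _ _ C (hF _ (mL (map negb m))) C0 HC.
move=> /(dominatedM _ _ (fun=> (-1) ^+ shuffle_inv m) `|(-1) ^+ shuffle_inv m|).
by move=> /(_ (normr_ge0 _))/(_ (fun _ _ => lexx _)).
Qed.

(* The components of dA - C_Q(A). *)
Definition curv i : dform 'rV[R]_n R := fun y w =>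
  ext_d N (comp i) y w - substitute e (Q (gen i)) A y w.

Context (hcurv : forall i, ray_dominated (curv i)).

Lemma defect_gen i y w : dft (gen i) y w = curv i y w.
Proof.
rewrite /defect /curv; congr (_ - _); apply: ext_d_eq => z u Nz.
by rewrite (substitute_gen N gr e deg hgr he U A hA).
Qed.

Lemma substitute_single f y : substitute e (single f one_mon) A y
  = fun w => f (A y [::]) * wunit w.
Proof.
rewrite substituteE (wsubst_seq _ _ _ [:: one_mon]) //.
  by apply/funext => w; rewrite big_seq1 single_eq wmon0.
by move=> m; rewrite inE => h; rewrite single_neq.
Qed.

(** The chain rules for d and for Q have the same partial derivatives of f as coefficients;
    subtracting them leaves the curvatures of the degree 0 coordinates. *)
Lemma defect_fun f y w : sfun f -> N y ->
  dft (single f one_mon) y w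
  = \sum_(i | deg i == 0%N)
      'D_('e_i) (f \o param0 e deg) (coord0 e deg (A y [::])) * curv i y w.
Proof.
move=> sf Ny; have [_ AU] := hA; have Uy := AU _ Ny.
rewrite /curv; under [RHS]eq_bigr do rewrite mulrBr.
rewrite sumrB /defect; congr (_ - _).
  rewrite (@ext_d_eq _ _ _ _ (fun y w => f (A y [::]) * wunit w)); last first.
    by move=> z u _; rewrite substitute_single.
  rewrite /ext_d; under [RHS]eq_bigr do rewrite big_distrr /=.
  rewrite exchange_big; apply: eq_bigr => k _ /=.
  set u := take k w ++ drop k.+1 w; set v := w`_k.
  have sfA := smooth_on_fun N gr e deg hgr he U hU0 hU A hA _ sf.
  rewrite (@derive_on_eq _ _ _ _ (fun z => wunit u * f (A z [::]))); last first.
    by move=> z _; rewrite mulrC.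
  rewrite derive_onZ // (derive_on_fun N dN gr e deg hgr he U hU0 hU A hA) //.
  rewrite !big_distrr; apply: eq_bigr => i /eqP di /=.
  (* A component of degree 0 is a pure 0-form, so it vanishes on every nonempty word. *)
  rewrite (@derive_on_eq _ _ _ (fun z => comp i z u) (fun z => wunit u * comp i z [::])); last first.
    move=> z Nz; have hw := whom_component N gr e deg hgr he U A hA i z Nz.
    by case: (u) => [|u0 u']; rewrite /wunit /= ?mul1r // mul0r hw // di.
  rewrite derive_onZ //; first by ring.
  by have := smooth_form_component N gr e U A hA i; apply.
have [Qin _ _ _ _] := hQ.
have i1 : in_alg (single f one_mon) by apply: in_alg_single => //; exact: admissible_one.
have iQ1 := Qin _ i1.
have iQg i := Qin _ (in_alg_gen gr e deg he U hU i).
rewrite substituteE /wsubst.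
have [r [ur r1 rg]] : exists r : seq (@monomial p), [/\ uniq r,
    forall m, m \notin r -> Q (single f one_mon) m = cst 0 &
    forall i m, m \notin r -> Q (gen i) m = cst 0].
  have [r ur hr] := in_AWU_support _ _ _ _ iQ1.
  have /choice[s hs] : forall i, exists s : seq (@monomial p),
      forall m, m \notin s -> Q (gen i) m = cst 0.
    by move=> i; have [s _ hs] := in_AWU_support _ _ _ _ (iQg i); exists s.
  exists (undup (r ++ flatten [seq s i | i <- enum 'I_p])); split.
  - exact: undup_uniq.
  - by move=> m; rewrite mem_undup mem_cat negb_or => /andP[/hr].
  - move=> i m; rewrite mem_undup mem_cat negb_or => /andP[_ h]; apply: hs.
    by apply: contra h => ms; apply/flatten_mapP; exists i => //; rewrite mem_enum.
have -> : \sum_(m \in [set: @monomial p]) Q (single f one_mon) m (A y [::]) *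
    wmon (fun i => comp i y) m w = wsubst (fun i => comp i y) (A y [::]) (Q (single f one_mon)) w by [].
rewrite (wsubst_seq _ _ _ _ ur r1).
under [RHS]eq_bigr => i _ do rewrite substituteE (wsubst_seq _ _ _ _ ur (rg i)) big_distrr /=.
rewrite exchange_big; apply: eq_bigr => m _ /=.
rewrite (differential_fun gr e deg hgr he U hU0 hU Q hQ) // big_distrl.
by apply: eq_bigr => i _ /=; rewrite mulrA.
Qed.

Lemma smooth_on_partial f i : sfun f ->
  smooth_on N (fun y => 'D_('e_i) (f \o param0 e deg) (coord0 e deg (A y [::]))).
Proof.
move=> [sf _].
apply: (@smooth_on_eq _ _ _ (fun y => ('D_('e_i) (f \o param0 e deg)) (\row_j comp j y [::]))).
  by move=> y Ny /=; rewrite (coord0_component N gr e deg hgr he U A hA).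
apply: (smooth_on_comp _ (param0 e deg @^-1` U) (fun z => 'D_('e_i) (f \o param0 e deg) z)) => //.
- exact: smooth_derive.
- by move=> y Ny; exact: (row_component_U N gr e deg hgr he U hU0 A hA).
- by move=> j; exact: (smooth_form_component N gr e U A hA).
Qed.

Lemma defect_fun_dominated f : sfun f -> ray_dominated (dft (single f one_mon)).
Proof.
move=> sf; apply: (ray_dominated_eq (fun y w => \sum_(i | deg i == 0%N)
      'D_('e_i) (f \o param0 e deg) (coord0 e deg (A y [::])) * curv i y w)).
  by move=> y w Ny; rewrite defect_fun.
apply: ray_dominated_sum => i _; apply: ray_dominatedM => //.
exact: smooth_on_partial.
Qed.

Lemma defect_mul_dominated k a b : in_alg a -> in_alg b -> alg_homogeneous deg k a ->
  ray_dominated (dft a) -> ray_dominated (dft b) ->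
  ray_dominated (dft (alg_mul deg a b)).
Proof.
move=> ia ib ha da db.
apply: (ray_dominated_eq (fun y w => fwedge (dft a) (substitute e b A) y w
    + (-1) ^+ k * fwedge (substitute e a A) (dft b) y w)).
  by move=> y w Ny; rewrite (defect_mul N dN gr e deg hgr he U hU0 hU A hA Q hQ k).
have sS c : in_alg c -> smooth_form N (substitute e c A).
  exact: (smooth_form_substitute N gr e deg hgr he U hU0 hU A hA).
apply: ray_dominatedD; first by apply: ray_dominated_wedgel => //; exact: sS.
by apply: ray_dominatedZ; apply: ray_dominated_wedger => //; exact: sS.
Qed.

(** Induction on the total exponent, splitting off one generator. Choosing the first one that occurs
    makes the Koszul sign trivial. *)
Lemma defect_monomial_dominated m : admissible deg m ->
  ray_dominated (dft (single (patch (cst 0) U (fun=> 1)) m)).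
Proof.
have [k] := ubnP (\sum_i m i)%N; elim: k m => // k IH m mk am.
have [m0|] := eqVneq m one_mon.
  by rewrite m0; apply: defect_fun_dominated; exact: smooth_fun_cst.
move=> mn0.
have [i0 hi0] : exists i, m i != 0%N.
  apply/existsP; apply: contra_neqT mn0 => /existsPn H.
  by apply/ffunP => i; rewrite ffunE; apply/eqP; have := H i; rewrite negbK.
have [i' hi' imin] : exists2 i : 'I_p, m i != 0%N & forall j : 'I_p, (j < i)%N -> m j = 0%N.
  case: (@arg_minnP _ i0 (fun j => m j != 0%N) (fun j : 'I_p => j : nat) hi0) => j hj jmin; exists j => // l lj.
  by apply/eqP; apply: contraTT lj => /jmin; rewrite -leqNgt.
have di : deg i' != 0%N.
  move/forallP: am => /(_ i')/andP[+ _]; apply: contraTneq => ->.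
  by rewrite eqxx implyTb.
pose m' : @monomial p := [ffun j => m j - (j == i')]%N.
have mE : madd (gen_mon deg i') m' = m.
  apply/ffunP => j; rewrite /gen_mon (negbTE di) !ffunE; have [->|_] := eqVneq j i'.
    by rewrite /= subnKC // lt0n.
  by rewrite /= subn0.
have am' : admissible deg m'.
  apply/forallP => j; move/forallP: am => /(_ j)/andP[h1 h2]; rewrite ffunE.
  apply/andP; split; apply/implyP => dj.
    by move/implyP: h1 => /(_ dj)/eqP ->.
  by apply: leq_trans (leq_subr _ _) _; exact: (implyP h2).
have mk' : (\sum_j m' j < k)%N.
  rewrite -ltnS; apply: leq_trans mk; rewrite ltnS.
  rewrite (bigD1 i') //= [X in (_ < X)%N](bigD1 i') //= !ffunE eqxx.
  rewrite -addSn leq_add //; first by rewrite subn1 prednK // lt0n.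
  by apply: leq_sum => j _; rewrite ffunE leq_subr.
have kz : koszul deg (gen_mon deg i') m' = 0%N.
  rewrite /koszul big1 // => j _; rewrite big1 // => l lj.
  rewrite /gen_mon (negbTE di) !ffunE; have [ji|_] := eqVneq j i'; last by rewrite !mul0n.
  by rewrite imin ?sub0n ?mul0n ?muln0 // -ji.
have s1 : sfun (patch (cst 0) U (fun=> 1 : R)) by exact: smooth_fun_cst.
have E : single (patch (cst 0) U (fun=> 1)) m
    = alg_mul deg (gen i') (single (patch (cst 0) U (fun=> 1)) m').
  rewrite alg_gen_single (negbTE di) alg_mul_single ?mE // kz.
  congr single; apply/funext => w; rewrite expr0 mul1r /patch.
  by case: ifP; rewrite ?mulr1 ?mulr0.
rewrite E; apply: (defect_mul_dominated (deg i')).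
- exact: (in_alg_gen gr).
- exact: in_alg_single.
- exact: homogeneous_gen.
- by apply: (ray_dominated_eq (curv i')) => // y w _; rewrite defect_gen.
- exact: IH.
Qed.

(** Induction on a list containing the support: each step splits off one term, written as a function
    times an ordered monomial, two cases already settled. *)
Lemma defect_dominated a : in_alg a -> ray_dominated (dft a).
Proof.
move=> ia; have [r ur ar] := in_AWU_support _ _ _ _ ia.
elim: r a ia ur ar => [|m r IH] a ia /= ur ar.
  have -> : a = single (fun=> 0) one_mon.
    apply/funext => m; rewrite ar // /single; by case: eqP.
  by apply: defect_fun_dominated; exact: smooth_fun0.
case/andP: ur => mr ur; have [afin aadm asm] := ia.
pose a' : prealg := fun m' => if m' == m then cst 0 else a m'.
have ia' : in_alg a'.
  split.
  - apply: sub_finite_set afin => m' /=; rewrite /a'; by case: eqP.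
  - by move=> m' nm; rewrite /a'; case: eqP => // _; exact: aadm.
  - by move=> m'; rewrite /a'; case: eqP => _ //; exact: smooth_fun0.
have da' : ray_dominated (dft a').
  apply: IH => // m' m'r; rewrite /a'; case: eqP => // /eqP mm.
  by apply: ar; rewrite inE negb_or mm.
have [am|nam] := boolP (admissible deg m); last first.
  suff -> : a = a' by [].
  by apply/funext => m'; rewrite /a'; case: eqP => // ->; exact: aadm.
pose T := alg_mul deg (single (a m) one_mon) (single (patch (cst 0) U (fun=> 1)) m).
have i0 : in_alg (single (a m) one_mon) by apply: in_alg_single => //; exact: admissible_one.
have i1 : in_alg (single (patch (cst 0) U (fun=> 1)) m).
  by apply: in_alg_single => //; exact: smooth_fun_cst.
have iT : in_alg T by exact: in_alg_mul.
have E : a = alg_lin 1 T a'.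
  apply/funext => m'; apply/funext => w; rewrite /alg_lin /T (alg_mul_single1l e deg U) //.
  rewrite mul1r /a' /single; case: eqP => [->|_]; last by rewrite mulr0 add0r.
  rewrite /= addr0 /patch; case: ifPn => [_|]; first by rewrite mulr1.
  by rewrite notin_setE mulr0 => nU; have [_] := asm m; apply.
rewrite E; apply: (ray_dominated_eq (fun y w => 1 * dft T y w + dft a' y w)).
  by move=> y w Ny; rewrite (defect_lin N dN gr e deg hgr he U hU0 hU A hA Q hQ).
apply: ray_dominatedD => //; apply: ray_dominatedZ.
apply: (defect_mul_dominated 0%N) => //.
- by rewrite -(mdeg_one deg); exact: homogeneous_single.
- exact: defect_fun_dominated.
- exact: defect_monomial_dominated.
Qed.

End DefectDomination.

(** * The integral equation *)

Section Gronwall.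
Context {R : realType}.

Lemma itg_exp k : itg 0 1 (fun t : R => t ^+ k) = k.+1%:R^-1.
Proof.
have k0 : k.+1%:R != 0 :> R by rewrite pnatr_eq0.
have D (t : R) : is_derive t 1 (fun s : R => k.+1%:R^-1 * s ^+ k.+1) (t ^+ k).
  have := @is_deriveX R _ (@id R) k.+1 t 1 1 (is_derive_id t 1).
  move=> /(is_deriveZ k.+1%:R^-1).
  by rewrite exprfctE /GRing.scale /= mulr1 mulKf.
have := FTC_ray (fun s : R => k.+1%:R^-1 * s ^+ k.+1) (fun t : R => t ^+ k).
rewrite expr1n expr0n mulr1 mulr0 subr0; apply.
- by apply: icontZ; exact: icont_exp.
- exact: icont_exp.
Qed.

(** After rescaling, s times the integral of kap(t s) over [0, 1] is the integral of kap over
    [0, s]. Iterating the inequality bounds kap(s) by C (M s)^k / k! for every k, a general term of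
    a convergent exponential series. *)
Lemma gronwall (kap : R -> R) (M : R) : 0 <= M ->
  (forall s, 0 <= s <= 1 -> 0 <= kap s) ->
  (forall s, 0 <= s <= 1 -> icont 0 1 (fun t => kap (t * s))) ->
  (forall s, 0 <= s <= 1 -> kap s <= M * (s * itg 0 1 (fun t => kap (t * s)))) ->
  forall s, 0 <= s <= 1 -> kap s = 0.
Proof.
move=> M0 kap0 ckap Hkap.
have [C C0 HC] : exists2 C, 0 <= C & forall t, 0 <= t <= 1 -> `|kap t| <= C.
  apply: icont_bounded; apply: icont_eq (ckap 1 _) => [t _|]; first by rewrite mulr1.
  by rewrite ler01 lexx.
have ts01 (t s : R) : 0 <= t <= 1 -> 0 <= s <= 1 -> 0 <= t * s <= 1.
  by move=> /andP[t0 t1] /andP[s0 s1]; rewrite mulr_ge0 // mulr_ile1.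
have bound k s : 0 <= s <= 1 -> kap s <= C * ((M * s) ^+ k / k`!%:R).
  elim: k s => [|k IH] s s01.
    by rewrite expr0 fact0 divr1 mulr1; apply: le_trans (HC s s01); exact: ler_norm.
  apply: le_trans (Hkap s s01) _; have /andP[s0 _] := s01.
  have c1 : icont 0 1 (fun t : R => C * ((M * s) ^+ k / k`!%:R) * t ^+ k).
    by apply: icontZ; exact: icont_exp.
  apply: (@le_trans _ _ (M * (s * itg 0 1 (fun t : R => C * ((M * s) ^+ k / k`!%:R) * t ^+ k)))).
    apply: ler_wpM2l => //; apply: ler_wpM2l => //; apply: le_itg => //.
      exact: ckap.
    move=> t t01; apply: le_trans (IH _ (ts01 t s t01 s01)) _.
    rewrite [M * (t * s)]mulrCA exprMn; set X := (M * s) ^+ k; rewrite le_eqVlt; apply/orP; left; apply/eqP; ring.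
  rewrite itgZ ?itg_exp; last exact: icont_exp.
  rewrite exprS factS natrM invfM; rewrite le_eqVlt; apply/orP; left; apply/eqP; ring.
move=> s s01; apply/eqP; rewrite eq_le kap0 // andbT leNgt; apply/negP => pos.
have cv : C * exp_coeff (M * s) k @[k --> \oo] --> C * 0.
  by apply: cvgMr; exact: cvg_series_cvg_0 (is_cvg_series_exp_coeff _).
rewrite mulr0 in cv.
have [k _ Hk] := cvgr_lt _ cv _ pos.
have := Hk k (leqnn k); rewrite /= ltNge; apply/negP/negPn.
by have := bound k s s01; rewrite /exp_coeff.
Qed.

End Gronwall.

Section Words.
Context {T : eqType}.

Fixpoint words (L : seq T) k : seq (seq T) :=
  if k is k'.+1 then [::] :: [seq v :: w | v <- L, w <- words L k'] else [:: [::]].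

Lemma mem_words (L : seq T) k w : {subset w <= L} -> (size w <= k)%N -> w \in words L k.
Proof.
elim: k w => [|k IH] [|v w] wL //= wk.
rewrite inE /=; apply/allpairsP; exists (v, w); split=> //=.
  by apply: wL; rewrite mem_head.
by apply: IH => // u uw; apply: wL; rewrite inE uw orbT.
Qed.

End Words.

Lemma is_formB {R : realType} {n : nat} (N : set 'rV[R]_n) (a b : dform 'rV[R]_n R) :
  is_form N a -> is_form N b -> is_form N (fun x vs => a x vs - b x vs).
Proof.
move=> [ma aa sa] [mb ab sb]; split.
- by move=> x Nx s1 s2 c u v; rewrite (ma x Nx) (mb x Nx); ring.
- by move=> x Nx s1 s2 s3 v; rewrite (aa x Nx) (ab x Nx) subrr.
- move=> vs; apply: smooth_onD; first exact: sa.
  exact: (smooth_formN _ _ sb).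
Qed.

(** * The integral equation for the curvature *)

Section IntegralForm.
Context {R : realType} {n : nat} (N : set 'rV[R]_n).
Context (dN : dense_interior N) (starN : star_shaped N).
Context {W : vectType R} (gr : nat -> {vspace W}).
Context {p : nat} (e : p.-tuple W) (deg : 'I_p -> nat).
Context (hgr : is_grading gr) (he : homogeneous_basis gr e deg).
Context (U : set W) (hU0 : forall w, U w -> w \in gr 0%N) (hU : open_in_W0 e deg U).
Context (Q : @prealg R W p -> @prealg R W p) (hQ : is_differential e deg U Q).
Context (A : dform 'rV[R]_n W) (hA : Omega0_over e N gr U A).
Notation gen := (alg_gen e deg U).
Notation comp := (component e A).
Notation C i := (substitute e (Q (gen i)) A).
Notation curvA := (curv N e deg U Q A).

Lemma in_alg_Qgen i : in_AWU e deg U (Q (gen i)).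
Proof. by have [Qin _ _ _ _] := hQ; apply: Qin; exact: (in_alg_gen gr). Qed.

Lemma is_form_C i : is_form N (C i).
Proof.
apply: (is_form_substitute N gr e deg hgr he U hU0 hU A hA).
exact: in_alg_Qgen.
Qed.

Lemma whom_C i y : N y -> whom (deg i).+1 (C i y).
Proof.
move=> Ny; apply: (whom_substitute N gr e deg hgr he U A hA) => //.
have [_ _ Qhom _ _] := hQ; apply: Qhom; first exact: (in_alg_gen gr).
exact: homogeneous_gen.
Qed.

Lemma ext_d_C i y w : N y -> ext_d N (C i) y w = defect N e A Q (Q (gen i)) y w.
Proof.
move=> Ny; have [_ _ _ _ QQ] := hQ.
by rewrite /defect QQ ?substitute0 ?subr0 //; exact: (in_alg_gen gr).
Qed.

Lemma smooth_form_curv i : smooth_form N (curvA i).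
Proof.
move=> w; have sc := smooth_form_component N gr e U A hA i.
have [_ _ sC] := is_form_C i.
apply: smooth_onD; first exact: smooth_form_ext_d.
exact: (smooth_formN _ _ sC).
Qed.

Lemma whom_curv i y : N y -> whom (deg i).+1 (curvA i y).
Proof.
move=> Ny w hw; rewrite /curv whom_C // (whom_ext_d N dN (deg i)) ?subr0 //.
by move=> z Nz; exact: (whom_component N gr e deg hgr he U A hA).
Qed.

Definition B_comp i : dform 'rV[R]_n R := fun x vs => comp i x vs - homotopy_op (C i) x vs.

Lemma ext_d_B i x vs : N x ->
  ext_d N (B_comp i) x vs = curvA i x vs + homotopy_op (ext_d N (C i)) x vs.
Proof.
move=> Nx; have sc := smooth_form_component N gr e U A hA i.
have fC := is_form_C i; have [mC _ sC] := fC.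
have sh : smooth_form N (homotopy_op (C i)) by exact: smooth_form_homotopy.
rewrite /B_comp (ext_dD N dN) //; last exact: smooth_formN.
rewrite ext_dN //.
have := homotopy_formula N dN starN _ x vs fC Nx.
have -> : (size vs == 0%N)%:R * C i 0 vs = 0.
  case: vs => [|v vs]; last by rewrite mul0r.
  by rewrite whom_C ?mulr0 //; exact: (proj1 starN).
by rewrite subr0 /curv => <-; ring.
Qed.

Lemma homotopy_dC i x vs : N x -> homotopy_op (ext_d N (C i)) x vs
  = itg 0 1 (fun t => t ^+ size vs * ext_d N (C i) (t *: x) (x :: vs)).
Proof.
move=> Nx; apply: (homotopy_opE N starN) => // y Ny.
have [mC _ sC] := is_form_C i.
exact: multilinear_ext_d.
Qed.

Lemma closed_of_curv0 : (forall i x vs, N x -> curvA i x vs = 0) ->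
  forall i x vs, N x -> ext_d N (B_comp i) x vs = 0.
Proof.
move=> H i x vs Nx; rewrite ext_d_B // H // add0r homotopy_dC // -[RHS](itg0 0 1).
apply: eq_itg => t t01; have Ntx := star_ray _ starN _ _ Nx t01.
(* Vanishing curvature is domination by 0, which the defect inherits. *)
have hc j : ray_dominated (fun=> 0) x (x :: vs) (curvA j).
  by move=> w _; exists 0 => // s s01; rewrite H ?normr0 ?mulr0 //; exact: star_ray.
have := defect_dominated N dN starN gr e deg hgr he U hU0 hU Q hQ A hA (fun=> 0)
 x Nx (x :: vs) hc _ (in_alg_Qgen i) (x :: vs) (fun _ => id).
move=> [M _ /(_ t t01)]; rewrite mulr0 normr_le0 => /eqP E.
by rewrite ext_d_C // E mulr0.
Qed.

Lemma curv0_of_closed : (forall i x vs, N x -> ext_d N (B_comp i) x vs = 0) ->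
  forall i x vs, N x -> curvA i x vs = 0.
Proof.
move=> H.
have HE i y w : N y -> curvA i y w = - homotopy_op (ext_d N (C i)) y w.
  by move=> Ny; apply/eqP; rewrite -addr_eq0 -ext_d_B // H.
move=> i x vs Nx.
pose L := x :: vs.
(* Large enough for the word vs itself and for every form degree in which some curvature component
   can be nonzero; longer words contribute 0. *)
pose d := maxn (size vs) (\max_i (deg i).+1).
pose kap (t : R) := \sum_(j < p) \sum_(w <- words L d | all (mem L) w) `|curvA j (t *: x) w|.
have kap0 t : 0 <= kap t.
  by apply: sumr_ge0 => j _; apply: sumr_ge0 => w _; exact: normr_ge0.
have le_kap j w t : {subset w <= L} -> (size w <= d)%N -> `|curvA j (t *: x) w| <= kap t.
  move=> wL wd; have wm := mem_words _ _ _ wL wd.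
  rewrite /kap (bigD1 j) //= (big_rem w) //= ifT; last exact/allP.
  rewrite -addrA lerDl addr_ge0 //; first by apply: sumr_ge0 => u _; exact: normr_ge0.
  by apply: sumr_ge0 => k _; apply: sumr_ge0 => u _; exact: normr_ge0.
have hc j : ray_dominated kap x L (curvA j).
  move=> w wL; exists 1 => // t t01; rewrite mul1r.
  have [wd|wd] := leqP (size w) d; first exact: le_kap.
  rewrite whom_curv ?normr0 //; first exact: star_ray.
  apply: contraTN wd => /eqP ->; rewrite -leqNgt.
  by apply: leq_trans (leq_maxr _ _); exact: (leq_bigmax j).
have ckap s : 0 <= s <= 1 -> icont 0 1 (fun t => kap (t * s)).
  move=> s01; have Nsx := star_ray _ starN _ _ Nx s01.
  apply: icont_sum => j _; apply: icont_sum => w _; apply: icont_abs.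
  apply: icont_eq (icont_on_ray _ starN _ _ (smooth_form_curv j w) Nsx) => t _.
  by rewrite scalerA.
(* Domination is now used in the other direction: bounding [kap] by a multiple of [K2] is the
   hypothesis of [gronwall]. *)
pose K2 (s : R) := s * itg 0 1 (fun t => kap (t * s)).
have [M M0 HM] : dominated K2 kap.
  apply: dominated_sum => j _; apply: dominated_sum => w /allP wL.
  (* The letter inserted by the homotopy operator already belongs to L, so the system closes. *)
  have xwL : {subset x :: w <= L}.
    by move=> v; rewrite inE => /orP[/eqP ->|/wL //]; rewrite mem_head.
  have [M M0 HM] := defect_dominated N dN starN gr e deg hgr he U hU0 hU Q hQ A hA kap
    x Nx L hc _ (in_alg_Qgen j) (x :: w) xwL.
  exists M => // s s01; rewrite normr_id.
  have Nsx := star_ray _ starN _ _ Nx s01; have /andP[s0 s1] := s01.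
  have [mC _ sC] := is_form_C j.
  have sdC := smooth_form_ext_d N dN _ sC.
  have cG : icont 0 1 (fun t => t ^+ size w * ext_d N (C j) (t *: (s *: x)) (x :: w)).
    exact: (icont_on_ray_exp _ starN _ _ _ (sdC (x :: w)) Nsx).
  rewrite HE // normrN homotopy_dC //.
  (* At the point s x the inserted vector is s x; its factor s becomes the one in front of the
     integral in [K2]. *)
  have -> : itg 0 1 (fun t => t ^+ size w * ext_d N (C j) (t *: (s *: x)) (s *: x :: w))
      = s * itg 0 1 (fun t => t ^+ size w * ext_d N (C j) (t *: (s *: x)) (x :: w)).
    rewrite -itgZ //; apply: eq_itg => t t01.
    have mD : multilinear (ext_d N (C j) (t *: (s *: x))).
      by apply: multilinear_ext_d => //; exact: star_ray.
    by rewrite (multilinearZ _ [::] w s x mD) /=; ring.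
  rewrite normrM ger0_norm // /K2 mulrCA ler_wpM2l // -itgZ; last exact: ckap.
  apply: le_trans (abs_itg _ _ _ cG) _.
  apply: le_itg; [exact: icont_abs|by apply: icontZ; exact: ckap|].
  move=> t t01; have /andP[t0 t1] := t01.
  have ts01 : 0 <= t * s <= 1 by rewrite mulr_ge0 // mulr_ile1.
  have := HM _ ts01; rewrite -ext_d_C; last exact: star_ray.
  rewrite scalerA normrM; apply: le_trans.
  by rewrite ler_piMl // normrX ger0_norm // exprn_ile1.
have kz := gronwall kap M M0 (fun s _ => kap0 s) ckap (fun s s01 => le_trans (ler_norm _) (HM s s01)).
have vL : {subset vs <= L} by move=> v vvs; rewrite inE vvs orbT.
have := le_kap i vs 1 vL (leq_maxl _ _).
rewrite kz ?ler01 ?lexx // scale1r normr_le0 => /eqP; exact.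
Qed.

End IntegralForm.
Theorem theorem4p1 (R : realType) (n : nat) (N : set 'rV[R]_n)
  (hN : submanifold_with_corners N) (hstar : star_shaped N)
  (W : vectType R) (gr : nat -> {vspace W}) (hgr : is_grading gr)
  (p : nat) (e : p.-tuple W) (deg : 'I_p -> nat)
  (he : homogeneous_basis gr e deg)
  (U : set W) (hU0 : forall w, U w -> w \in gr 0%N) (hU : open_in_W0 e deg U)
  (Q : @prealg R W p -> @prealg R W p)
  (hQ : is_differential e deg U Q)
  (A : dform 'rV[R]_n W) (hA : Omega0_over e N gr U A) :
  let B := form_sub A (wh e (C_of e deg U Q A)) in
  Omega e N gr 0 B /\
  (form_eq N (wd e N A) (C_of e deg U Q A) <->
   form_eq N (wd e N B) form0).
Proof.
move=> B.
have dN := submanifold_dense_interior N hN.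
pose Bc := B_comp e deg U Q A.
have compC i : component e (C_of e deg U Q A) i = substitute e (Q (alg_gen e deg U i)) A.
  apply/funext => x; apply/funext => vs; exact: (coord_sum_basis gr e deg he).
have compB i : component e B i = Bc i.
  apply/funext => x; apply/funext => vs; rewrite /component /B /form_sub linearB /=.
  rewrite /wh /of_components (coord_sum_basis gr e deg he) compC.
  by [].
have fC := is_form_C N gr e deg hgr he U hU0 hU Q hQ A hA.
have wdE X (i : 'I_p) x vs : coord e i (wd e N X x vs) = ext_d N (component e X i) x vs.
  exact: (coord_sum_basis gr e deg he).
have coord_inj (u v : W) : (forall i, coord e i u = coord e i v) -> u = v.
  move=> E; rewrite [u](sum_coord_basis gr e deg he) [v](sum_coord_basis gr e deg he).
  by apply: eq_bigr => i _; rewrite E.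
split.
  have [[fA _ _] _] := hA; split => //.
  - move=> i; rewrite compB; apply: is_formB => //.
    by apply: is_form_homotopy => //; exact: fC.
  (* C^i has form degree deg i + 1 and h lowers it by one, so B^i has the same pure degree as
     A^i. *)
  - move=> x vs k Nx; rewrite addn0 => vk; apply: (homogeneous_coord gr e deg he) => i ik.
    have := congr1 (fun F => F x vs) (compB i); rewrite /component => ->.
    rewrite /Bc /B_comp (whom_component N gr e deg hgr he U A hA) ?vk ?[k == _]eq_sym // sub0r.
    rewrite (whom_homotopy N hstar (deg i)) ?oppr0 ?vk ?[k == _]eq_sym //.
      by have [] := fC i.
    by move=> y Ny; exact: (whom_C N gr e deg hgr he U hU Q hQ A hA).
have L1 : form_eq N (wd e N A) (C_of e deg U Q A) <->
    (forall i x vs, N x -> curv N e deg U Q A i x vs = 0).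
  split=> [E i x vs Nx|E x Nx].
    have := congr1 (fun F => coord e i (F vs)) (E x Nx); rewrite /= wdE /curv => ->.
    by rewrite -compC subrr.
  apply/funext => vs; apply: coord_inj => i; rewrite wdE.
  have /eqP := E i x vs Nx; rewrite subr_eq0 -compC => /eqP ->.
  by [].
have L2 : form_eq N (wd e N B) form0 <->
    (forall i x vs, N x -> ext_d N (Bc i) x vs = 0).
  split=> [E i x vs Nx|E x Nx].
    have := congr1 (fun F => coord e i (F vs)) (E x Nx); rewrite /= wdE compB => ->.
    by rewrite linear0.
  by apply/funext => vs; apply: coord_inj => i; rewrite wdE compB E // linear0.
apply: (iff_trans L1); apply: iff_sym; apply: (iff_trans L2); split.
  exact: (curv0_of_closed N dN hstar gr e deg hgr he U hU0 hU Q hQ A hA).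
exact: (closed_of_curv0 N dN hstar gr e deg hgr he U hU0 hU Q hQ A hA).
Qed.
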